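(* Let $m\in\mathbb{R}$ and let $\sigma\in M^{m}_{\rho,\Lambda}(\mathbb{Z}^n\times\mathbb{T}^n)$ be $M$-elliptic. Then $$\mathcal{H}^{m,2}_\Lambda(\mathbb{Z}^n)=\mathrm{Dom}(T_{\sigma,0}),$$ where $T_{\sigma,0}$ is the minimal operator of $T_\sigma$ on $\ell^2(\mathbb{Z}^n)$.
   Context: Write $\mathbb{T}^n=\mathbb{R}^n/\mathbb{Z}^n$ and $\mathbb{N}_0=\{0,1,2,\dots\}$. For $f$ on $\mathbb{Z}^n$ set $\Delta_{k_j}f(k)=f(k+e_j)-f(k)$ ($e_j$ the $j$-th unit vector) and $\Delta_k^\alpha=\Delta_{k_1}^{\alpha_1}\cdots\Delta_{k_n}^{\alpha_n}$ for $\alpha\in\mathbb{N}_0^n$. On smooth functions on $\mathbb{T}^n$ set $D_x^{(\beta)}=D_{x_1}^{(\beta_1)}\cdots D_{x_n}^{(\beta_n)}$, where $D_{x_j}^{(0)}=I$ and $D_{x_j}^{(\ell)}=\prod_{r=0}^{\ell-1}\big(\frac{1}{2\pi i}\frac{\partial}{\partial x_j}-r\big)$ for $\ell\ge1$. Write $k^\gamma=k_1^{\gamma_1}\cdots k_n^{\gamma_n}$. Weight function: $\Lambda:\mathbb{Z}^n\to(0,\infty)$ is a weight function if there are positive constants $\mu_0\le\mu_1\le\mu$ and $C_0,C_1$ with $C_0(1+|k|)^{\mu_0}\le\Lambda(k)\le C_1(1+|k|)^{\mu_1}$ for all $k\in\mathbb{Z}^n$, and for all $\alpha\in\mathbb{N}_0^n$,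 $\gamma\in\{0,1\}^n$ there is $C_{\alpha,\gamma}>0$ with $|k^\gamma\Delta_k^{\alpha+\gamma}\Lambda(k)|\le C_{\alpha,\gamma}\Lambda(k)^{1-|\alpha|/\mu}$ for all $k\in\mathbb{Z}^n$. Fix such a $\Lambda$ (with its constants) and $\rho\in(0,1/\mu]$. Symbol classes: for $m\in\mathbb{R}$, $S^m_{\rho,\Lambda}(\mathbb{Z}^n\times\mathbb{T}^n)$ is the set of $\sigma:\mathbb{Z}^n\times\mathbb{T}^n\to\mathbb{C}$, smooth in $x$ for every $k$, such that for all $\alpha,\beta\in\mathbb{N}_0^n$ there is a constant $C>0$ with $|D_x^{(\beta)}\Delta_k^\alpha\sigma(k,x)|\le C\Lambda(k)^{m-\rho|\alpha|}$ for all $(k,x)$. $M^m_{\rho,\Lambda}(\mathbb{Z}^n\times\mathbb{T}^n)$ is the set of $\sigma:\mathbb{Z}^n\times\mathbb{T}^n\to\mathbb{C}$, smooth in $x$ for every $k$, such that $k^\gamma\Delta_k^\gamma\sigma(k,x)\in S^m_{\rho,\Lambda}(\mathbb{Z}^n\times\mathbb{T}^n)$ for all $\gamma\in\{0,1\}^n$. Operators: $\mathcal{S}(\mathbb{Z}^n)$ is the space of rapidly decreasing functions on $\mathbb{Z}^n$. For $f\in\mathcal{S}(\mathbb{Z}^n)$ put $\widehat f(x)=\sum_{k\in\mathbb{Z}^n}e^{-2\pi i k\cdot x}f(k)$ and $T_\sigma f(k)=\int_{\mathbb{T}^n}e^{2\pi i k\cdot x}\sigma(k,x)\widehat f(x)\,dx$.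 $M$-ellipticity: $\sigma\in M^m_{\rho,\Lambda}(\mathbb{Z}^n\times\mathbb{T}^n)$ is $M$-elliptic if there are positive constants $C,R_1$ with $|\sigma(k,x)|\ge C\Lambda(k)^m$ for all $x\in\mathbb{T}^n$ and all $k\in\mathbb{Z}^n$ with $|k|\ge R_1$. Weighted Sobolev space: for $s\in\mathbb{R}$, $\mathcal{H}^{s,2}_\Lambda(\mathbb{Z}^n)$ is the space of $w\in\mathcal{S}'(\mathbb{Z}^n)$ (functions on $\mathbb{Z}^n$ of at most polynomial growth) with $\|w\|_{s,2,\Lambda}=\big(\sum_{k\in\mathbb{Z}^n}\Lambda(k)^{2s}|w(k)|^2\big)^{1/2}<\infty$. Minimal operator: $T_\sigma$, viewed as an operator in $\ell^2(\mathbb{Z}^n)$ with domain $\mathcal{S}(\mathbb{Z}^n)$, is closable, and $T_{\sigma,0}$ is its closure: $\mathrm{Dom}(T_{\sigma,0})$ consists of all $g\in\ell^2(\mathbb{Z}^n)$ for which there is a sequence $(\phi_j)$ in $\mathcal{S}(\mathbb{Z}^n)$ with $\phi_j\to g$ and $T_\sigma\phi_j\to f$ in $\ell^2(\mathbb{Z}^n)$ for some $f\in\ell^2(\mathbb{Z}^n)$; then $T_{\sigma,0}g=f$.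
   Formalization: For m<0 the stated equality fails, since the weighted Sobolev space is not contained in ℓ²; the theorem proves that its intersection with ℓ² equals Dom(T_{σ,0}) for every real m, and the equality as stated for m≥0. *)

(* Defs.v *)
From HB Require Import structures.
From mathcomp Require Import all_boot all_order all_algebra.
From mathcomp Require Import complex.
From mathcomp Require Import all_classical all_reals all_analysis.

Set Implicit Arguments.
Unset Strict Implicit.
Unset Printing Implicit Defensive.

Import Order.TTheory GRing.Theory Num.Theory.
Import numFieldNormedType.Exports.
Import ComplexField.Normc.

Local Open Scope classical_set_scope.
Local Open Scope complex_scope.
Local Open Scope ring_scope.

(* Points of Z^n are row vectors 'rV[int]_n. A function on the torus
   T^n = R^n/Z^n is a function on 'rV[R]_n satisfying [torus_periodic]. *)

Section lattice.
Variable n : nat.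
Implicit Types (j : 'I_n) (a : 'I_n -> nat) (k : 'rV[int]_n).

Definition mlen a : nat := (\sum_j a j)%N.

Definition zmonomial a k : int := \prod_j (k 0 j) ^+ (a j).

Definition dif (V : zmodType) j (f : 'rV[int]_n -> V) : 'rV[int]_n -> V :=
  fun k => f (k + delta_mx 0 j) - f k.

Definition difs (V : zmodType) a (f : 'rV[int]_n -> V) : 'rV[int]_n -> V :=
  foldr (fun j g => iter (a j) (dif j) g) f (enum 'I_n).

(* g is the indicator multi-index of a subset of the coordinates, i.e.
   g in {0,1}^n *)
Definition zero_one (g : 'I_n -> nat) : Prop := forall j, (g j <= 1)%N.

End lattice.

Section norms.
Variables (R : realType) (n : nat).
Implicit Types (k : 'rV[int]_n) (x : 'rV[R]_n).

Definition znorm k : R := Num.sqrt (\sum_j (k 0 j)%:~R ^+ 2).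

Definition zdot k x : R := \sum_j (k 0 j)%:~R * x 0 j.

(* e^{2 pi i t} *)
Definition e2pi (t : R) : R[i] := cos (2 * pi * t) +i* sin (2 * pi * t).

End norms.

Section torus.
Variables (R : realType) (n : nat).
Implicit Types (g : 'rV[R]_n -> R[i]) (j : 'I_n).

Definition torus_periodic g : Prop :=
  forall (l : 'rV[int]_n) x, g (x + map_mx intr l) = g x.

Definition repart g : 'rV[R]_n -> R := fun x => complex.Re (g x).
Definition impart g : 'rV[R]_n -> R := fun x => complex.Im (g x).

Definition pderiv j g : 'rV[R]_n -> R[i] := fun x =>
  'D_(delta_mx 0 j) (repart g) x +i* 'D_(delta_mx 0 j) (impart g) x.

(* C^infinity: every iterated partial derivative exists and is continuous. *)
Definition smooth g : Prop := forall s : seq 'I_n,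
  let h := foldr pderiv g s in
  [/\ continuous (repart h), continuous (impart h) &
      forall j x, derivable (repart h) x (delta_mx 0 j) /\
                  derivable (impart h) x (delta_mx 0 j)].

Definition torus_smooth g : Prop := torus_periodic g /\ smooth g.

(* D_{x_j}^{(l)} = prod_{r < l} ((2 pi i)^-1 d/dx_j - r), the factors being
   applied in the order r = 0, ..., l - 1 (they commute). *)
Fixpoint Dx1 j (l : nat) g : 'rV[R]_n -> R[i] :=
  if l is r.+1 then
    let h := Dx1 j r g in
    fun x => (2 * pi%:C * 'i%C)^-1 * pderiv j h x - r%:R * h x
  else g.

Definition Dx (b : 'I_n -> nat) g : 'rV[R]_n -> R[i] :=
  foldr (fun j h => Dx1 j (b j) h) g (enum 'I_n).

End torus.

(* Integral over the torus, computed over the fundamental domain [0,1]^n as an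
   iterated Lebesgue integral; it is only applied to continuous functions. *)
Fixpoint torus_Rint (R : realType) (n : nat) : ('rV[R]_n -> R) -> R :=
  match n return ('rV[R]_n -> R) -> R with
  | 0%N => fun f => f 0
  | p.+1 => fun f =>
      (\int[lebesgue_measure]_(t in `[0%R, 1%R])
         torus_Rint (fun y : 'rV[R]_p =>
           f (row_mx (t%:M : 'rV[R]_1) y : 'rV[R]_(1 + p))))%R
  end.

Definition torus_int (R : realType) (n : nat) (g : 'rV[R]_n -> R[i]) : R[i] :=
  torus_Rint (repart g) +i* torus_Rint (impart g).

(* Sum over Z^n of an absolutely summable complex family: positive and
   negative parts of the real and imaginary parts are summed separately. *)
Definition zRsum (R : realType) (n : nat) (u : 'rV[int]_n -> R) : R :=
  fine (\esum_(k in setT) (Num.max (u k) 0)%:E -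
        \esum_(k in setT) (Num.max (- u k) 0)%:E)%E.

Definition zsum (R : realType) (n : nat) (u : 'rV[int]_n -> R[i]) : R[i] :=
  zRsum (fun k => complex.Re (u k)) +i* zRsum (fun k => complex.Im (u k)).

Section symbols.
Variables (R : realType) (n : nat).
Implicit Types (L : 'rV[int]_n -> R) (sigma : 'rV[int]_n -> 'rV[R]_n -> R[i]).

Definition weight_function (mu0 mu1 mu : R) L : Prop :=
  [/\ [/\ 0 < mu0, mu0 <= mu1 & mu1 <= mu],
      forall k, 0 < L k,
      exists C0 C1 : R, [/\ 0 < C0, 0 < C1 & forall k,
        C0 * (1 + znorm R k) `^ mu0 <= L k <= C1 * (1 + znorm R k) `^ mu1] &
      forall a g : 'I_n -> nat, zero_one g ->
        exists2 C : R, 0 < C & forall k,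
          `|(zmonomial g k)%:~R * difs (fun j => (a j + g j)%N) L k|
            <= C * L k `^ (1 - (mlen a)%:R / mu)].

Definition symbol_S (rho : R) L (m : R) sigma : Prop :=
  (forall k, torus_smooth (sigma k)) /\
  forall a b : 'I_n -> nat, exists2 C : R, 0 < C & forall k x,
    normc (Dx b (fun y => difs a (fun l => sigma l y) k) x)
      <= C * L k `^ (m - rho * (mlen a)%:R).

Definition symbol_M (rho : R) L (m : R) sigma : Prop :=
  (forall k, torus_smooth (sigma k)) /\
  forall g : 'I_n -> nat, zero_one g ->
    symbol_S rho L m
      (fun k x => (zmonomial g k)%:~R * difs g (fun l => sigma l x) k).

Definition M_elliptic L (m : R) sigma : Prop :=
  exists C R1 : R, [/\ 0 < C, 0 < R1 & forall k x,
    R1 <= znorm R k -> C * L k `^ m <= normc (sigma k x)].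

End symbols.

Section operators.
Variables (R : realType) (n : nat).
Implicit Types (f g w : 'rV[int]_n -> R[i]) (L : 'rV[int]_n -> R)
  (sigma : 'rV[int]_n -> 'rV[R]_n -> R[i]).

Definition schwartz : set ('rV[int]_n -> R[i]) :=
  [set f | forall N : nat, exists C : R, forall k,
     (1 + znorm R k) ^+ N * normc (f k) <= C].

Definition tempered : set ('rV[int]_n -> R[i]) :=
  [set w | exists (N : nat) (C : R), forall k,
     normc (w k) <= C * (1 + znorm R k) ^+ N].

Definition l2norm w : \bar R :=
  ((\esum_(k in setT) (normc (w k) ^+ 2)%:E) `^ 2^-1)%E.

Definition ell2 : set ('rV[int]_n -> R[i]) := [set w | (l2norm w < +oo)%E].

Definition sobolev_norm L (s : R) w : \bar R :=
  ((\esum_(k in setT) (L k `^ (2 * s) * normc (w k) ^+ 2)%:E) `^ 2^-1)%E.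

Definition sobolev L (s : R) : set ('rV[int]_n -> R[i]) :=
  [set w | tempered w /\ (sobolev_norm L s w < +oo)%E].

Definition fourier f : 'rV[R]_n -> R[i] :=
  fun x => zsum (fun k => e2pi (- zdot k x) * f k).

Definition pseudo_op sigma f : 'rV[int]_n -> R[i] :=
  fun k => torus_int (fun x => e2pi (zdot k x) * sigma k x * fourier f x).

Definition l2_cvg (u : nat -> 'rV[int]_n -> R[i]) w : Prop :=
  ell2 w /\ (fun j => l2norm (fun k => u j k - w k)) @ \oo --> 0%E.

(* [minimal_graph sigma g f] : g is in Dom(T_{sigma,0}) and T_{sigma,0} g = f *)
Definition minimal_graph sigma g f : Prop :=
  exists phi : nat -> 'rV[int]_n -> R[i],
    [/\ forall j, schwartz (phi j),
        l2_cvg phi g &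
        l2_cvg (fun j => pseudo_op sigma (phi j)) f].

Definition minimal_dom sigma : set ('rV[int]_n -> R[i]) :=
  [set g | exists f, minimal_graph sigma g f].

End operators.

(* Main.v *)
Require Import Defs.
From mathcomp Require Import all_boot all_order all_algebra.
From mathcomp Require Import complex.
From mathcomp Require Import all_classical all_reals all_analysis.
From mathcomp Require Import ring lra zify.

Set Implicit Arguments.
Unset Strict Implicit.
Unset Printing Implicit Defensive.

Import Order.TTheory GRing.Theory Num.Theory.
Import numFieldNormedType.Exports.
Import ComplexField.Normc.

Local Open Scope classical_set_scope.
Local Open Scope ring_scope.

(** Write [a(k, q)] for the Fourier coefficient of [sigma k] at [q] and
    [e_k] for the character [x |-> e^{2 pi i k.x}]; on rapidly decreasing
    functions the operator is the matrix with entries [a(k, l - k)].  Powers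
    of [weight q], the product of the [1 + |q_j|], measure all decay.

    Upper bound.  Smoothness of the symbol in [x] gives
    [|a(k, q)| <= C L(k)^m weight(q)^-P] for every [P]
    ([symbol_fourier_coef]).  The estimate on the first differences of [L]
    makes [L^{1/mu}] Lipschitz, so that [L(k)^t / L(l)^t] is at most a
    constant times a power of [weight(k - l)] for every real [t] ([peetre]).  Hence
    [|a(k, l - k)| <= C L(l)^m weight(k - l)^-2] ([kernel_bound]), and Young's
    inequality [young] yields
    [||T phi||^2 <= C sum_k L(k)^{2m} |phi(k)|^2] ([kernel_l2]).  Applied to
    the difference between [g] and its truncations to boxes, this shows that
    every [g] in the Sobolev space and in l^2 lies in the domain of the
    closure ([sobolev_minimal_dom]).

    Lower bound.  For large [k] the modulus of [sigma k] is at least a constant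
    times [L(k)^m]; put [b = 1 / sigma k].  Then [phi(k)], which is the integral of
    [e_k phi^], is also the integral of [b (sigma_k e_k phi^)].  Expanding [b]
    into its Fourier series bounds [|phi(k)|] by the sum over [q] of [|b^(q)|]
    times the modulus of the integral of [e_{k+q} sigma_k phi^].  Replacing
    [sigma_k] by [sigma_{k+q}] turns this integral into [T phi (k + q)], and
    the error involves first differences of the symbol only, which are of
    order [m - rho] ([frozen_symbol_error]).  As [rho > 0] and [L] is bounded
    below, such an error is absorbed into the left-hand side ([absorb]).  The
    result is the a priori estimate [elliptic_estimate],
    [||phi||_m <= C (||T phi|| + ||phi||)], which passes to limits in the
    graph norm and puts the domain of the closure inside the Sobolev space
    ([minimal_dom_sobolev]).

    Fourier analysis on the torus is derived from finite sums.  The iterated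
    integral of a function that is Lipschitz in each coordinate is the limit
    of its averages over the grids of mesh [1 / M] ([torus_Rint_grid_avg]).
    On a grid, Fourier inversion is the orthogonality of finitely many
    characters ([grid_avg_inversion]), and iterated differences of step
    [1 / M] bound the grid coefficients by negative powers of the weight,
    uniformly in [M] ([grid_coef_decay]).  Both facts pass to the limit,
    which gives decay of Fourier coefficients ([fourier_coef_decay]) and
    inversion in the form [torus_int_mul_le]. *)

(** * Riemann sums for the torus integral *)

Lemma div_natr_small (R : realType) (C e : R) : 0 < e ->
  exists N : nat, forall M, (N <= M)%N -> C / M.+1%:R <= e.
Proof.
move=> e0; exists (Num.truncn (C / e)) => M NM.
rewrite ler_pdivrMr ?ltr0n// mulrC -ler_pdivrMr// ltW//.
by rewrite (lt_le_trans (truncnS_gt _))// ler_nat ltnS.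
Qed.

Section RiemannSums.
Variable R : realType.
Implicit Types (f : R -> R) (C : R).
Local Notation mu := (@lebesgue_measure R).

Lemma lipschitz_continuous f C :
  (forall s t, `|f t - f s| <= C * `|t - s|) -> continuous f.
Proof.
move=> fC s; apply/cvgrPdist_le => e e0.
have C1 : 0 < `|C| + 1 by rewrite ltr_wpDl.
near=> t; rewrite (le_trans (fC _ _))//.
rewrite (@le_trans _ _ ((`|C| + 1) * `|s - t|))//.
  by rewrite ler_wpM2r// (le_trans (ler_norm _))// lerDl.
rewrite -ler_pdivlMl// ltW//; near: t.
by apply: cvgr_dist_lt => //; rewrite mulr_gt0// invr_gt0.
Unshelve. all: by end_near. Qed.

(** The mean value theorem for the indefinite integral.  Starting
    the integral at [-1] keeps [0] and [1] in the interior of the interval of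
    definition, so that no one-sided derivative occurs. *)
Lemma Rintegral_increment f (a b : R) : continuous f -> -1 < a -> a < b -> b < 2 ->
  exists2 c, a <= c <= b &
    \int[mu]_(t in `[(-1)%R, b]) f t - \int[mu]_(t in `[(-1)%R, a]) f t
      = f c * (b - a).
Proof.
move=> cf a1 ab b2.
have itf : mu.-integrable `[(-1)%R, 2%R] (EFin \o f).
  apply: continuous_compact_integrable; first exact: segment_compact.
  exact: continuous_subspaceT.
pose G (x : R) : R := \int[mu]_(t in `[(-1)%R, x]) f t.
have dG x : x \in `[a, b] -> derivable G x 1 /\ derive1 G x = f x.
  rewrite in_itv/= => /andP[ax xb].
  apply: (@continuous_FTC1 _ f (BLeft (-1)) x 2) => //.
  + exact: le_lt_trans xb b2.
  + by rewrite /= lte_fin (lt_le_trans a1).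
  + exact: cf.
have [||c] := @MVT_segment R G f a b (ltW ab).
- move=> x xab; have [|d1 <-] := dG x; first exact: subset_itv_oo_cc.
  by rewrite derive1E; apply: derivableP.
- by apply: derivable_within_continuous => x /dG[].
- by rewrite in_itv/= => cab e; exists c.
Qed.

Lemma Rintegral01 f : continuous f ->
  \int[mu]_(t in `[0%R, 1%R]) f t =
  \int[mu]_(t in `[(-1)%R, 1%R]) f t - \int[mu]_(t in `[(-1)%R, 0%R]) f t.
Proof.
move=> cf.
have itf : mu.-integrable `[(-1)%R, 1%R] (EFin \o f).
  apply: continuous_compact_integrable; first exact: segment_compact.
  exact: continuous_subspaceT.
rewrite (@Rintegral_itvB _ f (BLeft (-1)) (BRight 1) 0) ?bnd_simp//.
rewrite Rintegral_itv_obnd_cbnd//.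
by apply: integrableS itf => //; apply: subset_itvr; rewrite bnd_simp.
Qed.

(** Each cell of the partition contributes its length times a value of
    [f] at a point of the cell, and the Lipschitz condition moves that point to
    the left end of the cell. *)
Lemma riemann_sum f C (M : nat) :
  (forall s t, `|f t - f s| <= C * `|t - s|) ->
  `|\int[mu]_(t in `[0%R, 1%R]) f t
     - M.+1%:R^-1 * \sum_(i < M.+1) f (i%:R / M.+1%:R)| <= C / M.+1%:R.
Proof.
move=> fC; have cf := lipschitz_continuous fC.
have C0 : 0 <= C.
  by have := fC 0 1; rewrite subr0 normr1 mulr1; apply: le_trans.
have M0 : 0 < M.+1%:R :> R by rewrite ltr0n.
rewrite Rintegral01//.
pose G (x : R) : R := \int[mu]_(t in `[(-1)%R, x]) f t.
have -> : \int[mu]_(t in `[(-1)%R, 1%R]) f t - \int[mu]_(t in `[(-1)%R, 0%R]) f t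
    = \sum_(i < M.+1) (G (i.+1%:R / M.+1%:R) - G (i%:R / M.+1%:R)).
  rewrite -(big_mkord xpredT
    (fun i => G (i.+1%:R / M.+1%:R) - G (i%:R / M.+1%:R))).
  by rewrite (telescope_sumr (fun i => G (i%:R / M.+1%:R)))// divff ?gt_eqF// mul0r.
rewrite mulr_sumr -sumrB (le_trans (ler_norm_sum _ _ _))//.
have -> : C / M.+1%:R = \sum_(i < M.+1) (C / M.+1%:R) / M.+1%:R.
  by rewrite sumr_const card_ord -[RHS]mulr_natr divfK// gt_eqF.
apply: ler_sum => i _.
have step : i.+1%:R / M.+1%:R - i%:R / M.+1%:R = M.+1%:R^-1 :> R.
  by rewrite -mulrBl -natrB// subSnn mul1r.
have [||||c /andP[c1 c2] e] := @Rintegral_increment f (i%:R / M.+1%:R) (i.+1%:R / M.+1%:R) => //.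
- by rewrite (@lt_le_trans _ _ 0)// divr_ge0.
- by rewrite -subr_gt0 step invr_gt0.
- by rewrite (@le_lt_trans _ _ 1) ?ltr1n// ler_pdivrMr// mul1r ler_nat.
rewrite [G _ - G _]e step; set v := M.+1%:R^-1.
have -> : f c * v - v * f (i%:R * v) = (f c - f (i%:R * v)) * v by ring.
have v0 : 0 < v by rewrite invr_gt0.
rewrite normrM (gtr0_norm v0) ler_pM2r// (le_trans (fC _ _))// ler_wpM2l//.
by rewrite ger0_norm ?subr_ge0// -[leRHS]step lerD2r.
Qed.

End RiemannSums.

Section GridAverages.
Variables (R : realType).

(** The index [M] stands for [M + 1] points per direction, which excludes
    the empty grid. *)
Definition gridpt n M (a : {ffun 'I_n -> 'I_M.+1}) : 'rV[R]_n :=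
  \row_j ((a j)%:R / M.+1%:R).

Definition grid_avg (K : fieldType) n M (f : 'rV[R]_n -> K) : K :=
  M.+1%:R ^- n * \sum_a f (gridpt (M := M) a).

Lemma grid_avg0 (K : fieldType) M (f : 'rV[R]_0 -> K) : grid_avg M f = f 0.
Proof.
rewrite /grid_avg expr0 invr1 mul1r (big_pred1 [ffun => ord0]) => [|a].
  by congr f; apply/rowP => -[].
by apply/esym/eqP/ffunP => -[].
Qed.

(** The bijection that splits off the first coordinate of a multi-index;
    it matches the recursion of the iterated integral. *)
Definition ffun_cons n (T : finType) (p : T * {ffun 'I_n -> T}) :
    {ffun 'I_n.+1 -> T} :=
  [ffun j => if unlift ord0 j is Some i then p.2 i else p.1].

Lemma ffun_cons_bij n (T : finType) : bijective (@ffun_cons n T).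
Proof.
exists (fun a : {ffun 'I_n.+1 -> T} =>
  (a ord0, [ffun i : 'I_n => a (lift ord0 i)]) : T * {ffun 'I_n -> T}) => [[t a]|a] /=.
  rewrite /ffun_cons !ffunE unlift_none; congr (_, _).
  by apply/ffunP => i; rewrite !ffunE liftK.
apply/ffunP => j; rewrite !ffunE /=.
by case: unliftP => [i ->|->] //; rewrite ffunE.
Qed.

Lemma grid_avgS (K : fieldType) n M (f : 'rV[R]_n.+1 -> K) :
  grid_avg M f = M.+1%:R^-1 * \sum_(i < M.+1)
    grid_avg M (fun y : 'rV[R]_n =>
      f (row_mx ((i%:R / M.+1%:R)%:M : 'rV[R]_1) y : 'rV[R]_(1 + n))).
Proof.
rewrite /grid_avg -mulr_sumr mulrA exprS invfM; congr (_ * _).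
rewrite (reindex (@ffun_cons n 'I_M.+1)) /=; last first.
  by have [g g1 g2] := @ffun_cons_bij n 'I_M.+1; exists g => a _.
rewrite pair_big /=; apply: eq_bigr => -[i a] _; congr f.
apply/rowP => j; rewrite /gridpt !mxE ffunE /=.
case: splitP => k jk.
  rewrite ord1 !mxE eqxx mulr1n; case: unliftP => // l jl.
  by move: jk; rewrite jl ord1.
rewrite !mxE; case: unliftP => [l jl|jl].
  by congr ((a _)%:R / _); apply: val_inj; move: jk; rewrite jl /= /bump leq0n => -[].
by move: jk; rewrite jl.
Qed.

(** A Lipschitz condition one coordinate at a time: stable under freezing
    coordinates, and equivalent to the usual one up to the constant. *)
Definition lip_coordR n (C : R) (f : 'rV[R]_n -> R) :=
  forall j x h, `|f (x + h *: delta_mx 0 j) - f x| <= C * `|h|.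

Lemma le_grid_avg n M (f g : 'rV[R]_n -> R) :
  (forall x, f x <= g x) -> grid_avg M f <= grid_avg M g.
Proof.
by move=> fg; rewrite ler_wpM2l ?invr_ge0 ?exprn_ge0 ?ler_sum.
Qed.

Lemma grid_avg_cst (K : numFieldType) n M (c : K) :
  grid_avg M (fun _ : 'rV[R]_n => c) = c.
Proof.
rewrite /grid_avg sumr_const card_ffun !card_ord -[X in _ * X]mulr_natl natrX mulKf//.
Qed.

Lemma grid_avgB (K : fieldType) n M (f g : 'rV[R]_n -> K) :
  grid_avg M (fun x => f x - g x) = grid_avg M f - grid_avg M g.
Proof. by rewrite /grid_avg sumrB mulrBr. Qed.

Lemma grid_avg_norm n M (f : 'rV[R]_n -> R) (B : R) :
  (forall x, `|f x| <= B) -> `|grid_avg M f| <= B.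
Proof.
move=> fB; rewrite ler_norml -{1}(grid_avg_cst n M (- B)) -{2}(grid_avg_cst n M B).
by apply/andP; split; apply: le_grid_avg => x; have := fB x; rewrite ler_norml => /andP[].
Qed.

Lemma cons_rowD n (t h : R) (y : 'rV[R]_n) :
  (row_mx ((t + h)%:M : 'rV[R]_1) y : 'rV[R]_(1 + n)) =
  (row_mx (t%:M : 'rV[R]_1) y + h *: delta_mx 0 ord0 : 'rV[R]_n.+1).
Proof.
apply/rowP => j; rewrite !mxE; case: splitP => k jk.
  rewrite ord1 !mxE eqxx !mulr1n.
  have -> : j = ord0 by apply: val_inj; rewrite /= jk ord1.
  by rewrite eqxx mulr1.
case: (j =P _) => [j0|_]; last by rewrite mulr0 addr0.
by move: jk; rewrite j0.
Qed.

Lemma row_consD n (t h : R) (y : 'rV[R]_n) i :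
  (row_mx (t%:M : 'rV[R]_1) (y + h *: delta_mx 0 i) : 'rV[R]_(1 + n)) =
  (row_mx (t%:M : 'rV[R]_1) y + h *: delta_mx 0 (lift ord0 i) : 'rV[R]_n.+1).
Proof.
apply/rowP => j; rewrite !mxE; case: splitP => k jk.
  rewrite !mxE; have -> : j = ord0 by apply: val_inj; rewrite /= jk ord1.
  by rewrite (negPf (neq_lift _ _)) andbF mulr0 addr0.
rewrite !mxE /=; congr (_ + _ * (nat_of_bool _)%:R).
apply/eqP/eqP => e; apply: val_inj; first by rewrite /= jk e.
by move: jk; rewrite e => -[].
Qed.

Lemma lip_coordR_ge0 n (C : R) (f : 'rV[R]_n.+1 -> R) : lip_coordR C f -> 0 <= C.
Proof. by move=> /(_ ord0 0 1); rewrite normr1 mulr1; apply: le_trans. Qed.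

(** Induction on the dimension.  The inner integral is Lipschitz in the
    outer variable because it is a limit of grid averages, which are; the
    one-dimensional Riemann sum then handles the outer integral.  Linearity and
    boundedness of the torus integral follow from those of the averages. *)
Lemma torus_Rint_grid_avg n (C : R) (f : 'rV[R]_n -> R) M : lip_coordR C f ->
  `|torus_Rint f - grid_avg M f| <= n%:R * C / M.+1%:R.
Proof.
elim: n f M => [|n IH] f M fC; first by rewrite grid_avg0 subrr normr0 !mul0r.
have C0 := lip_coordR_ge0 fC.
pose g t (y : 'rV[R]_n) := f (row_mx (t%:M : 'rV[R]_1) y : 'rV[R]_(1 + n)).
have gC t : lip_coordR C (g t).
  by move=> j y h; rewrite /g row_consD; exact: fC.
have FC s t : `|torus_Rint (g t) - torus_Rint (g s)| <= C * `|t - s|.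
  apply/ler_addgt0Pr => e e0.
  have [N /(_ N (leqnn N)) Ne] := div_natr_small (n%:R * C) (divr_gt0 e0 (ltr0n _ 2)).
  have h1 := IH (g t) N (gC t); have h2 := IH (g s) N (gC s).
  have h3 : `|grid_avg N (g t) - grid_avg N (g s)| <= C * `|t - s|.
    rewrite -grid_avgB; apply: grid_avg_norm => y; rewrite /g.
    by have -> : t = s + (t - s) by [ring|]; rewrite cons_rowD addrAC subrr add0r; exact: fC.
  have -> : torus_Rint (g t) - torus_Rint (g s) =
     (torus_Rint (g t) - grid_avg N (g t)) + (grid_avg N (g t) - grid_avg N (g s))
      - (torus_Rint (g s) - grid_avg N (g s)) by ring.
  rewrite (le_trans (ler_normB _ _))//.
  rewrite (le_trans (lerD (ler_normD _ _) (lexx _)))//.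
  rewrite (le_trans (lerD (lerD (le_trans h1 Ne) h3) (le_trans h2 Ne)))//.
  by rewrite (addrC (e / 2)) -addrA -splitr.
rewrite grid_avgS /=.
have h1 := riemann_sum M FC.
set S := \sum_(i < M.+1) grid_avg _ _.
set T := \sum_(i < M.+1) torus_Rint _ in h1.
have h2 : `|M.+1%:R^-1 * T - M.+1%:R^-1 * S| <= n%:R * C / M.+1%:R.
  rewrite -mulrBr normrM gtr0_norm ?invr_gt0 ?ltr0n// ler_pdivrMl ?ltr0n//.
  rewrite /S /T -sumrB (le_trans (ler_norm_sum _ _ _))//.
  apply: (@le_trans _ _ (\sum_(i < M.+1) (n%:R * C / M.+1%:R))).
    by apply: ler_sum => i _; exact: (IH (g (i%:R / M.+1%:R)) M (gC _)).
  by rewrite sumr_const card_ord -[leLHS]mulr_natl.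
rewrite (le_trans (ler_distD (M.+1%:R^-1 * T) _ _))//.
have -> : n.+1%:R = n%:R + 1 :> R by rewrite natr1.
by rewrite mulrDl mul1r mulrDl [leRHS]addrC lerD.
Qed.

End GridAverages.

(** * Modulus, complex torus integral and characters *)

Section ComplexModulus.
Variable R : realType.
Implicit Types z w : R[i]%C.

Lemma normc_ge0 z : 0 <= normc z.
Proof. by case: z => a b; exact: sqrtr_ge0. Qed.

Lemma ler_normcD z w : normc (z + w) <= normc z + normc w.
Proof.
have := ler_normD z w.
by rewrite -[`|z|]/((normc z)%:C)%C -[`|w|]/((normc w)%:C)%C
  -[`|z + w|]/((normc (z + w))%:C)%C -rmorphD lecR.
Qed.

Lemma normcN z : normc (- z) = normc z.
Proof. by case: z => a b; rewrite /normc /= !sqrrN. Qed.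

Lemma ler_normcB z w : normc (z - w) <= normc z + normc w.
Proof. by rewrite -(normcN w) ler_normcD. Qed.

Lemma normcBC z w : normc (z - w) = normc (w - z).
Proof. by rewrite -normcN opprB. Qed.

Lemma ler_normc_dist v z w : normc (z - w) <= normc (z - v) + normc (v - w).
Proof. by rewrite -(subrKA v) ler_normcD. Qed.

Lemma ler_normcD_sub z w : normc z <= normc w + normc (z - w).
Proof. by rewrite -{1}(subrK w z) addrC ler_normcD. Qed.

Lemma ler_normc_sum (I : Type) (r : seq I) (P : pred I) (F : I -> R[i]%C) :
  normc (\sum_(i <- r | P i) F i) <= \sum_(i <- r | P i) normc (F i).
Proof.
elim/big_rec2: _ => [|i x y _ h]; first by rewrite normc0.
by rewrite (le_trans (ler_normcD _ _))// lerD2l.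
Qed.

Lemma normcX z n : normc (z ^+ n) = normc z ^+ n.
Proof. by elim: n => [|n IH]; rewrite ?expr0 ?normc1// !exprS normcM IH. Qed.

Lemma sqr_normc z : normc z ^+ 2 = complex.Re z ^+ 2 + complex.Im z ^+ 2.
Proof. by case: z => a b /=; rewrite sqr_sqrtr// addr_ge0 ?sqr_ge0. Qed.

Lemma Re_le_normc z : `|complex.Re z| <= normc z.
Proof. by case: z => a b /=; rewrite -sqrtr_sqr ler_wsqrtr// lerDl sqr_ge0. Qed.

Lemma Im_le_normc z : `|complex.Im z| <= normc z.
Proof. by case: z => a b /=; rewrite -sqrtr_sqr ler_wsqrtr// lerDr sqr_ge0. Qed.

Lemma normcR (x : R) : normc (x%:C)%C = `|x|.
Proof. by rewrite /normc /= expr0n addr0 sqrtr_sqr. Qed.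

Lemma normc_le_ReIm z : normc z <= `|complex.Re z| + `|complex.Im z|.
Proof.
rewrite -(@ler_pXn2r _ 2) ?nnegrE ?normc_ge0 ?addr_ge0//.
rewrite sqr_normc sqrrD !real_normK ?num_real//.
by rewrite addrAC lerDl mulrn_wge0// mulr_ge0.
Qed.

Lemma ReD z w : complex.Re (z + w) = complex.Re z + complex.Re w.
Proof. by case: z w => a b []. Qed.
Lemma ImD z w : complex.Im (z + w) = complex.Im z + complex.Im w.
Proof. by case: z w => a b []. Qed.
Lemma ReB z w : complex.Re (z - w) = complex.Re z - complex.Re w.
Proof. by case: z w => a b []. Qed.
Lemma ImB z w : complex.Im (z - w) = complex.Im z - complex.Im w.
Proof. by case: z w => a b []. Qed.
Lemma ReZ (x : R) z : complex.Re ((x%:C)%C * z) = x * complex.Re z.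
Proof. by case: z => a b /=; rewrite mul0r subr0. Qed.
Lemma ImZ (x : R) z : complex.Im ((x%:C)%C * z) = x * complex.Im z.
Proof. by case: z => a b /=; rewrite mul0r addr0. Qed.
Lemma Re_sum (I : Type) (r : seq I) (P : pred I) (F : I -> R[i]%C) :
  complex.Re (\sum_(i <- r | P i) F i) = \sum_(i <- r | P i) complex.Re (F i).
Proof. by elim/big_rec2: _ => // i x y _ <-; rewrite ReD. Qed.
Lemma Im_sum (I : Type) (r : seq I) (P : pred I) (F : I -> R[i]%C) :
  complex.Im (\sum_(i <- r | P i) F i) = \sum_(i <- r | P i) complex.Im (F i).
Proof. by elim/big_rec2: _ => // i x y _ <-; rewrite ImD. Qed.

Lemma complex_eqP z w :
  complex.Re z = complex.Re w -> complex.Im z = complex.Im w -> z = w.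
Proof. by case: z w => a b [c d] /= -> ->. Qed.

Lemma normc_eq z w : (forall e, 0 < e -> normc (z - w) <= e) -> z = w.
Proof.
move=> h; apply/subr0_eq/eq0_normc/eqP.
rewrite eq_le normc_ge0 andbT.
by apply/ler_addgt0Pr => e e0; rewrite add0r h.
Qed.

End ComplexModulus.

Section TorusIntegral.
Variables (R : realType) (n : nat).
Implicit Types (f g : 'rV[R]_n -> R[i]%C) (B C : R).

Definition lip_coord C f :=
  forall j x h, normc (f (x + h *: delta_mx 0 j) - f x) <= C * `|h|.

Definition norm_bounded B f := forall x, normc (f x) <= B.

Lemma grid_avg_ReIm M f :
  grid_avg M f = (grid_avg M (repart f) +i* grid_avg M (impart f))%C.
Proof.
rewrite /grid_avg; have -> : (M.+1%:R ^- n : R[i]%C) = ((M.+1%:R ^- n)%:C)%C.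
  by rewrite fmorphV rmorphXn rmorph_nat.
by apply: complex_eqP; rewrite ?ReZ ?ImZ /= ?Re_sum ?Im_sum.
Qed.

Lemma torus_int_grid_avg C f M : lip_coord C f ->
  normc (torus_int f - grid_avg M f) <= n%:R * C / M.+1%:R *+ 2.
Proof.
move=> fC; rewrite grid_avg_ReIm (le_trans (normc_le_ReIm _))// mulr2n.
by rewrite lerD//= torus_Rint_grid_avg// => j x h;
  rewrite (le_trans _ (fC j x h))// /repart /impart -?ReB -?ImB
    ?Re_le_normc ?Im_le_normc.
Qed.

Lemma torus_int_near C f (e : R) : lip_coord C f -> 0 < e ->
  exists N : nat, forall M, (N <= M)%N -> normc (torus_int f - grid_avg M f) <= e.
Proof.
move=> fC e0; have [N hN] := div_natr_small (n%:R * C) (divr_gt0 e0 (ltr0n _ 2)).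
exists N => M NM; rewrite (le_trans (torus_int_grid_avg M fC))// (splitr e) mulr2n.
by rewrite lerD ?hN.
Qed.

Lemma grid_avg_normc B f M : norm_bounded B f -> normc (grid_avg M f) <= B.
Proof.
move=> fB; rewrite /grid_avg normcM normcV normcX.
have -> : (M.+1%:R : R[i]%C) = ((M.+1%:R)%:C)%C by rewrite rmorph_nat.
rewrite normcR normr_nat ler_pdivrMl ?exprn_gt0 ?ltr0n//.
rewrite (le_trans (ler_normc_sum _ _ _))//.
rewrite (le_trans (ler_sum _ (fun a _ => fB _)))// sumr_const card_ffun !card_ord.
by rewrite -[leLHS]mulr_natl natrX.
Qed.

Lemma torus_int_limit C f (B : R) (N : nat) : lip_coord C f ->
  (forall M, (N <= M)%N -> normc (grid_avg M f) <= B) -> normc (torus_int f) <= B.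
Proof.
move=> fC fB; apply/ler_addgt0Pr => e e0.
have [N' hN] := torus_int_near fC e0.
rewrite (le_trans (ler_normcD_sub _ (grid_avg (maxn N N') f)))// lerD ?fB ?hN//.
  exact: leq_maxl.
exact: leq_maxr.
Qed.

Lemma torus_int_bound B C f : lip_coord C f -> norm_bounded B f -> normc (torus_int f) <= B.
Proof. by move=> fC fB; apply: (torus_int_limit (N := 0) fC) => M _; exact: grid_avg_normc. Qed.

Lemma lip_coordW C C' f : C <= C' -> lip_coord C f -> lip_coord C' f.
Proof. by move=> CC fC j x h; rewrite (le_trans (fC j x h))// ler_wpM2r. Qed.

Lemma lip_coord_cst (c : R[i]%C) : lip_coord 0 (fun _ => c).
Proof. by move=> j x h; rewrite subrr normc0 mul0r. Qed.

Lemma lip_coordB C1 C2 f g : lip_coord C1 f -> lip_coord C2 g ->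
  lip_coord (C1 + C2) (fun x => f x - g x).
Proof.
move=> fC gC j x h; rewrite mulrDl.
set y := x + _; have -> : f y - g y - (f x - g x) = (f y - f x) - (g y - g x) by ring.
by rewrite (le_trans (ler_normcB _ _))//; apply: lerD; [exact: fC|exact: gC].
Qed.

Lemma lip_coordM B1 B2 C1 C2 f g :
  norm_bounded B1 f -> norm_bounded B2 g -> lip_coord C1 f -> lip_coord C2 g ->
  lip_coord (C1 * B2 + B1 * C2) (fun x => f x * g x).
Proof.
move=> fB gB fC gC j x h; set y := x + _.
have -> : f y * g y - f x * g x = (f y - f x) * g y + f x * (g y - g x) by ring.
rewrite (le_trans (ler_normcD _ _))// !normcM mulrDl; apply: lerD.
  by rewrite mulrAC ler_pM ?normc_ge0//; first [exact: fC|exact: gB].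
by rewrite -mulrA ler_pM ?normc_ge0//; first [exact: fB|exact: gC].
Qed.

Lemma norm_boundedM B1 B2 f g : norm_bounded B1 f -> norm_bounded B2 g ->
  norm_bounded (B1 * B2) (fun x => f x * g x).
Proof. by move=> fB gB x; rewrite normcM ler_pM ?normc_ge0//; first [exact: fB|exact: gB]. Qed.

Lemma lip_coordZ C (c : R[i]%C) f : lip_coord C f -> lip_coord (normc c * C) (fun x => c * f x).
Proof. by move=> fC j x h; rewrite -mulrBr normcM -mulrA ler_wpM2l ?normc_ge0//; exact: fC. Qed.

Lemma torus_intB C1 C2 f g : lip_coord C1 f -> lip_coord C2 g ->
  torus_int (fun x => f x - g x) = torus_int f - torus_int g.
Proof.
move=> fC gC; apply: normc_eq => e e0.
have e3 : 0 < e / 3 by rewrite divr_gt0.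
have [N1 h1] := torus_int_near fC e3; have [N2 h2] := torus_int_near gC e3.
have [N3 h3] := torus_int_near (lip_coordB fC gC) e3.
pose M := maxn N1 (maxn N2 N3).
have {}h1 := h1 M (leq_maxl _ _).
have {}h2 : normc (torus_int g - grid_avg M g) <= e / 3.
  by apply: h2; rewrite /M !leq_max leqnn orbT.
have {}h3 : normc (torus_int (fun x => f x - g x) - grid_avg M (fun x => f x - g x)) <= e / 3.
  by apply: h3; rewrite /M !leq_max leqnn !orbT.
move: h3; rewrite grid_avgB => h3.
set I := torus_int _ in h3 *.
have -> : I - (torus_int f - torus_int g) = (I - (grid_avg M f - grid_avg M g))
   - ((torus_int f - grid_avg M f) - (torus_int g - grid_avg M g)) by ring.
rewrite (le_trans (ler_normcB _ _))//.
have -> : e = e / 3 + (e / 3 + e / 3) by field.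
by rewrite lerD// (le_trans (ler_normcB _ _))// lerD.
Qed.

Lemma grid_avgZ M (c : R[i]%C) f : grid_avg M (fun x => c * f x) = c * grid_avg M f.
Proof. by rewrite /grid_avg -mulr_sumr mulrCA. Qed.

Lemma torus_intZ C (c : R[i]%C) f : lip_coord C f ->
  torus_int (fun x => c * f x) = c * torus_int f.
Proof.
move=> fC; apply: normc_eq => e e0.
have e2 : 0 < e / 2 by rewrite divr_gt0.
have c1 : 0 < normc c + 1 by rewrite ltr_wpDl ?normc_ge0.
have [N1 h1] := torus_int_near fC (divr_gt0 e2 c1).
have [N2 h2] := torus_int_near (lip_coordZ c fC) e2.
have {}h1 := h1 _ (leq_maxl N1 N2).
have {}h2 := h2 _ (leq_maxr N1 N2).
move: h2; rewrite grid_avgZ; set M := maxn _ _ in h1 * => h2.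
rewrite (le_trans (ler_normc_dist (c * grid_avg M f) _ _))// (splitr e) lerD//.
rewrite -mulrBr normcM normcBC (@le_trans _ _ ((normc c + 1) * (e / 2 / (normc c + 1))))//.
  by rewrite ler_pM ?normc_ge0// lerDl.
by rewrite mulrC divfK// gt_eqF.
Qed.

Lemma torus_int0 : torus_int (fun _ : 'rV[R]_n => 0) = 0.
Proof.
by have := torus_intB (lip_coord_cst 0) (lip_coord_cst 0); rewrite !subrr.
Qed.

Lemma torus_intD C1 C2 f g : lip_coord C1 f -> lip_coord C2 g ->
  torus_int (fun x => f x + g x) = torus_int f + torus_int g.
Proof.
move=> fC gC.
have e : (fun x => f x + g x) = (fun x => f x - (-1) * g x).
  by apply/funext => x; ring.
by rewrite e (torus_intB fC (lip_coordZ (-1) gC)) (torus_intZ _ gC); ring.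
Qed.

Lemma lip_coord_sum (I : Type) (r : seq I) (F : I -> 'rV[R]_n -> R[i]%C) (C : I -> R) :
  (forall i, lip_coord (C i) (F i)) -> lip_coord (\sum_(i <- r) C i) (fun x => \sum_(i <- r) F i x).
Proof.
move=> FC j x h; rewrite -sumrB mulr_suml (le_trans (ler_normc_sum _ _ _))//.
by apply: ler_sum => i _; exact: FC.
Qed.

Lemma torus_int_sum (I : Type) (r : seq I) (F : I -> 'rV[R]_n -> R[i]%C) (C : I -> R) :
  (forall i, lip_coord (C i) (F i)) ->
  torus_int (fun x => \sum_(i <- r) F i x) = \sum_(i <- r) torus_int (F i).
Proof.
move=> FC; elim: r => [|i r IH].
  rewrite big_nil -[RHS]torus_int0; congr torus_int.
  by apply/funext => x; rewrite big_nil.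
rewrite big_cons -IH -(torus_intD (FC i) (lip_coord_sum r FC)); congr torus_int.
by apply/funext => x; rewrite big_cons.
Qed.

End TorusIntegral.

Section Characters.
Variables (R : realType).

Lemma e2piD (s t : R) : e2pi (s + t) = e2pi s * e2pi t.
Proof. by rewrite /e2pi mulrDr cosD sinD; apply: complex_eqP => //=; ring. Qed.

Lemma e2pi0 : e2pi (0 : R) = 1.
Proof. by rewrite /e2pi mulr0 cos0 sin0. Qed.

Lemma normc_e2pi (t : R) : normc (e2pi t) = 1.
Proof. by rewrite /normc /= cos2Dsin2 sqrtr1. Qed.

Lemma e2pi_nat (m : nat) : e2pi (m%:R : R) = 1.
Proof.
elim: m => [|m IH]; first exact: e2pi0.
rewrite -natr1 e2piD IH mul1r /e2pi mulr1 mulr_natl.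
by rewrite cos2pi sin2pi.
Qed.

Lemma e2pi1 : e2pi (1 : R) = 1.
Proof. exact: (e2pi_nat 1). Qed.

Lemma e2piN (t : R) : e2pi t * e2pi (- t) = 1.
Proof. by rewrite -e2piD subrr e2pi0. Qed.

Lemma e2pi_int (m : int) : e2pi (m%:~R : R) = 1.
Proof.
case: m => m; first exact: e2pi_nat.
have := e2piN (m.+1%:R : R); rewrite e2pi_nat mul1r.
by rewrite NegzE mulrNz.
Qed.

Lemma e2piX (t : R) (m : nat) : e2pi (m%:R * t) = e2pi t ^+ m.
Proof.
elim: m => [|m IH]; first by rewrite mul0r e2pi0.
by rewrite -natr1 mulrDl mul1r e2piD IH exprSr.
Qed.

Lemma e2pi_lip (s h : R) : normc (e2pi (s + h) - e2pi s) <= 4 * pi * `|h|.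
Proof.
have mono (f df : R -> R) : (forall x : R, is_derive x (1 : R) f (df x)) ->
    (forall x, `|df x| <= 1) -> forall a b : R, `|f b - f a| <= `|b - a|.
  move=> fd fb a b; wlog ab : a b / a <= b => [hw|].
    have [/hw//|/ltW/hw] := leP a b.
    by rewrite distrC [leRHS]distrC.
  have cf : {within `[a, b], continuous f}.
    apply/continuous_subspaceT => x.
    by apply/differentiable_continuous/derivable1_diffP; case: (fd x).
  have [c _ ->] := @MVT_segment R f df a b ab (fun x _ => fd x) cf.
  by rewrite normrM ler_piMl.
rewrite (le_trans (normc_le_ReIm _))// /e2pi /=.
have hc := mono cos (- sin) (fun x => is_derive_cos x).
have hs := mono sin cos (fun x => is_derive_sin x).
have -> : 4 * pi * `|h| = `|2 * pi * (s + h) - 2 * pi * s| + `|2 * pi * (s + h) - 2 * pi * s|.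
  have -> : 2 * pi * (s + h) - 2 * pi * s = 2 * pi * h by ring.
  by rewrite normrM ger0_norm ?mulr_ge0 ?pi_ge0//; ring.
rewrite lerD ?hc ?hs// => x; first by rewrite normrN ler_norml sin_geN1 sin_le1.
by rewrite ler_norml cos_geN1 cos_le1.
Qed.

(** Some multiple [r * t] lands in the arc from [1/4] to [3/4], where the
    character has nonpositive real part and hence distance at least [1] from
    [1]; the telescoping bound [|z^r - 1| <= r |z - 1|] transfers this to [t]
    itself. *)
Lemma normc_e2piB1_ge (t : R) : `|t| <= 2^-1 -> `|t| <= normc (e2pi t - 1).
Proof.
move=> t2; have [->|t0] := eqVneq t 0; first by rewrite normr0 normc_ge0.
have pt : 0 < `|t| by rewrite normr_gt0.
pose r := (Num.truncn (4^-1 / `|t|)).+1.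
have r1 : 4^-1 <= r%:R * `|t| by rewrite -ler_pdivrMr// ltW// truncnS_gt.
have r2 : r%:R * `|t| <= 4^-1 + `|t|.
  rewrite /r -natr1 mulrDl mul1r lerD2r -ler_pdivlMr//.
  by rewrite truncn_le// divr_ge0// ltW.
have cr : cos (2 * pi * (r%:R * t)) <= 0.
  have -> : cos (2 * pi * (r%:R * t)) = cos (2 * pi * (r%:R * `|t|)).
    by have [_|_] := ger0P t => //; rewrite !mulrN cosN.
  set y := r%:R * `|t| in r1 r2 *.
  have -> : 2 * pi * y = (2 * pi * y - pi) + pi by ring.
  rewrite cosDpi oppr_le0 cos_ge0_pihalf//.
  have y3 : y <= 3 / 4 by lra.
  have p0 := pi_gt0 R.
  by apply/andP; split; nra.
have h1 : 1 <= normc (e2pi (r%:R * t) - 1).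
  rewrite (le_trans _ (Re_le_normc _))//= distrC ger0_norm.
    by rewrite lerBrDr gerDl.
  by rewrite subr_ge0 cos_le1.
have h2 (m : nat) : normc (e2pi (m%:R * t) - 1) <= m%:R * normc (e2pi t - 1).
  elim: m => [|m IH]; first by rewrite mul0r e2pi0 subrr normc0 mul0r.
  have -> : e2pi (m.+1%:R * t) - 1 = (e2pi (m%:R * t) - 1) * e2pi t + (e2pi t - 1).
    by rewrite -natr1 mulrDl mul1r e2piD; ring.
  rewrite (le_trans (ler_normcD _ _))// normcM normc_e2pi mulr1.
  by rewrite -natr1 mulrDl mul1r lerD2r.
have {h1 h2} := le_trans h1 (h2 r).
set z := normc _ => h.
have r0 : 0 < r%:R :> R by rewrite ltr0n.
rewrite -(ler_pM2l r0) (le_trans _ h)// (le_trans r2)//; lra.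
Qed.

Variable n : nat.
Implicit Types (k q : 'rV[int]_n) (x : 'rV[R]_n).

Definition echar k x : R[i]%C := e2pi (zdot k x).

Lemma zdotDr k x y : zdot k (x + y) = zdot k x + zdot k y.
Proof. by rewrite /zdot -big_split; apply: eq_bigr => j _; rewrite mxE mulrDr. Qed.

Lemma zdotDl k q x : zdot (k + q) x = zdot k x + zdot q x.
Proof. by rewrite /zdot -big_split; apply: eq_bigr => j _; rewrite mxE intrD mulrDl. Qed.

Lemma zdotNl k x : zdot (- k) x = - zdot k x.
Proof. by rewrite /zdot -sumrN; apply: eq_bigr => j _; rewrite mxE mulrNz mulNr. Qed.

Lemma zdot_delta k j (h : R) : zdot k (h *: delta_mx 0 j) = (k 0 j)%:~R * h.
Proof.
rewrite /zdot (bigD1 j)//= !mxE !eqxx mulr1 big1 ?addr0// => i ij.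
by rewrite !mxE eqxx /= (negPf ij) !mulr0.
Qed.

Lemma zdot0l x : zdot 0 x = 0.
Proof. by rewrite /zdot big1// => j _; rewrite mxE mul0r. Qed.

Lemma echarD k q x : echar (k + q) x = echar k x * echar q x.
Proof. by rewrite /echar zdotDl e2piD. Qed.

Lemma echar0 x : echar 0 x = 1.
Proof. by rewrite /echar zdot0l e2pi0. Qed.

Lemma normc_echar k x : normc (echar k x) = 1.
Proof. exact: normc_e2pi. Qed.

Lemma echar_shift k x j h :
  echar k (x + h *: delta_mx 0 j) = echar k x * e2pi ((k 0 j)%:~R * h).
Proof. by rewrite /echar zdotDr zdot_delta e2piD. Qed.

Definition l1norm k : nat := (\sum_j absz (k 0%R j))%N.

Lemma echar_lip k : lip_coord (4 * pi * (l1norm k)%:R) (echar k).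
Proof.
move=> j x h; rewrite /echar zdotDr zdot_delta (le_trans (e2pi_lip _ _))//.
rewrite normrM mulrA ler_wpM2r// ler_wpM2l ?mulr_ge0 ?pi_ge0//.
rewrite -intr_norm -[(`|_|)%:~R]/((absz (k 0 j))%:R) ler_nat /l1norm.
by rewrite (bigD1 j)//= leq_addr.
Qed.

Lemma echar_bounded k : norm_bounded 1 (echar k).
Proof. by move=> x; rewrite normc_echar. Qed.

Lemma echar_periodic k : torus_periodic (echar k).
Proof.
move=> l x; rewrite /echar zdotDr e2piD.
suff -> : zdot k (map_mx intr l) = (\sum_j k 0 j * l 0 j)%:~R :> R.
  by rewrite e2pi_int mulr1.
by rewrite /zdot raddf_sum; apply: eq_bigr => j _; rewrite mxE -intrM.
Qed.

End Characters.

(** * Discrete Fourier analysis on the grid *)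

Section Boxes.
Variables (R : realType) (n : nat).
Implicit Types (q k : 'rV[int]_n).

Definition boxpt K (i : {ffun 'I_n -> 'I_K.*2.+1}) : 'rV[int]_n :=
  \row_j ((i j)%:Z - K%:Z).

(** The lattice points with coordinates of modulus at most [K]: a complete
    set of frequencies for the grid with [2 K + 1] points per direction, centred
    at [0] so that [|q_j / (2 K + 1)| <= 1/2]. *)
Definition box K : seq 'rV[int]_n :=
  [seq boxpt i | i <- enum {ffun 'I_n -> 'I_K.*2.+1}].

Lemma boxP K q : reflect (forall j, (absz (q 0%R j) <= K)%N) (q \in box K).
Proof.
apply: (iffP idP) => [/mapP[i _ ->] j|h].
  by rewrite mxE; case: (fun_of_fin i j) => x /= xK; lia.
pose i : {ffun 'I_n -> 'I_K.*2.+1} := [ffun j => inord (absz (q 0%R j + K%:Z))].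
apply/mapP; exists i; first by rewrite mem_enum.
by apply/rowP => j; rewrite !mxE ffunE; move: (q _ j) (h j) => x hx; rewrite inordK; lia.
Qed.

Lemma box_uniq K : uniq (box K).
Proof.
rewrite map_inj_uniq ?enum_uniq// => i i' /rowP e.
apply/ffunP => j; apply: val_inj; have := e j; rewrite !mxE /=; lia.
Qed.

Lemma sub_box K K' q : (K <= K')%N -> q \in box K -> q \in box K'.
Proof. by move=> KK /boxP h; apply/boxP => j; rewrite (leq_trans (h j)). Qed.

Lemma mem_box_sum q : q \in box (\sum_j absz (q 0%R j))%N.
Proof. by apply/boxP => j; rewrite (bigD1 j)//= leq_addr. Qed.

Lemma big_box (V : nmodType) K (F : 'rV[int]_n -> V) :
  \sum_(q <- box K) F q = \sum_(i : {ffun 'I_n -> 'I_K.*2.+1}) F (boxpt i).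
Proof. by rewrite big_map big_enum. Qed.

(** A product rather than a norm: it is submultiplicative, and its
    inverse square is summable over the lattice one coordinate at a time. *)
Definition weight q : R := \prod_j (1 + (absz (q 0%R j))%:R).

Lemma weight_ge1 q : 1 <= weight q.
Proof. by rewrite /weight; elim/big_rec: _ => // j x _ x1; rewrite mulr_ege1// lerDl. Qed.

Lemma weight_gt0 q : 0 < weight q.
Proof. by rewrite (lt_le_trans ltr01)// weight_ge1. Qed.

Lemma weight_ge0 q : 0 <= weight q.
Proof. exact/ltW/weight_gt0. Qed.

Lemma weightN q : weight (- q) = weight q.
Proof. by apply: eq_bigr => j _; rewrite mxE abszN. Qed.

Lemma weightD q k : weight (q + k) <= weight q * weight k.
Proof.
rewrite /weight -big_split /=; apply: ler_prod => j _; rewrite addr_ge0//=.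
rewrite mxE; set a := q 0 j; set b := k 0 j.
apply: (@le_trans _ _ (1 + (absz a + absz b)%:R)).
  by rewrite lerD2l ler_nat; lia.
rewrite natrD mulrDr mulr1 mulrDl mul1r addrA lerD2l.
by rewrite lerDl mulr_ge0.
Qed.

Lemma l1norm_weight q : 1 + (l1norm q)%:R <= weight q.
Proof.
rewrite /l1norm /weight; elim/big_rec2: _ => [|j x y _ h]; first by rewrite addr0.
rewrite natrD mulrDl mul1r addrA addrAC lerD// ler_peMr//.
by rewrite (le_trans _ h)// lerDl.
Qed.

(** The bound telescopes: the two new terms of the induction step are
    [2 / (K + 2)^2 <= 2 / (K + 1) - 2 / (K + 2)]. *)
Lemma sum_inv_sqr_abs (K : nat) :
  \sum_(i < K.*2.+1) (1 + (absz (i%:Z - K%:Z))%:R) ^- 2 <= 3 - 2 / K.+1%:R :> R.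
Proof.
elim: K => [|K IH].
  rewrite big_ord1 subrr absz0 addr0 expr1n invr1; lra.
rewrite doubleS big_ord_recr big_ord_recl /=.
rewrite [X in _ + X + _](eq_bigr (fun i : 'I_K.*2.+1 =>
    (1 + (absz ((i : nat)%:Z - K%:Z))%:R) ^- 2)); last first.
  move=> i _; congr ((1 + (absz _)%:R) ^- 2).
  by case: i => i /= iK; rewrite /bump; lia.
rewrite [X in X + _ + _](_ : _ = (1 + K.+1%:R) ^- 2); last first.
  by congr ((1 + (_)%:R) ^- 2); lia.
rewrite [X in _ + _ + X](_ : _ = (1 + K.+1%:R) ^- 2); last first.
  by congr ((1 + (_)%:R) ^- 2); lia.
set u := K.+1%:R in IH *; have u0 : 0 < u by rewrite ltr0n.
have -> : K.+2%:R = 1 + u :> R by rewrite nat1r.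
set S := \sum_(i < _) _ in IH *.
have h : (1 + u) ^- 2 + (1 + u) ^- 2 <= 2 / u - 2 / (1 + u).
  rewrite -subr_ge0.
  have -> : 2 / u - 2 / (1 + u) - ((1 + u) ^- 2 + (1 + u) ^- 2)
     = 2 / (u * (1 + u) ^+ 2) by field; apply/andP; split; apply: lt0r_neq0; lra.
  by rewrite divr_ge0// mulr_ge0 ?ltW// exprn_gt0// addr_gt0.
rewrite addrAC (le_trans (lerD h IH))//.
by rewrite le_eqVlt; apply/orP; left; apply/eqP; ring.
Qed.

Lemma sum_weightV2 K : \sum_(q <- box K) weight q ^- 2 <= 3 ^+ n.
Proof.
rewrite big_box.
under eq_bigr => i _ do rewrite /weight -exprVn -prodfV -prodrXl.
pose F (j : 'I_n) (i : 'I_K.*2.+1) : R := (1 + (absz (i%:Z - K%:Z))%:R) ^- 2.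
rewrite (eq_bigr (fun i : {ffun 'I_n -> 'I_K.*2.+1} => \prod_j F j (i j))); last first.
  by move=> i _; apply: eq_bigr => j _; rewrite mxE exprVn.
rewrite -bigA_distr_bigA /= -[X in _ <= _ ^+ X]card_ord -prodr_const.
apply: ler_prod => j _; rewrite sumr_ge0 => [|i _]; last first.
  by rewrite invr_ge0 exprn_ge0// addr_ge0.
by rewrite (le_trans (sum_inv_sqr_abs K))// gerBl divr_ge0.
Qed.

End Boxes.
Arguments weight {R n}.

Section DiscreteFourier.
Variables (R : realType) (n : nat).
Implicit Types (f g b G : 'rV[R]_n -> R[i]%C) (q : 'rV[int]_n).

Definition grid_coef M g q : R[i]%C := grid_avg M (fun x => echar (- q) x * g x).
Definition fourier_coef g q : R[i]%C := torus_int (fun x => echar (- q) x * g x).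

(** A shift by one mesh step permutes the grid cyclically, by
    periodicity. *)
Lemma grid_avg_shift M f j : torus_periodic f ->
  grid_avg M (fun x => f (x + M.+1%:R^-1 *: delta_mx 0 j)) = grid_avg M f.
Proof.
move=> fper; rewrite /grid_avg; congr (_ * _).
pose s (a : {ffun 'I_n -> 'I_M.+1}) := [ffun i => if i == j then ordS (a i) else a i].
pose p (a : {ffun 'I_n -> 'I_M.+1}) := [ffun i => if i == j then ord_pred (a i) else a i].
have sp : cancel s p.
  by move=> a; apply/ffunP => i; rewrite !ffunE; case: eqP => // _; rewrite ordSK.
have ps : cancel p s.
  by move=> a; apply/ffunP => i; rewrite !ffunE; case: eqP => // _; rewrite ord_predK.
rewrite [RHS](reindex s); last by exists p => a _.
apply: eq_bigr => a _.
pose l : 'rV[int]_n := (a j == M :> nat)%:Z *: delta_mx 0 j.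
rewrite -[RHS](fper l); congr f; apply/rowP => i; rewrite !mxE ffunE eqxx /=.
case: eqP => [->|_]; last by rewrite !mulr0 addr0.
rewrite !mulr1 /=; set A := a j.
have [->|AM] := eqVneq (A : nat) M.
  rewrite modnn mul0r add0r -[X in _ + X]mul1r -mulrDl natr1 divff//.
rewrite modn_small ?addr0; last by have := ltn_ord A; lia.
by rewrite -[A.+1%:R]natr1 mulrDl mul1r.
Qed.

Definition fdiff (V : zmodType) (h : R) j (N : nat) (g : 'rV[R]_n -> V) :=
  iter N (fun u x => u (x + h *: delta_mx 0 j) - u x) g.

Lemma fdiff_periodic h j N g : torus_periodic g -> torus_periodic (fdiff h j N g).
Proof.
move=> gp; elim: N => //= N IH l x.
by rewrite IH; congr (_ - _); rewrite addrAC IH.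
Qed.

(** Summation by parts: a difference of mesh step acts on the
    coefficient at [q] as multiplication by
    [e^{2 pi i q_j / (M + 1)} - 1]. *)
Lemma grid_coef_fdiff M g q j N : torus_periodic g ->
  grid_coef M (fdiff M.+1%:R^-1 j N g) q =
  (e2pi ((q 0 j)%:~R / M.+1%:R) - 1) ^+ N * grid_coef M g q.
Proof.
move=> gp; elim: N => [|N IH]; first by rewrite expr0 mul1r.
rewrite exprS -mulrA -IH mulrBl mul1r.
pose f := fdiff M.+1%:R^-1 j N g; rewrite -/f; have fp : torus_periodic f := fdiff_periodic _ j N gp.
have -> : grid_coef M (fdiff M.+1%:R^-1 j N.+1 g) q =
  grid_avg M (fun x => echar (- q) x * f (x + M.+1%:R^-1 *: delta_mx 0 j)) - grid_coef M f q.
  by rewrite /grid_coef -grid_avgB; congr (grid_avg M _); apply/funext => x; rewrite -mulrBr.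
congr (_ - _).
have ep : torus_periodic (fun x => echar (- q) x * f x).
  by move=> l x; rewrite (echar_periodic _ l) fp.
rewrite /grid_coef -[in RHS](grid_avg_shift M j ep) -grid_avgZ; congr (grid_avg M _).
apply/funext => x; rewrite echar_shift mxE mulrNz mulNr.
set t := (q 0 j)%:~R / _.
rewrite -[LHS]mul1r -(e2piN t); ring.
Qed.

Lemma grid_coef_bound M g q B : norm_bounded B g -> normc (grid_coef M g q) <= B.
Proof.
move=> gB; apply: grid_avg_normc => x.
by rewrite normcM normc_echar mul1r gB.
Qed.

(** Decay of order [n P] in each single coordinate gives decay of order
    [P] in the weight, which is at most the [n]-th power of its largest
    factor. *)
Lemma weight_decay (c C : R) (q : 'rV[int]_n) (P : nat) : 0 <= c ->
  c <= C -> (forall j, c * (absz (q 0%R j))%:R ^+ (n * P) <= C) ->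
  c * weight q ^+ P <= 2 ^+ (n * P) * C.
Proof.
move=> c0 cC h; have C0 := le_trans c0 cC.
have h1 j : c * (1 + (absz (q 0%R j))%:R) ^+ (n * P) <= 2 ^+ (n * P) * C.
  have [->|a0] := posnP (absz (q 0%R j)).
    rewrite addr0 expr1n mulr1 (le_trans cC)// ler_peMl// exprn_ege1//; lra.
  set a := _%:R : R.
  have a1 : 1 <= a by rewrite ler1n.
  rewrite (@le_trans _ _ (2 ^+ (n * P) * (c * a ^+ (n * P))))//; last first.
    by rewrite ler_wpM2l//; exact: h.
  by rewrite mulrCA -exprMn ler_wpM2l// lerXn2r// ?nnegrE; lra.
case: (pickP 'I_n) => [j0 _|n0]; last first.
  rewrite /weight big_pred0// expr1n mulr1 (le_trans cC)// ler_peMl//.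
  by rewrite exprn_ege1//; lra.
pose j := [arg max_(i > j0) absz (q 0%R i)]%N.
have jmax i : (absz (q 0%R i) <= absz (q 0%R j))%N.
  by rewrite /j; case: arg_maxnP => // i' _; apply.
rewrite (le_trans _ (h1 j))// ler_wpM2l// exprM lerXn2r// ?nnegrE ?weight_ge0//.
rewrite -[X in _ ^+ X]card_ord -prodr_const; apply: ler_prod => i _.
by rewrite addr_ge0//= lerD2l ler_nat.
Qed.

(** Iterated differences of order [n * P] behave like derivatives of that
    order; this discrete form of smoothness is all that the decay of
    coefficients uses. *)
Definition diff_decay (P : nat) (C : R) g :=
  norm_bounded C g /\
  forall j h x, normc (fdiff h j (n * P) g x) <= C * `|h| ^+ (n * P).

(** On the grid with [2 K + 1] points per direction
    [t = |q_j| / (2 K + 1)] is at most [1/2], so that the multiplier of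
    [grid_coef_fdiff] has modulus at least [t]; the powers of the mesh cancel,
    and the bound does not depend on [K]. *)
Lemma grid_coef_decay K P C g q : torus_periodic g -> diff_decay P C g -> q \in box n K ->
  normc (grid_coef K.*2 g q) * weight q ^+ P <= 2 ^+ (n * P) * C.
Proof.
move=> gp [gC gD] /boxP qK; apply: weight_decay; rewrite ?normc_ge0 ?grid_coef_bound//.
move=> j; have M0 : 0 < K.*2.+1%:R :> R by rewrite ltr0n.
have h1 : normc (grid_coef K.*2 (fdiff K.*2.+1%:R^-1 j (n * P) g) q)
    <= C * K.*2.+1%:R^-1 ^+ (n * P).
  by apply: grid_coef_bound => x; rewrite (le_trans (gD _ _ _))// ger0_norm.
move: h1; rewrite grid_coef_fdiff// normcM normcX => h1.
set t := (q 0 j)%:~R / _ in h1.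
have tabs : `|t| = (absz (q 0%R j))%:R / K.*2.+1%:R.
  by rewrite /t normrM (gtr0_norm (x := _^-1)) ?invr_gt0// -intr_norm.
have t2 : `|t| <= 2^-1.
  rewrite tabs ler_pdivrMr// ler_pdivlMl// -natrM ler_nat; have := qK j; lia.
have h2 := normc_e2piB1_ge t2.
have h3 : `|t| ^+ (n * P) * normc (grid_coef K.*2 g q) <= C * K.*2.+1%:R^-1 ^+ (n * P).
  rewrite (le_trans _ h1)// ler_wpM2r ?normc_ge0// lerXn2r// nnegrE//.
  exact: normc_ge0.
move: h3; rewrite tabs exprMn mulrAC ler_pM2r ?exprn_gt0 ?invr_gt0//.
by rewrite mulrC.
Qed.

(** The sum factors over the coordinates, and each factor is a
    geometric sum of a nontrivial root of unity unless the two coordinates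
    agree. *)
Lemma echar_grid_orth K (a a' : {ffun 'I_n -> 'I_K.*2.+1}) :
  \sum_(q <- box n K) echar q (gridpt R a) * echar (- q) (gridpt R a') =
  (K.*2.+1 ^ n)%:R * (a == a')%:R.
Proof.
set M := K.*2.+1.
pose d j : R := ((a j)%:R - (a' j)%:R) / M%:R.
pose F j (i : 'I_M) : R[i]%C := e2pi ((i%:R - K%:R) * d j).
have -> : \sum_(q <- box n K) echar q (gridpt R a) * echar (- q) (gridpt R a')
   = \sum_(i : {ffun 'I_n -> 'I_M}) \prod_j F j (i j).
  rewrite big_box; apply: eq_bigr => i _.
  rewrite /echar -e2piD /zdot -big_split /=.
  rewrite (big_morph (@e2pi R) (@e2piD R) (e2pi0 R)); apply: eq_bigr => j _.
  rewrite /F !mxE; congr e2pi.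
  by rewrite mulrNz intrB /d; ring.
rewrite -bigA_distr_bigA /=.
have [e|aa] := eqVneq a a'.
  rewrite mulr1 natrX -[X in _ = _ ^+ X]card_ord -prodr_const; apply: eq_bigr => j _.
  under eq_bigr do rewrite /F /d e subrr mul0r mulr0 e2pi0.
  by rewrite sumr_const card_ord.
rewrite mulr0.
have [j aj] : exists j, a j != a' j.
  apply/existsP; rewrite -negb_forall; apply: contra aa => /forallP e.
  by apply/eqP/ffunP => j; apply/eqP.
rewrite (bigD1 j)//= [X in X * _](_ : _ = 0) ?mul0r//.
pose z : R[i]%C := e2pi (d j).
have M0 : 0 < M%:R :> R by rewrite ltr0n.
have zM : z ^+ M = 1.
  rewrite /z -e2piX /d mulrC divfK ?gt_eqF//.
  by rewrite !pmulrn -intrB e2pi_int.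
have z1 : z != 1.
  (* [d j] lies strictly between [-1] and [1]; if its modulus exceeds [1/2], a
     shift by one period brings it into the range of the lower bound *)
  have aux (t : R) : t != 0 -> `|t| <= 2^-1 -> e2pi t != 1.
    move=> t0 /normc_e2piB1_ge; apply: contraTneq => ->.
    by rewrite subrr normc0 -ltNge normr_gt0.
  have dn0 : d j != 0.
    rewrite /d mulf_neq0//; last by rewrite invr_eq0 gt_eqF.
    by rewrite subr_eq0 eqr_nat; apply: contra aj => /eqP/val_inj ->.
  have d1 : `|d j| < 1.
    rewrite /d normrM (gtr0_norm (x := _^-1)) ?invr_gt0// ltr_pdivrMr// mul1r.
    rewrite !pmulrn -intrB -intr_norm -[(`|_|)%:~R]/((absz ((a j)%:Z - (a' j)%:Z))%:R).
    by rewrite ltr_nat; have := ltn_ord (a j); have := ltn_ord (a' j); lia.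
  have [d2|d2] := leP `|d j| 2^-1; first exact: aux.
  have [dp|dn] := ltP 0 (d j).
    have -> : z = e2pi (d j - 1).
      by rewrite /z -[RHS]mulr1 -e2pi1 -e2piD subrK.
    rewrite (gtr0_norm dp) in d1 d2.
    by apply: aux; [apply: ltr0_neq0; lra|rewrite ltr0_norm; lra].
  have -> : z = e2pi (d j + 1) by rewrite e2piD e2pi1 mulr1.
  rewrite (ler0_norm dn) in d1 d2.
  by apply: aux; [apply: lt0r_neq0; lra|rewrite gtr0_norm; lra].
have -> : \sum_i F j i = e2pi (- K%:R * d j) * \sum_(i < M) z ^+ i.
  rewrite mulr_sumr; apply: eq_bigr => i _.
  by rewrite /F /z -e2piX -e2piD; congr e2pi; ring.
have /eqP : (z - 1) * \sum_(i < M) z ^+ i = 0 by rewrite -subrX1 zM subrr.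
by rewrite mulf_eq0 subr_eq0 (negPf z1) /= => /eqP ->; rewrite mulr0.
Qed.

(** Discrete Fourier inversion of [b], integrated against [G]. *)
Lemma grid_avg_inversion K b G :
  grid_avg K.*2 (fun x => b x * G x) =
  \sum_(q <- box n K) grid_coef K.*2 b q * grid_avg K.*2 (fun x => echar q x * G x).
Proof.
set M := K.*2.+1; pose T := {ffun 'I_n -> 'I_M}.
have M0 : (M%:R : R[i]%C) ^+ n != 0 by rewrite expf_neq0// pnatr_eq0.
rewrite /grid_coef /grid_avg -/M.
have -> : \sum_(q <- box n K)
    M%:R ^- n * (\sum_(a : T) echar (- q) (@gridpt R n K.*2 a) * b (@gridpt R n K.*2 a)) *
    (M%:R ^- n * (\sum_(a : T) echar q (@gridpt R n K.*2 a) * G (@gridpt R n K.*2 a))) =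
  M%:R ^- n * (M%:R ^- n * \sum_(a : T) \sum_(a' : T) b (@gridpt R n K.*2 a') * G (@gridpt R n K.*2 a) *
     \sum_(q <- box n K) echar q (@gridpt R n K.*2 a) * echar (- q) (@gridpt R n K.*2 a')).
  rewrite mulrA mulr_sumr.
  transitivity (\sum_(q <- box n K) \sum_(a : T) M%:R ^- n * M%:R ^- n * \sum_(a' : T)
     b (@gridpt R n K.*2 a') * G (@gridpt R n K.*2 a) *
     (echar q (@gridpt R n K.*2 a) * echar (- q) (@gridpt R n K.*2 a'))).
    apply: eq_bigr => q _; rewrite mulrACA -mulr_sumr; congr (_ * _).
    rewrite mulrC mulr_suml; apply: eq_bigr => a _.
    by rewrite mulr_sumr; apply: eq_bigr => a' _; ring.
  rewrite exchange_big /=; apply: eq_bigr => a _; rewrite -mulr_sumr; congr (_ * _).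
  by rewrite exchange_big /=; apply: eq_bigr => a' _; rewrite -mulr_sumr.
congr (_ * _); rewrite mulr_sumr; apply: eq_bigr => a _.
rewrite (bigD1 a)//= [X in _ * (_ + X)]big1 ?addr0 => [|a' aa']; last first.
  by rewrite echar_grid_orth eq_sym (negPf aa') !mulr0.
by rewrite echar_grid_orth eqxx mulr1 natrX mulrCA mulVf ?mulr1.
Qed.

End DiscreteFourier.

(** * Sums over the lattice and Young's inequality *)

Section LatticeSums.
Variables (R : realType) (n : nat).
Local Notation Zn := 'rV[int]_n.
Implicit Types (u v w : Zn -> R).

Definition box_sum K u : R := \sum_(q <- box n K) u q.

Definition lsum u : \bar R := (\esum_(q in [set: Zn]) (u q)%:E)%E.

Lemma lsum_ge0 u : (forall q, 0 <= u q) -> (0 <= lsum u)%E.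
Proof. by move=> u0; apply: esum_ge0 => q _; rewrite lee_fin. Qed.

Lemma le_lsum u v : (forall q, u q <= v q) -> (lsum u <= lsum v)%E.
Proof. by move=> uv; apply: le_esum => q _; rewrite lee_fin. Qed.

Lemma eq_lsum u v : u =1 v -> lsum u = lsum v.
Proof. by move=> uv; apply: eq_esum => q _; rewrite uv. Qed.

Lemma lsumD u v : (forall q, 0 <= u q) -> (forall q, 0 <= v q) ->
  lsum (fun q => u q + v q) = (lsum u + lsum v)%E.
Proof.
by move=> u0 v0; rewrite /lsum -esumD// => q _; rewrite lee_fin.
Qed.

Lemma esumZ (T : choiceType) (c : R) (f : T -> \bar R) : 0 <= c ->
  (forall x, 0 <= f x)%E ->
  (\esum_(x in [set: T]) (c%:E * f x) = c%:E * \esum_(x in [set: T]) f x)%E.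
Proof.
move=> c0 f0; rewrite /esum -ereal_supZl//; last first.
  by apply/set0P; exists 0%E, set0; [exact: fsets_set0|rewrite fsbig_set0].
congr ereal_sup; rewrite image_comp; apply: eq_imagel => A [finA _] /=.
by rewrite ge0_mule_fsumr// => x; rewrite f0.
Qed.

Lemma lsumZ c u : 0 <= c -> (forall q, 0 <= u q) ->
  lsum (fun q => c * u q) = (c%:E * lsum u)%E.
Proof.
by move=> c0 u0; rewrite /lsum -esumZ.
Qed.

(** Tonelli. *)
Lemma esum_swap (T1 T2 : choiceType) (a : T1 -> T2 -> \bar R) :
  (forall i j, 0 <= a i j)%E ->
  (\esum_(i in [set: T1]) \esum_(j in [set: T2]) a i j =
   \esum_(j in [set: T2]) \esum_(i in [set: T1]) a i j)%E.
Proof.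
move=> a0; rewrite !esum_esum//.
rewrite (@reindex_esum _ _ _ ([set: T1] `*`` (fun=> [set: T2])) _
   (fun p : T1 * T2 => (p.2, p.1)))//.
split=> //; first by move=> [x y] [x' y'] _ _ [-> ->].
by move=> [x y] _; exists (y, x).
Qed.

Lemma lsum_shift u k : lsum (fun q => u (q + k)) = lsum u.
Proof.
rewrite /lsum [RHS](@reindex_esum _ _ _ setT _ (fun q => q + k))//.
split=> //; first by move=> x y _ _ /addIr.
by move=> q _; exists (q - k) => //; rewrite subrK.
Qed.

Lemma lsum_reflect u k : lsum (fun q => u (k - q)) = lsum u.
Proof.
rewrite /lsum [RHS](@reindex_esum _ _ _ setT _ (fun q => k - q))//.
split=> //; first by move=> x y _ _ /addrI/oppr_inj.
by move=> q _; exists (k - q) => //; rewrite subKr.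
Qed.

Lemma le_seq_sum u (s r : seq Zn) : (forall q, 0 <= u q) -> uniq s -> uniq r ->
  {subset s <= r} -> \sum_(q <- s) u q <= \sum_(q <- r) u q.
Proof.
move=> u0 us ur sr.
rewrite [leRHS](bigID (mem s)) /=.
have -> : \sum_(q <- r | q \in s) u q = \sum_(q <- s) u q.
  rewrite -big_filter; apply: perm_big; apply: uniq_perm; rewrite ?filter_uniq// => q.
  by rewrite mem_filter; case: (boolP (q \in s)) => // /sr ->.
by rewrite lerDl sumr_ge0.
Qed.

Lemma seq_sum_le_lsum u (s : seq Zn) : (forall q, 0 <= u q) -> uniq s ->
  ((\sum_(q <- s) u q)%:E <= lsum u)%E.
Proof.
move=> u0 us; apply: esum_ge; exists [set` s]; first by split=> //; exact: finite_seq.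
by rewrite -fsbig_seq// sumEFin.
Qed.

Lemma box_sum_le_lsum K u : (forall q, 0 <= u q) -> ((box_sum K u)%:E <= lsum u)%E.
Proof. by move=> u0; apply: seq_sum_le_lsum => //; exact: box_uniq. Qed.

Lemma le_box_sum K K' u : (forall q, 0 <= u q) -> (K <= K')%N -> box_sum K u <= box_sum K' u.
Proof.
move=> u0 KK; apply: le_seq_sum; rewrite ?box_uniq// => q.
exact: sub_box.
Qed.

Lemma lsum_le_box_sum u (B : R) : (forall q, 0 <= u q) ->
  (forall K, box_sum K u <= B) -> (lsum u <= B%:E)%E.
Proof.
move=> u0 uB; apply: ge_ereal_sup => _ [A [finA _] <-].
have [s [us ->]] : exists s : seq Zn, uniq s /\ A = [set` s].
  have /finite_seqP[s As] := finA; exists (undup s); split; first exact: undup_uniq.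
  by rewrite As; apply/seteqP; split => x /=; rewrite mem_undup.
rewrite -fsbig_seq// sumEFin lee_fin.
pose K := (\sum_(q <- s) \sum_j absz (q 0%R j))%N.
rewrite (le_trans _ (uB K))//; apply: le_seq_sum; rewrite ?box_uniq// => q qs.
apply: sub_box (mem_box_sum q).
by rewrite /K (big_rem q)//= leq_addr.
Qed.

(** Truncation outside a box, so that a tail is again a sum over the whole
    lattice. *)
Definition tail K u q : R := if q \in box n K then 0 else u q.

Lemma tail_ge0 K u q : 0 <= u q -> 0 <= tail K u q.
Proof. by rewrite /tail; case: ifP. Qed.

Lemma lsum_tail K u : (forall q, 0 <= u q) ->
  lsum u = ((box_sum K u)%:E + lsum (tail K u))%E.
Proof.
move=> u0.
have -> : (box_sum K u)%:E = lsum (fun q => if q \in box n K then u q else 0).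
  apply/eqP; rewrite eq_le; apply/andP; split.
    rewrite (le_trans _ (@box_sum_le_lsum K _ _))// => [|q]; last by case: ifP.
    rewrite lee_fin /box_sum big_seq [leRHS]big_seq.
    by apply: ler_sum => q ->.
  apply: lsum_le_box_sum => [q|K']; first by case: ifP.
  rewrite /box_sum -big_mkcond -big_filter /=; apply: le_seq_sum => //.
  - exact/filter_uniq/box_uniq.
  - exact: box_uniq.
  - by move=> q; rewrite mem_filter => /andP[].
rewrite -lsumD; first by apply: eq_lsum => q; rewrite /tail; case: ifP => _; rewrite ?addr0 ?add0r.
- by move=> q; case: ifP.
- by move=> q; exact: tail_ge0.
Qed.

Lemma lsum_fin u : (forall q, 0 <= u q) -> (lsum u < +oo)%E ->
  exists2 S : R, 0 <= S & lsum u = S%:E.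
Proof.
move=> u0 uoo; exists (fine (lsum u)); first exact/fine_ge0/lsum_ge0.
by rewrite fineK// ge0_fin_numE// lsum_ge0.
Qed.

Lemma tail_small u (e : R) : (forall q, 0 <= u q) -> (lsum u < +oo)%E -> 0 < e ->
  exists N : nat, forall K, (N <= K)%N -> (lsum (tail K u) <= e%:E)%E.
Proof.
move=> u0 /(lsum_fin u0)[S S0 uS] e0.
have [N hN] : exists N, S - e < box_sum N u.
  apply/not_existsP => h.
  have := @lsum_le_box_sum u (S - e) u0 (fun K => ltac:(rewrite leNgt; exact/negP/h)).
  by rewrite uS lee_fin lerBrDr gerDl leNgt e0.
exists N => K NK; have := lsum_tail K u0; rewrite uS => e1.
have : (S%:E <= (box_sum K u)%:E + e%:E)%E.
  rewrite -EFinD lee_fin -lerBlDr (le_trans (ltW hN))// le_box_sum//.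
by rewrite e1 leeD2lE.
Qed.

Lemma box_sum_cvg u (S : R) : (forall q, 0 <= u q) -> lsum u = S%:E ->
  forall K, box_sum K u <= S.
Proof. by move=> u0 uS K; rewrite -lee_fin -uS box_sum_le_lsum. Qed.

Lemma lsum_weightV2 : (lsum (fun q => weight q ^- 2) <= (3 ^+ n)%:E)%E.
Proof.
apply: lsum_le_box_sum => [q|K]; last exact: sum_weightV2.
by rewrite invr_ge0 exprn_ge0// weight_ge0.
Qed.

(** Expand the nonnegative quantity
    [sum w (u - t)^2] at its minimum [t = a / b]. *)
Lemma weighted_cauchy_schwarz (s : seq Zn) w u : (forall q, 0 <= w q) ->
  (\sum_(q <- s) w q * u q) ^+ 2 <=
  (\sum_(q <- s) w q) * (\sum_(q <- s) w q * u q ^+ 2).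
Proof.
move=> w0; set a := \sum_(q <- s) w q * u q; set b := \sum_(q <- s) w q.
set c := \sum_(q <- s) _.
have b0 : 0 <= b by apply: sumr_ge0.
(* the quadratic polynomial in [t] whose discriminant is the claim *)
have quad (t : R) : 0 <= c - 2 * t * a + t ^+ 2 * b.
  have -> : c - 2 * t * a + t ^+ 2 * b = \sum_(q <- s) w q * (u q - t) ^+ 2.
    rewrite /a /b /c !mulr_sumr -sumrB -big_split /=.
    by apply: eq_bigr => q _; ring.
  by apply: sumr_ge0 => q _; rewrite mulr_ge0// sqr_ge0.
have [b1|b1] := eqVneq b 0.
  have a0 : a = 0.
    rewrite /a big_seq big1// => q qs.
    have := @psumr_eq0 _ _ s xpredT w (fun q _ => w0 q).
    rewrite -/b b1 eqxx => /esym/allP/(_ q qs) /= /eqP ->.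
    by rewrite mul0r.
  by rewrite a0 b1 expr0n mul0r.
have bp : 0 < b by rewrite lt_neqAle eq_sym b1.
have := quad (a / b).
have -> : c - 2 * (a / b) * a + (a / b) ^+ 2 * b = (b * c - a ^+ 2) / b by field.
by rewrite pmulr_lge0 ?invr_gt0// subr_ge0.
Qed.

(** Young's inequality [l^1 * l^2 -> l^2]: apply the Cauchy-Schwarz
    inequality with weight [w (k - .)], then sum over [k] and exchange the
    sums. *)
Lemma young w u v (A : R) : 0 < A -> (forall q, 0 <= w q) -> (forall q, 0 <= u q) ->
  (forall q, 0 <= v q) -> (lsum w <= A%:E)%E ->
  (forall k, (v k)%:E <= lsum (fun l => w (k - l)%R * u l)%R)%E ->
  (lsum (fun k => v k ^+ 2)%R <= (A ^+ 2)%:E * lsum (fun k => u k ^+ 2)%R)%E.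
Proof.
move=> A0 w0 u0 v0 wA vwu.
have wu0 k l : 0 <= w (k - l) * u l ^+ 2 by rewrite mulr_ge0// sqr_ge0.
have cs k : ((v k ^+ 2)%:E <= A%:E * lsum (fun l => w (k - l)%R * u l ^+ 2)%R)%E.
  have [Soo|] := eqVneq (lsum (fun l => w (k - l) * u l ^+ 2)) +oo%E.
    by rewrite Soo gt0_muley ?lte_fin// leey.
  rewrite -ltey => /(lsum_fin (wu0 k))[s s0 sE].
  rewrite sE -EFinM lee_fin -[leRHS]sqr_sqrtr; last by rewrite mulr_ge0// ltW.
  rewrite lerXn2r ?nnegrE ?sqrtr_ge0// -lee_fin (le_trans (vwu k))//.
  apply: lsum_le_box_sum => [l|K]; first by rewrite mulr_ge0.
  rewrite -(ger0_norm (x := box_sum _ _)) -?sqrtr_sqr; last first.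
    by apply: sumr_ge0 => l _; rewrite mulr_ge0.
  rewrite ler_wsqrtr// (le_trans (weighted_cauchy_schwarz _ _ _))//.
  rewrite ler_pM ?sumr_ge0//.
    rewrite -lee_fin (le_trans _ wA)// -(lsum_reflect w k).
    by apply: (@box_sum_le_lsum K (fun l => w (k - l))) => l.
  exact: (box_sum_cvg (wu0 k) sE).
have -> : ((A ^+ 2)%:E * lsum (fun k => u k ^+ 2)%R =
   A%:E * (A%:E * lsum (fun k => u k ^+ 2)%R))%E by rewrite muleA -EFinM.
apply: (@le_trans _ _ (\esum_(k in [set: Zn]) (A%:E * lsum (fun l => w (k - l)%R * u l ^+ 2)%R))%E).
  by apply: le_esum => k _.
rewrite esumZ ?(ltW A0)// => [|k]; last exact: lsum_ge0.
rewrite lee_pmul2l ?lte_fin//.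
rewrite /lsum esum_swap; last by move=> k l; rewrite lee_fin.
rewrite -esumZ ?(ltW A0)// => [|k]; last by rewrite lee_fin sqr_ge0.
apply: le_esum => l _.
have -> : (\esum_(k in [set: Zn]) (w (k - l)%R * u l ^+ 2)%R%:E =
    (u l ^+ 2)%:E * lsum w)%E.
  rewrite -(lsum_shift w (- l)) -lsumZ ?sqr_ge0//.
  by apply: eq_esum => k _; rewrite mulrC.
by rewrite muleC lee_wpmul2r ?lee_fin ?sqr_ge0.
Qed.

End LatticeSums.

(** * Fourier coefficients and Fourier inversion *)

Section ComplexLatticeSums.
Variables (R : realType) (n : nat).
Local Notation Zn := 'rV[int]_n.

(** Positive and negative parts have tails between [0] and [e], so the
    difference of these tails has modulus at most [e]. *)
Lemma zRsum_near (u : Zn -> R) K (e : R) :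
  (lsum (tail K (fun q => `|u q|)%R) <= e%:E)%E -> `|zRsum u - box_sum K u| <= e.
Proof.
move=> ue; pose up q : R := Num.max (u q) 0; pose um q : R := Num.max (- u q) 0.
have up0 q : 0 <= up q by rewrite /up le_max lexx orbT.
have um0 q : 0 <= um q by rewrite /um le_max lexx orbT.
have tl w : (forall q, 0 <= w q) -> (forall q, w q <= `|u q|) ->
    exists2 t : R, 0 <= t <= e & lsum w = (box_sum K w + t)%:E.
  move=> w0 wu.
  have te : (lsum (tail K w) <= e%:E)%E.
    by rewrite (le_trans _ ue)//; apply: le_lsum => q; rewrite /tail; case: ifP.
  have [|t t0 tE] := @lsum_fin _ _ (tail K w) (fun q => tail_ge0 K (w0 q)).
    by rewrite (le_lt_trans te) ?ltry.
  exists t; first by rewrite t0 -lee_fin -tE.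
  by rewrite (lsum_tail K w0) tE.
have [p /andP[p0 pe] pE] := tl up up0 (fun q => ltac:(rewrite /up ge_max ler_norm normr_ge0//)).
have [m /andP[m0 me] mE] := tl um um0 (fun q => ltac:(rewrite /um ge_max -normrN ler_norm normr_ge0//)).
have -> : zRsum u = (box_sum K up + p) - (box_sum K um + m).
  by rewrite /zRsum -/(lsum up) -/(lsum um) pE mE -EFinB.
have -> : box_sum K u = box_sum K up - box_sum K um.
  rewrite /box_sum -sumrB; apply: eq_bigr => q _; rewrite /up /um.
  by rewrite !maxEle; case: (lerP (u q) 0) => h1; case: (lerP (- u q) 0) => h2; lra.
rewrite ler_norml; apply/andP; split; lra.
Qed.

Lemma zsum_near (u : Zn -> R[i]%C) K (e : R) :
  (lsum (tail K (fun q => normc (u q))) <= e%:E)%E ->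
  normc (zsum u - \sum_(q <- box n K) u q) <= e *+ 2.
Proof.
move=> ue; rewrite (le_trans (normc_le_ReIm _))// /zsum ReB ImB Re_sum Im_sum mulr2n.
apply: lerD; apply: zRsum_near; rewrite (le_trans _ ue)//; apply: le_lsum => q;
  by rewrite /tail; case: ifP => // _; rewrite ?Re_le_normc ?Im_le_normc.
Qed.

End ComplexLatticeSums.

Section FourierCoefficients.
Variables (R : realType) (n : nat).
Local Notation Zn := 'rV[int]_n.
Implicit Types (f g b G : 'rV[R]_n -> R[i]%C) (q k l : Zn) (phi : Zn -> R[i]%C).

Lemma grid_avg_cvg C f : lip_coord C f ->
  (fun K => normc (grid_avg K.*2 f)) @ \oo --> normc (torus_int f).
Proof.
move=> fC; apply/cvgrPdist_le => e e0.
have [N hN] := torus_int_near fC e0; near=> K.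
have {}hN : normc (torus_int f - grid_avg K.*2 f) <= e.
  apply: hN; rewrite (@leq_trans K)//; last by rewrite -addnn leq_addr.
  by near: K; exact: nbhs_infty_ge.
rewrite ler_norml; apply/andP; split.
  rewrite lerBrDl lerBlDr (le_trans (ler_normcD_sub _ (torus_int f)))//.
  by rewrite lerD2l normcBC.
by rewrite lerBlDl (le_trans (ler_normcD_sub _ (grid_avg K.*2 f)))// lerD2l.
Unshelve. all: by end_near. Qed.

Lemma lip_coord_echarM B C f q : norm_bounded B f -> lip_coord C f ->
  lip_coord (4 * pi * (l1norm q)%:R * B + C) (fun x => echar q x * f x).
Proof.
move=> fB fC; rewrite -(mul1r C).
exact: lip_coordM (echar_bounded q) fB (echar_lip q) fC.
Qed.

(** Limit of [grid_coef_decay] along the grids with [2 K + 1]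
    points. *)
Lemma fourier_coef_decay P C B g q C' : torus_periodic g -> norm_bounded B g -> lip_coord C' g ->
  diff_decay P C g -> normc (fourier_coef g q) * weight q ^+ P <= 2 ^+ (n * P) * C.
Proof.
move=> gp gB gC gD.
have wP : 0 < weight (R := R) q ^+ P by rewrite exprn_gt0 ?weight_gt0.
rewrite -ler_pdivlMr//.
apply: (cvgr_to_le (grid_avg_cvg (lip_coord_echarM (- q) gB gC))).
near=> K; rewrite ler_pdivlMr//; apply: grid_coef_decay => //.
apply: sub_box (mem_box_sum q); near: K; exact: nbhs_infty_ge.
Unshelve. all: by end_near. Qed.

(** For [q <> 0] the grid average vanishes on fine grids: it is the
    coefficient of a constant, whose differences are zero, and the multiplier of
    [grid_coef_fdiff] is not. *)
Lemma torus_int_echar q : torus_int (@echar R n q) = (q == 0)%:R.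
Proof.
have [->|q0] := eqVneq q 0.
  have -> : @echar R n 0 = fun _ => 1 by apply/funext => x; rewrite echar0.
  apply: normc_eq => e e0; have [N hN] := torus_int_near (@lip_coord_cst R n 1) e0.
  by have := hN N (leqnn N); rewrite grid_avg_cst.
have [j qj] : exists j, q 0 j != 0.
  apply/existsP; rewrite -negb_forall; apply: contra q0 => /forallP h.
  by apply/eqP/rowP => j; rewrite mxE; apply/eqP.
apply/eq0_normc/eqP; rewrite eq_le normc_ge0 andbT.
apply: (cvgr_to_le (grid_avg_cvg (@echar_lip R n q))).
near=> K.
have -> : grid_avg K.*2 (@echar R n q) = grid_coef K.*2 (fun _ => 1) (- q).
  by rewrite /grid_coef; congr (grid_avg _ _); apply/funext => x; rewrite opprK mulr1.
suff -> : grid_coef K.*2 (fun _ : 'rV[R]_n => 1) (- q) = 0 by rewrite normc0.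
have := @grid_coef_fdiff R n K.*2 (fun _ => 1) (- q) j 1 (fun _ _ => erefl).
rewrite expr1 /grid_coef /=.
under [X in grid_avg _ X = _]eq_fun do rewrite subrr mulr0.
rewrite grid_avg_cst => /esym/eqP; rewrite mulf_eq0 => /orP[|/eqP//].
set t := (_ / _ : R); rewrite subr_eq0 => /eqP e1.
have t0 : t != 0.
  by rewrite /t mulf_neq0 ?invr_eq0 ?pnatr_eq0// mxE intr_eq0 oppr_eq0.
have : `|t| <= normc (e2pi t - 1).
  apply: normc_e2piB1_ge; rewrite /t normrM (gtr0_norm (x := _^-1)) ?invr_gt0 ?ltr0n//.
  rewrite -intr_norm mxE normrN -[(`|_|)%:~R]/((absz (q 0 j))%:R).
  rewrite ler_pdivrMr ?ltr0n// ler_pdivlMl// -natrM ler_nat.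
  have : (absz (q 0%R j) <= K)%N.
    have /boxP := mem_box_sum q => /(_ j) h; apply: (leq_trans h).
    near: K; exact: nbhs_infty_ge.
  lia.
by rewrite e1 subrr normc0 leNgt normr_gt0 t0.
Unshelve. all: by end_near. Qed.

Lemma fourier_coef_echar k l : fourier_coef (@echar R n k) l = (k == l)%:R.
Proof.
rewrite /fourier_coef -(subr_eq0 k l) -torus_int_echar; congr torus_int.
by apply/funext => x; rewrite addrC echarD.
Qed.

(** Fourier inversion of [b] under the integral, in the form of an
    inequality between nonnegative sums.  The identity [grid_avg_inversion] is
    passed to the limit as in Tannery's theorem: a fixed box of frequencies
    converges termwise, and the remaining ones are dominated, uniformly in the
    grid, by a tail of the summable [weight^-2]. *)
Lemma torus_int_mul_le b G Cb CG Bb BG C : torus_periodic b ->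
  norm_bounded Bb b -> lip_coord Cb b -> diff_decay 2 C b -> norm_bounded BG G -> lip_coord CG G ->
  ((normc (torus_int (fun x => b x * G x)%R))%:E <=
   lsum (fun q => normc (fourier_coef b q) *
                  normc (torus_int (fun x => echar q x * G x)))%R)%E.
Proof.
move=> bp bB bC bD GB GC.
pose s q := normc (fourier_coef b q) * normc (torus_int (fun x => echar q x * G x)).
have s0 q : 0 <= s q by rewrite mulr_ge0 ?normc_ge0.
have BG0 : 0 <= BG by rewrite (le_trans (normc_ge0 _) (GB 0)).
pose D := 2 ^+ (n * 2) * C.
have D0 : 0 <= D.
  by rewrite mulr_ge0// (le_trans (normc_ge0 _) (bD.1 0)).
have w0 q : 0 <= weight (R := R) q ^- 2 by rewrite invr_ge0 exprn_ge0 ?weight_ge0.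
have wfin : (lsum (fun q : Zn => weight (R := R) q ^- 2)%R < +oo)%E.
  by rewrite (le_lt_trans (lsum_weightV2 R n)) ?ltry.
apply/lee_addgt0Pr => e e0.
have DB1 : 0 < D * BG + 1 by rewrite ltr_wpDl// mulr_ge0.
have [K0 /(_ K0 (leqnn _)) hK0] := tail_small w0 wfin (divr_gt0 e0 DB1).
rewrite (@le_trans _ _ (box_sum K0 s + e)%:E)//; last first.
  by rewrite EFinD leeD2r// box_sum_le_lsum.
rewrite lee_fin.
pose d K q := normc (grid_coef K.*2 b q) * normc (grid_avg K.*2 (fun x => echar q x * G x)).
have dcvg : (fun K => \sum_(q <- box n K0) d K q + e) @ \oo --> box_sum K0 s + e.
  apply: cvgD; last exact: cvg_cst.
  apply: cvg_big => [|q _]; [exact: add_continuous|apply: cvgM].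
    exact: grid_avg_cvg (lip_coord_echarM (- q) bB bC).
  exact: grid_avg_cvg (lip_coord_echarM q GB GC).
apply: (ler_cvg_to (grid_avg_cvg (lip_coordM bB GB bC GC)) dcvg).
near=> K.
have KK : (K0 <= K)%N by near: K; exact: nbhs_infty_ge.
rewrite grid_avg_inversion (le_trans (ler_normc_sum _ _ _))//.
under eq_bigr do rewrite normcM -/(d K _).
rewrite (bigID (fun q => q \in box n K0)) /=; apply: lerD.
  rewrite -big_filter; apply: le_seq_sum.
  - by move=> q; rewrite mulr_ge0 ?normc_ge0.
  - exact/filter_uniq/box_uniq.
  - exact: box_uniq.
  - by move=> q; rewrite mem_filter => /andP[].
rewrite (@le_trans _ _ (D * BG * box_sum K (tail K0 (fun q => weight (R := R) q ^- 2))))//.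
  rewrite mulr_sumr big_mkcond big_seq [leRHS]big_seq; apply: ler_sum => q qK.
  rewrite /tail; case: (boolP (q \in box n K0)) => _ /=; first by rewrite mulr0.
  rewrite [leRHS]mulrAC /d ler_pM ?normc_ge0//.
    by rewrite ler_pdivlMr ?exprn_gt0 ?weight_gt0//; exact: grid_coef_decay.
  by apply: grid_avg_normc => x; rewrite normcM normc_echar mul1r GB.
have t0 q : 0 <= tail K0 (fun q => weight (R := R) q ^- 2) q by exact: tail_ge0.
have te : box_sum K (tail K0 (fun q => weight (R := R) q ^- 2)) <= e / (D * BG + 1).
  by rewrite -lee_fin (le_trans (box_sum_le_lsum K t0)).
have DB0 : 0 <= D * BG by rewrite mulr_ge0.
rewrite (le_trans (ler_wpM2l DB0 te))//.
rewrite mulrCA ler_piMr ?(ltW e0)//.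
by rewrite ler_pdivrMr// mul1r lerDl.
Unshelve. all: by end_near. Qed.

(** Summability of [phi], together with that of its first moment, which
    makes the Fourier transform Lipschitz. *)
Definition summable_moment phi :=
  (lsum (fun l => normc (phi l)) < +oo)%E /\
  (lsum (fun l => (l1norm l)%:R * normc (phi l))%R < +oo)%E.

Definition trigpoly K phi : 'rV[R]_n -> R[i]%C :=
  fun x => \sum_(l <- box n K) phi l * echar (- l) x.

Lemma fourier_near phi K (e : R) x :
  (lsum (tail K (fun l => normc (phi l))) <= e%:E)%E ->
  normc (fourier phi x - trigpoly K phi x) <= e *+ 2.
Proof.
move=> pe; have -> : trigpoly K phi x = \sum_(l <- box n K) e2pi (- zdot l x) * phi l.
  by apply: eq_bigr => l _; rewrite mulrC /echar zdotNl.
apply: zsum_near; rewrite (le_trans _ pe)//; apply: le_lsum => l.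
by rewrite /tail; case: ifP => // _; rewrite normcM normc_e2pi mul1r.
Qed.

Lemma fourier_lip_coord phi : summable_moment phi -> exists C, lip_coord C (fourier phi).
Proof.
move=> [p0 p1].
have n0 l : 0 <= normc (phi l) by exact: normc_ge0.
have n1 l : 0 <= (l1norm l)%:R * normc (phi l) by rewrite mulr_ge0.
have [S S0 SE] := lsum_fin n1 p1.
exists (4 * pi * S) => j x h; apply/ler_addgt0Pr => e e0.
have e4 : 0 < e / 4 by rewrite divr_gt0.
have [K /(_ K (leqnn _)) hK] := tail_small n0 p0 e4.
set y := x + _.
have := fourier_near y hK; have := fourier_near x hK.
set fy := fourier phi y; set fx := fourier phi x => hx hy.
have ht : normc (trigpoly K phi y - trigpoly K phi x) <= 4 * pi * S * `|h|.
  rewrite -sumrB (le_trans (ler_normc_sum _ _ _))//.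
  rewrite (@le_trans _ _ (4 * pi * `|h| * box_sum K (fun l => (l1norm l)%:R * normc (phi l))))//.
    rewrite mulr_sumr; apply: ler_sum => l _.
    rewrite -mulrBr normcM mulrC.
    rewrite (le_trans (ler_wpM2r (n0 l) (echar_lip (- l) j x h)))//.
    have -> : l1norm (- l) = l1norm l.
      by apply: eq_bigr => i _; rewrite mxE abszN.
    by rewrite le_eqVlt; apply/orP; left; apply/eqP; ring.
  rewrite mulrAC ler_wpM2r// ler_wpM2l ?mulr_ge0 ?pi_ge0//.
  exact: (box_sum_cvg n1 SE).
have -> : fy - fx = (fy - trigpoly K phi y) + (trigpoly K phi y - trigpoly K phi x)
  - (fx - trigpoly K phi x) by ring.
rewrite (le_trans (ler_normcB _ _))//.
rewrite (le_trans (lerD (ler_normcD _ _) (lexx _)))//.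
rewrite (le_trans (lerD (lerD hy ht) hx))//.
by rewrite le_eqVlt; apply/orP; left; apply/eqP; field.
Qed.

Lemma fourier_bounded phi : (lsum (fun l => normc (phi l)) < +oo)%E ->
  exists B, norm_bounded B (fourier phi).
Proof.
move=> p0; have n0 l : 0 <= normc (phi l) by exact: normc_ge0.
have [K /(_ K (leqnn _)) hK] := tail_small n0 p0 ltr01.
exists (box_sum K (fun l => normc (phi l)) + 1 *+ 2) => x.
rewrite (le_trans (ler_normcD_sub _ (trigpoly K phi x)))// lerD ?fourier_near//.
rewrite (le_trans (ler_normc_sum _ _ _))//; apply: ler_sum => l _.
by rewrite normcM normc_echar mulr1.
Qed.

(** Term-by-term integration of [phi^], by uniform
    convergence. *)
Lemma torus_int_fourier_near phi g B C K (e : R) : summable_moment phi ->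
  norm_bounded B g -> lip_coord C g ->
  (lsum (tail K (fun l => normc (phi l))) <= e%:E)%E ->
  normc (torus_int (fun x => g x * fourier phi x) -
     \sum_(l <- box n K) phi l * fourier_coef g l) <= B * (e *+ 2).
Proof.
move=> ps gB gC pe.
have [Cf fC] := fourier_lip_coord ps; have [Bf fB] := fourier_bounded ps.1.
pose c l := normc (phi l) * (4 * pi * (l1norm (- l))%:R * B + C).
have cl l : lip_coord (c l) (fun x => phi l * (echar (- l) x * g x)).
  exact/lip_coordZ/lip_coord_echarM.
have -> : \sum_(l <- box n K) phi l * fourier_coef g l =
    torus_int (fun x => \sum_(l <- box n K) phi l * (echar (- l) x * g x)).
  rewrite (torus_int_sum _ cl); apply: eq_bigr => l _.
  by rewrite (torus_intZ _ (lip_coord_echarM (- l) gB gC)).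
rewrite -(torus_intB (lip_coordM gB fB gC fC) (lip_coord_sum _ cl)).
apply: torus_int_bound (lip_coordB (lip_coordM gB fB gC fC) (lip_coord_sum _ cl)) _ => x.
have -> : \sum_(l <- box n K) phi l * (echar (- l) x * g x) = g x * trigpoly K phi x.
  by rewrite mulr_sumr; apply: eq_bigr => l _; ring.
rewrite -mulrBr normcM ler_pM ?normc_ge0//.
exact: fourier_near.
Qed.

Lemma torus_int_fourier_le phi g B C : summable_moment phi ->
  norm_bounded B g -> lip_coord C g ->
  ((normc (torus_int (fun x => g x * fourier phi x)))%:E <=
   lsum (fun l => normc (phi l) * normc (fourier_coef g l))%R)%E.
Proof.
move=> ps gB gC.
have B0 : 0 <= B by rewrite (le_trans (normc_ge0 _) (gB 0)).
have n0 l : 0 <= normc (phi l) by exact: normc_ge0.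
apply/lee_addgt0Pr => e e0.
have B1 : 0 < B *+ 2 + 1 by rewrite ltr_wpDl// mulrn_wge0.
have [K /(_ K (leqnn _)) hK] := tail_small n0 ps.1 (divr_gt0 e0 B1).
have s0 l : 0 <= normc (phi l) * normc (fourier_coef g l) by rewrite mulr_ge0 ?normc_ge0.
apply: (@le_trans _ _ (box_sum K (fun l => normc (phi l) * normc (fourier_coef g l)) + e)%:E).
  rewrite lee_fin (le_trans (ler_normcD_sub _ (\sum_(l <- box n K) phi l * fourier_coef g l)))//.
  apply: lerD.
    rewrite (le_trans (ler_normc_sum _ _ _))//; apply: ler_sum => l _.
    by rewrite normcM.
  rewrite (le_trans (torus_int_fourier_near ps gB gC hK))//.
  have -> : B * (e / (B *+ 2 + 1) *+ 2) = e * ((B *+ 2) / (B *+ 2 + 1)).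
    by field; apply: lt0r_neq0; lra.
  by rewrite ler_piMr ?ler_pdivrMr ?mul1r ?lerDl// ltW.
by rewrite EFinD leeD2r// box_sum_le_lsum.
Qed.

(** Inversion in this direction is the orthogonality of the
    characters. *)
Lemma fourier_inversion phi k : summable_moment phi ->
  torus_int (fun x => echar k x * fourier phi x) = phi k.
Proof.
move=> ps; apply: normc_eq => e e0.
have n0 l : 0 <= normc (phi l) by exact: normc_ge0.
have [N hN] := tail_small n0 ps.1 (divr_gt0 e0 (ltr0n _ 2)).
pose K := maxn N (\sum_j absz (k 0%R j))%N.
have kK : k \in box n K by apply: sub_box (mem_box_sum k); exact: leq_maxr.
have := torus_int_fourier_near ps (echar_bounded k) (@echar_lip R n k) (hN K (leq_maxl _ _)).
have -> : \sum_(l <- box n K) phi l * fourier_coef (@echar R n k) l = phi k.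
  rewrite (bigD1_seq k) ?box_uniq//= fourier_coef_echar eqxx mulr1 big1 ?addr0// => l lk.
  by rewrite fourier_coef_echar eq_sym (negPf lk) mulr0.
by rewrite mul1r mulr2n -splitr.
Qed.

End FourierCoefficients.

(** * Families with uniformly bounded derivatives *)

Section BoundedDerivatives.
Variable R : realType.

(** [N] derivatives, all bounded uniformly over the family.  The recursion
    through some derivative family, rather than through an explicit iterated
    derivative, makes the stability properties below plain inductions. *)
Fixpoint bounded_derivs (I : Type) (N : nat) (F : I -> R -> R) : Prop :=
  (exists C : R, forall i t, `|F i t| <= C) /\
  (if N is N'.+1 then
     exists2 F' : I -> R -> R,
       (forall i (t : R), is_derive t (1 : R) (F i) (F' i t)) & bounded_derivs N' F'
   else True).

Variable I : Type.
Implicit Types (F G : I -> R -> R) (N : nat).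

Lemma bounded_derivs_bounded N F : bounded_derivs N F -> exists C : R, forall i t, `|F i t| <= C.
Proof. by case: N => [|N] []. Qed.

Lemma bounded_derivsSW N F : bounded_derivs N.+1 F -> bounded_derivs N F.
Proof.
elim: N F => [|N IH] F [bF [F' dF bF']]; first by split.
by split=> //; exists F' => //; exact: IH.
Qed.

Lemma bounded_derivsD N F G : bounded_derivs N F -> bounded_derivs N G -> bounded_derivs N (fun i t => F i t + G i t).
Proof.
elim: N F G => [|N IH] F G [[C FC] hF] [[D GD] hG].
  split=> //; exists (C + D) => i t.
  by rewrite (le_trans (ler_normD _ _))// lerD.
split.
  exists (C + D) => i t.
  by rewrite (le_trans (ler_normD _ _))// lerD.
have [F' dF bF'] := hF; have [G' dG bG'] := hG.
exists (fun i t => F' i t + G' i t); last exact: IH.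
by move=> i t; have := dF i t; have := dG i t => d1 d2; exact: is_deriveD.
Qed.

Lemma bounded_derivsM N F G : bounded_derivs N F -> bounded_derivs N G -> bounded_derivs N (fun i t => F i t * G i t).
Proof.
have b0 (F1 G1 : I -> R -> R) : (exists C : R, forall i t, `|F1 i t| <= C) ->
    (exists C : R, forall i t, `|G1 i t| <= C) ->
    exists C : R, forall i t, `|F1 i t * G1 i t| <= C.
  move=> [C FC] [D GD]; exists (C * D) => i t.
  by rewrite normrM ler_pM.
elim: N F G => [|N IH] F G hF hG.
  by split=> //; apply: b0; [case: hF|case: hG].
split; first by apply: b0; apply: bounded_derivs_bounded; [exact: hF|exact: hG].
have hF0 := bounded_derivsSW hF; have hG0 := bounded_derivsSW hG.
have [_ [F' dF bF']] := hF; have [_ [G' dG bG']] := hG.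
exists (fun i t => F i t * G' i t + G i t * F' i t).
  by move=> i t; have := dF i t; have := dG i t => d1 d2; exact: is_deriveM.
by apply: bounded_derivsD; exact: IH.
Qed.

Lemma bounded_derivs_cst N (c : I -> R) (C : R) : (forall i, `|c i| <= C) ->
  bounded_derivs N (fun i _ => c i).
Proof.
elim: N c C => [|N IH] c C cC; first by split=> //; exists C => i _.
split; first by exists C => i _.
exists (fun _ _ => 0); last by apply: (IH (fun _ => 0) 0) => i; rewrite normr0.
by move=> i t; exact: is_derive_cst.
Qed.

Lemma bounded_derivsZ N (c : R) F : bounded_derivs N F -> bounded_derivs N (fun i t => c * F i t).
Proof. by apply: bounded_derivsM; exact: (@bounded_derivs_cst N (fun _ => c) `|c|). Qed.

(** The derivative [- F' / F^2] of the inverse is a product of families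
    that are known to be good one order below. *)
Lemma bounded_derivsV N F (c : R) : 0 < c -> (forall i t, c <= F i t) -> bounded_derivs N F ->
  bounded_derivs N (fun i t => (F i t)^-1).
Proof.
move=> c0 Fc.
have F0 i t : 0 < F i t by rewrite (lt_le_trans c0).
have b0 : exists C : R, forall i t, `|(F i t)^-1| <= C.
  by exists c^-1 => i t; rewrite ger0_norm ?invr_ge0 ?(ltW (F0 _ _))// lef_pV2 ?posrE.
elim: N => [|N IH] hF; first by split.
split=> //; have {}IH := IH (bounded_derivsSW hF).
have [_ [F' dF bF']] := hF.
exists (fun i t => ((F i t)^-1 * (F i t)^-1) * (-1 * F' i t)).
  move=> i t; have d := dF i t.
  have -> : (F i t)^-1 * (F i t)^-1 * (-1 * F' i t) = - (F i t) ^- 2 *: F' i t.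
    by rewrite -exprVn expr2 mulN1r mulrN -mulNr.
  by apply: is_deriveV => //; rewrite gt_eqF.
by apply: bounded_derivsM; [exact: bounded_derivsM|exact: bounded_derivsZ].
Qed.

Definition ldiff (h : R) (u : R -> R) : R -> R := fun t => u (t + h) - u t.

Lemma is_derive_ldiff h N (u u' : R -> R) :
  (forall t : R, is_derive t (1 : R) u (u' t)) ->
  forall t : R, is_derive t (1 : R) (iter N (ldiff h) u) (iter N (ldiff h) u' t).
Proof.
move=> du; elim: N => [//|N IH] t /=.
have dg : is_derive t (1 : R) (fun s : R => s + h) 1.
  rewrite -[X in is_derive _ _ _ X]addr0.
  exact: (@is_deriveD _ _ _ id (cst h)).
have d1 := @is_derive1_comp R _ (fun s : R => s + h) t _ _ (IH (t + h)) dg.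
rewrite mulr1 in d1; have d2 := IH t.
by apply: is_deriveB.
Qed.

End BoundedDerivatives.

(** The mean value theorem, applied to the [N]-th difference, whose
    derivative is the [N]-th difference of the derivative. *)
Lemma bounded_derivs_ldiff (R : realType) (I : Type) (N : nat) (F : I -> R -> R) : bounded_derivs N F ->
  exists C : R, forall i t h, `|iter N (@ldiff R h) (F i) t| <= C * `|h| ^+ N.
Proof.
elim: N F => [|N IH] F.
  by move=> [[C FC] _]; exists C => i t h; rewrite expr0 mulr1; exact: FC.
move=> [_ [F' dF /IH[C hC]]]; exists C => i t h.
rewrite /= {1}/ldiff.
have dI := is_derive_ldiff h N (dF i).
have ct a b : {within `[a, b], continuous (iter N (@ldiff R h) (F i))}.
  apply/continuous_subspaceT => x.
  by apply/differentiable_continuous/derivable1_diffP; case: (dI x).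
have aux a b : a <= b -> `|iter N (@ldiff R h) (F i) b - iter N (@ldiff R h) (F i) a|
    <= C * `|h| ^+ N * `|b - a|.
  move=> ab; have [c _ ->] := MVT_segment ab (fun x _ => dI x) (ct a b).
  by rewrite normrM ler_wpM2r.
rewrite exprSr mulrA; have [h0|/ltW h0] := leP 0 h.
  have /aux : t <= t + h by rewrite lerDl.
  by rewrite (addrC t) addrK.
have /aux : t + h <= t by rewrite gerDl.
by rewrite distrC opprD addNKr normrN.
Qed.

Section UniformlySmooth.
Variables (R : realType) (n : nat).
Implicit Types (j : 'I_n) (x : 'rV[R]_n).

(** The restrictions of [g i] to all lines parallel to a coordinate axis
    form one family, so that uniformity in the base point is built in. *)
Definition line (I : Type) (g : I -> 'rV[R]_n -> R[i]%C)
    (p : I * 'rV[R]_n * 'I_n) (t : R) : R[i]%C :=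
  g p.1.1 (p.1.2 + t *: delta_mx 0 p.2).

Definition unif_smooth (I : Type) (g : I -> 'rV[R]_n -> R[i]%C) : Prop :=
  (exists C : R, forall i, norm_bounded C (g i)) /\
  forall N, bounded_derivs N (fun p t => complex.Re (line g p t)) /\
            bounded_derivs N (fun p t => complex.Im (line g p t)).

Lemma fdiff_line (I : Type) (g : I -> 'rV[R]_n -> R[i]%C) i x j h N t :
  complex.Re (fdiff h j N (g i) (x + t *: delta_mx 0 j)) =
    iter N (ldiff h) (fun s => complex.Re (line g (i, x, j) s)) t /\
  complex.Im (fdiff h j N (g i) (x + t *: delta_mx 0 j)) =
    iter N (ldiff h) (fun s => complex.Im (line g (i, x, j) s)) t.
Proof.
elim: N t => [//|N IH] t; rewrite /= /ldiff -!(IH _).1 -!(IH _).2 ReB ImB.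
by rewrite scalerDl addrA.
Qed.

Lemma unif_smooth_fdiff (I : Type) (g : I -> 'rV[R]_n -> R[i]%C) N :
  unif_smooth g -> exists C : R, forall i j h x,
    normc (fdiff h j N (g i) x) <= C * `|h| ^+ N.
Proof.
move=> [_ /(_ N)[/bounded_derivs_ldiff[C1 h1] /bounded_derivs_ldiff[C2 h2]]]; exists (C1 + C2) => i j h x.
have [e1 e2] := fdiff_line g i x j h N 0.
rewrite scale0r addr0 in e1 e2.
by rewrite (le_trans (normc_le_ReIm _))// e1 e2 mulrDl lerD.
Qed.

Lemma unif_smooth_bounds (I : Type) (g : I -> 'rV[R]_n -> R[i]%C) P :
  unif_smooth g -> exists C : R, forall i,
    [/\ norm_bounded C (g i), lip_coord C (g i) & diff_decay P C (g i)].
Proof.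
move=> gs; have [[C0 h0] _] := gs.
have [C1 h1] := unif_smooth_fdiff 1 gs; have [CP hP] := unif_smooth_fdiff (n * P) gs.
exists (`|C0| + `|C1| + `|CP|) => i.
have l0 : C0 <= `|C0| + `|C1| + `|CP|.
  by rewrite (le_trans (ler_norm _))// -addrA lerDl addr_ge0.
have l1 : C1 <= `|C0| + `|C1| + `|CP|.
  by rewrite (le_trans (ler_norm _))// addrAC lerDr addr_ge0.
have lP : CP <= `|C0| + `|C1| + `|CP|.
  by rewrite (le_trans (ler_norm _))// lerDr addr_ge0.
have b : norm_bounded (`|C0| + `|C1| + `|CP|) (g i).
  by move=> x; rewrite (le_trans (h0 i x)).
split=> //.
  by move=> j x h; rewrite (le_trans (h1 i j h x))// ler_wpM2r.
by split=> // j h x; rewrite (le_trans (hP i j h x))// ler_wpM2r.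
Qed.

(** The real and imaginary parts of [1 / g] are those of [g], up to sign,
    over [|g|^2]. *)
Lemma unif_smoothV (I : Type) (g : I -> 'rV[R]_n -> R[i]%C) (c : R) : 0 < c ->
  (forall i x, c <= normc (g i x)) -> unif_smooth g ->
  unif_smooth (fun i x => (g i x)^-1).
Proof.
move=> c0 gc [_ gs]; split.
  exists c^-1 => i x; rewrite normcV lef_pV2 ?posrE//.
  exact: lt_le_trans (gc i x).
move=> N; have [hR hI] := gs N.
pose Q p t : R := complex.Re (line g p t) ^+ 2 + complex.Im (line g p t) ^+ 2.
have QE p t : Q p t = normc (line g p t) ^+ 2 by rewrite sqr_normc.
have hQ : bounded_derivs N (fun p t => (Q p t)^-1).
  apply: (bounded_derivsV (c := c ^+ 2)); first by rewrite exprn_gt0.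
    by move=> p t; rewrite QE lerXn2r ?nnegrE ?(ltW c0) ?normc_ge0//; exact: gc.
  have -> : Q = fun p t => complex.Re (line g p t) * complex.Re (line g p t) +
                          complex.Im (line g p t) * complex.Im (line g p t).
    by apply/funext => p; apply/funext => t; rewrite /Q !expr2.
  by apply: bounded_derivsD; exact: bounded_derivsM.
have RE p t : complex.Re (line (fun i x => (g i x)^-1) p t) =
    complex.Re (line g p t) * (Q p t)^-1.
  by rewrite /Q /line; case: (g _ _) => a b.
have IE p t : complex.Im (line (fun i x => (g i x)^-1) p t) =
    -1 * complex.Im (line g p t) * (Q p t)^-1.
  by rewrite /Q /line; case: (g _ _) => a b /=; rewrite mulN1r mulNr.
split; [under eq_fun => p do under eq_fun do rewrite RE
       |under eq_fun => p do under eq_fun do rewrite IE].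
  exact: bounded_derivsM.
by apply: bounded_derivsM => //; exact: bounded_derivsZ.
Qed.

(** Existence of all pure derivatives up to order [N] in one coordinate,
    a class that is visibly stable under complex linear combinations. *)
Fixpoint diff_along j N (h : 'rV[R]_n -> R[i]%C) : Prop :=
  if N is N'.+1 then
    (forall x, derivable (repart h) x (delta_mx 0 j) /\
               derivable (impart h) x (delta_mx 0 j)) /\ diff_along j N' (pderiv j h)
  else True.

Lemma smooth_diff_along j N h : smooth h -> diff_along j N h.
Proof.
elim: N h => [//|N IH] h hs; split; first by have [_ _] := hs [::]; apply.
by apply: IH => s; have := hs (rcons s j); rewrite foldr_rcons.
Qed.

Lemma derivable_lincomb (f g : 'rV[R]_n -> R) (a b : R) x v :
  derivable f x v -> derivable g x v ->
  derivable (fun y => a * f y + b * g y) x v /\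
  'D_v (fun y => a * f y + b * g y) x = a * 'D_v f x + b * 'D_v g x.
Proof.
move=> df dg.
have dfa : is_derive x v (a \*: f) (a *: 'D_v f x) by apply: is_deriveZ; exact: derivableP.
have dgb : is_derive x v (b \*: g) (b *: 'D_v g x) by apply: is_deriveZ; exact: derivableP.
have d := is_deriveD dfa dgb.
have e : (fun y => a * f y + b * g y) = (a \*: f) + (b \*: g) by [].
by rewrite e; split; [exact: ex_derive|rewrite derive_val].
Qed.

Lemma pderiv_lincomb j (a b : R[i]%C) g h :
  (forall x, derivable (repart g) x (delta_mx 0 j) /\
             derivable (impart g) x (delta_mx 0 j)) ->
  (forall x, derivable (repart h) x (delta_mx 0 j) /\
             derivable (impart h) x (delta_mx 0 j)) ->
  let f := fun x => a * g x + b * h x in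
  (forall x, derivable (repart f) x (delta_mx 0 j) /\
             derivable (impart f) x (delta_mx 0 j)) /\
  pderiv j f = (fun x => a * pderiv j g x + b * pderiv j h x).
Proof.
case: a b => [a1 a2] [b1 b2] dg dh f.
have fR : repart f = (fun x => 1 * (a1 * repart g x + - a2 * impart g x)
    + 1 * (b1 * repart h x + - b2 * impart h x)).
  apply/funext => x; rewrite /f /repart /impart.
  by case: (g x) (h x) => u1 u2 [w1 w2] /=; ring.
have fI : impart f = (fun x => 1 * (a1 * impart g x + a2 * repart g x)
    + 1 * (b1 * impart h x + b2 * repart h x)).
  apply/funext => x; rewrite /f /repart /impart.
  by case: (g x) (h x) => u1 u2 [w1 w2] /=; ring.
have dR x := derivable_lincomb 1 1
  (derivable_lincomb a1 (- a2) (dg x).1 (dg x).2).1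
  (derivable_lincomb b1 (- b2) (dh x).1 (dh x).2).1.
have dI x := derivable_lincomb 1 1
  (derivable_lincomb a1 a2 (dg x).2 (dg x).1).1
  (derivable_lincomb b1 b2 (dh x).2 (dh x).1).1.
split; first by move=> x; rewrite fR fI; split; [exact: (dR x).1|exact: (dI x).1].
apply/funext => x; rewrite /pderiv fR fI (dR x).2 (dI x).2.
rewrite (derivable_lincomb a1 (- a2) (dg x).1 (dg x).2).2.
rewrite (derivable_lincomb b1 (- b2) (dh x).1 (dh x).2).2.
rewrite (derivable_lincomb a1 a2 (dg x).2 (dg x).1).2.
rewrite (derivable_lincomb b1 b2 (dh x).2 (dh x).1).2.
by apply: complex_eqP => /=; ring.
Qed.

Lemma diff_along_lincomb j N (a b : R[i]%C) g h : diff_along j N g -> diff_along j N h ->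
  diff_along j N (fun x => a * g x + b * h x).
Proof.
elim: N g h => [//|N IH] g h [dg hg] [dh hh].
have [d e] := pderiv_lincomb a b dg dh.
by split=> //; rewrite e; exact: IH.
Qed.

Lemma diff_along_Dx1 j l g : (forall N, diff_along j N g) -> forall N, diff_along j N (Dx1 j l g).
Proof.
move=> hg; elim: l => [//|l IH] N /=.
have := diff_along_lincomb (2 * pi%:C * 'i)^-1%C (- l%:R) (IH N.+1).2 (IH N).
by congr diff_along; apply/funext => x; rewrite mulNr.
Qed.

Lemma is_derive_line (f : 'rV[R]_n -> R) j x (t : R) :
  derivable f (x + t *: delta_mx 0 j) (delta_mx 0 j) ->
  is_derive t (1 : R) (fun s => f (x + s *: delta_mx 0 j))
    ('D_(delta_mx 0 j) f (x + t *: delta_mx 0 j)).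
Proof.
move=> df.
have e : (fun h : R => h^-1 *: (f (x + (h *: (1 : R) + t) *: delta_mx 0 j)
      - f (x + t *: delta_mx 0 j)))
  = (fun h : R => h^-1 *: (f (h *: delta_mx 0 j + (x + t *: delta_mx 0 j))
      - f (x + t *: delta_mx 0 j))).
  apply/funext => h; congr (_ *: (f _ - _)).
  by rewrite [h *: 1]mulr1 scalerDl addrCA.
by apply: DeriveDef; rewrite /derivable /derive /= e.
Qed.

(** The recursion defining the operators [D^{(l)}], solved for the plain
    derivative. *)
Lemma pderiv_Dx1 j l g x :
  pderiv j (Dx1 j l g) x =
  (2 * pi%:C * 'i)%C * (Dx1 j l.+1 g x + l%:R * Dx1 j l g x).
Proof.
rewrite /= subrK mulrA divff ?mul1r//.
rewrite mulf_neq0//; last by rewrite eq_complex /= oner_eq0 andbF.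
rewrite mulf_neq0 ?pnatr_eq0//.
by rewrite eq_complex /= negb_and gt_eqF// pi_gt0.
Qed.

Lemma twopii_components l (z w : R[i]%C) :
  (2 * pi%:C * 'i)%C * (z + l%:R * w) =
  ((- 2 * pi * (complex.Im z + l%:R * complex.Im w)) +i*
   (2 * pi * (complex.Re z + l%:R * complex.Re w)))%C.
Proof.
have -> : (2 : R[i]%C) = ((2 : R)%:C)%C by rewrite rmorph_nat.
have -> : (l%:R : R[i]%C) = ((l%:R : R)%:C)%C by rewrite rmorph_nat.
by case: z w => z1 z2 [w1 w2]; apply: complex_eqP => /=; ring.
Qed.

(** By [pderiv_Dx1], the derivative of [D^{(l)} g] along its coordinate is a
    combination of [D^{(l)} g] and [D^{(l+1)} g]; so the family of all
    [D^{(l)} g] is closed under differentiation, and bounds on its members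
    give bounds on every derivative.  The real factor [c] normalizes the
    family. *)
Lemma unif_smooth_Dx1 (I : Type) (c : I -> R) (g : I -> 'rV[R]_n -> R[i]%C) :
  (forall i j N, diff_along j N (g i)) ->
  (exists C : R, forall i x, `|c i| * normc (g i x) <= C) ->
  (forall j l, exists C : R, forall i x, `|c i| * normc (Dx1 j l (g i) x) <= C) ->
  unif_smooth (fun i x => (c i)%:C%C * g i x).
Proof.
move=> gd [C0 hC0] gb; split.
  by exists C0 => i x; rewrite normcM normcR.
pose D l (p : I * 'rV[R]_n * 'I_n) (t : R) :=
  Dx1 p.2 l (g p.1.1) (p.1.2 + t *: delta_mx 0 p.2).
have Db l : exists C : R, forall p t, `|c p.1.1| * normc (D l p t) <= C.
  have /choice[C hC] : forall j, exists C : R, forall i x,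
     `|c i| * normc (Dx1 j l (g i) x) <= C by move=> j; exact: gb.
  exists (\sum_j `|C j|) => -[[i x] j] t /=.
  rewrite (le_trans (hC j i _))// (le_trans (ler_norm _))//.
  by rewrite (bigD1 j)//= lerDl sumr_ge0.
have main N : forall l, bounded_derivs N (fun p t => c p.1.1 * complex.Re (D l p t)) /\
                        bounded_derivs N (fun p t => c p.1.1 * complex.Im (D l p t)).
  elim: N => [|N IH] l.
    have [C hC] := Db l.
    by split; split=> //; exists C => p t; rewrite normrM (le_trans _ (hC p t))//
      ler_wpM2l ?Re_le_normc ?Im_le_normc.
  have [C hC] := Db l; have [hR hI] := IH l; have [hR1 hI1] := IH l.+1.
  have dR (p : I * 'rV[R]_n * 'I_n) (t : R) :
      is_derive t (1 : R) (fun s => complex.Re (D l p s)) _ :=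
    is_derive_line (((diff_along_Dx1 l (gd p.1.1 p.2)) 1%N).1
      (p.1.2 + t *: delta_mx 0 p.2)).1.
  have dI (p : I * 'rV[R]_n * 'I_n) (t : R) :
      is_derive t (1 : R) (fun s => complex.Im (D l p s)) _ :=
    is_derive_line (((diff_along_Dx1 l (gd p.1.1 p.2)) 1%N).1
      (p.1.2 + t *: delta_mx 0 p.2)).2.
  have eR p t : complex.Re (pderiv p.2 (Dx1 p.2 l (g p.1.1))
      (p.1.2 + t *: delta_mx 0 p.2)) =
      - 2 * pi * (complex.Im (D l.+1 p t) + l%:R * complex.Im (D l p t)).
    by rewrite pderiv_Dx1 twopii_components.
  have eI p t : complex.Im (pderiv p.2 (Dx1 p.2 l (g p.1.1))
      (p.1.2 + t *: delta_mx 0 p.2)) =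
      2 * pi * (complex.Re (D l.+1 p t) + l%:R * complex.Re (D l p t)).
    by rewrite pderiv_Dx1 twopii_components.
  split; split.
  - by exists C => p t; rewrite normrM (le_trans _ (hC p t))// ler_wpM2l ?Re_le_normc.
  - exists (fun p t => - 2 * pi * (c p.1.1 * complex.Im (D l.+1 p t)
        + l%:R * (c p.1.1 * complex.Im (D l p t)))); last first.
      by apply: bounded_derivsZ; apply: bounded_derivsD => //; exact: bounded_derivsZ.
    move=> p t; have := @is_deriveZ _ _ _ _ (c p.1.1) _ _ _ (dR p t).
    rewrite [X in _ *: X](eR p t).
    by move=> h; apply: (is_derive_eq h); rewrite /GRing.scale /=; ring.
  - by exists C => p t; rewrite normrM (le_trans _ (hC p t))// ler_wpM2l ?Im_le_normc.
  - exists (fun p t => 2 * pi * (c p.1.1 * complex.Re (D l.+1 p t)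
        + l%:R * (c p.1.1 * complex.Re (D l p t)))); last first.
      by apply: bounded_derivsZ; apply: bounded_derivsD => //; exact: bounded_derivsZ.
    move=> p t; have := @is_deriveZ _ _ _ _ (c p.1.1) _ _ _ (dI p t).
    rewrite [X in _ *: X](eI p t).
    by move=> h; apply: (is_derive_eq h); rewrite /GRing.scale /=; ring.
move=> N; have [hR hI] := main N 0%N; split.
  by under eq_fun => p do under eq_fun do rewrite /line ReZ.
by under eq_fun => p do under eq_fun do rewrite /line ImZ.
Qed.

End UniformlySmooth.

(** * Differences on the lattice and Peetre's inequality *)

Section MultiIndices.
Variables (n : nat).

Lemma difs_zero (V : zmodType) (f : 'rV[int]_n -> V) : difs (fun _ => 0%N) f = f.
Proof. by rewrite /difs; elim: (enum _). Qed.

Lemma foldr_single (T : Type) (F : 'I_n -> T -> T) j (x : T) (s : seq 'I_n) : uniq s ->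
  foldr (fun i y => if i == j then F i y else y) x s =
  if j \in s then F j x else x.
Proof.
elim: s => [//|i s IH] /= /andP[ins us]; rewrite IH// in_cons.
by case: (eqVneq i j) => [<-|ij] //=; rewrite (negPf ins).
Qed.

Lemma difs_single (V : zmodType) j (f : 'rV[int]_n -> V) :
  difs (fun i => (i == j)%N) f = dif j f.
Proof.
rewrite /difs -[RHS](_ : (if j \in enum 'I_n then dif j f else f) = _); last first.
  by rewrite mem_enum.
rewrite -(foldr_single _ _ _ (enum_uniq 'I_n)).
by elim: (enum 'I_n) => //= i s ->; case: eqP.
Qed.

Lemma Dx_single (R : realType) j l (g : 'rV[R]_n -> R[i]%C) :
  Dx (fun i => if i == j then l else 0%N) g = Dx1 j l g.
Proof.
rewrite /Dx -[RHS](_ : (if j \in enum 'I_n then Dx1 j l g else g) = _); last first.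
  by rewrite mem_enum.
rewrite -(foldr_single (fun i => Dx1 i l) _ _ (enum_uniq 'I_n)).
by elim: (enum 'I_n) => //= i s ->; case: eqP.
Qed.

Lemma zmonomial_zero (k : 'rV[int]_n) : zmonomial (fun _ => 0%N) k = 1.
Proof. by rewrite /zmonomial big1. Qed.

Lemma mlen_zero : mlen (fun _ : 'I_n => 0%N) = 0%N.
Proof. by rewrite /mlen big1. Qed.

Lemma mlen_single (j : 'I_n) : mlen (fun i => (i == j)%N) = 1%N.
Proof. by rewrite /mlen (bigD1 j)//= eqxx big1 ?addn0// => i /negPf ->. Qed.

End MultiIndices.

Section LatticePaths.
Variables (R : realType) (n : nat).
Local Notation Zn := 'rV[int]_n.

Lemma l1norm_eq0 (q : Zn) : l1norm q = 0%N -> q = 0.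
Proof.
move=> /eqP; rewrite /l1norm sum_nat_eq0 => /forallP h.
by apply/rowP => j; rewrite mxE; apply/eqP; have := h j; rewrite absz_eq0.
Qed.

Lemma l1norm_step (q : Zn) : q != 0 -> exists j (s : bool),
  let q' := if s then q - delta_mx 0 j else q + delta_mx 0 j in
  l1norm q = (l1norm q').+1 /\ weight (R := R) q' <= weight q.
Proof.
move=> q0.
have [j qj] : exists j, q 0 j != 0.
  apply/existsP; rewrite -negb_forall; apply: contra q0 => /forallP h.
  by apply/eqP/rowP => j; rewrite mxE; apply/eqP.
exists j, (0 < q 0 j) => q'.
have qi i : i != j -> q' 0 i = q 0 i.
  by move=> ij; rewrite /q'; case: ifP => _; rewrite !mxE eqxx /= (negPf ij) ?subr0 ?addr0.
have qjj : absz (q 0 j) = (absz (q' 0 j)).+1.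
  rewrite /q'; case: ifP => h; rewrite !mxE !eqxx /=; move: (q 0 j) h qj => x; lia.
split.
  rewrite /l1norm (bigD1 j)//= [in RHS](bigD1 j)//= qjj addSn; congr (_ + _).+1.
  by apply: eq_bigr => i ij; rewrite qi.
rewrite /weight (bigD1 j)//= [leRHS](bigD1 j)//= qjj.
have -> : \prod_(i < n | i != j) (1 + (absz (q' 0%R i))%:R) =
    \prod_(i < n | i != j) (1 + (absz (q 0%R i))%:R) :> R.
  by apply: eq_bigr => i ij; rewrite qi.
by rewrite ler_wpM2r ?prodr_ge0// ?lerD2l ?ler_nat// => i _; rewrite addr_ge0.
Qed.

(** Walk from [k] to [k + q] along unit steps; the intermediate points [p]
    satisfy [weight (p - k) <= weight q].  Stated for an arbitrary
    pseudodistance [d], since it serves both for powers of [L] and for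
    coefficients of the symbol. *)
Lemma path_bound (d : Zn -> Zn -> R) (k q : Zn) (B : R) :
  (forall x, d x x = 0) -> (forall x y, d x y = d y x) ->
  (forall x y z, d x z <= d x y + d y z) ->
  (forall p j, weight (R := R) (p - k) <= weight q -> d p (p + delta_mx 0 j) <= B) ->
  d k (k + q) <= (l1norm q)%:R * B.
Proof.
move=> d0 dC dT; move: {2}(l1norm q) (erefl (l1norm q)) => N.
elim: N q => [|N IH] q qN h.
  by rewrite (l1norm_eq0 qN) addr0 d0 /l1norm big1 ?mul0r// => j _; rewrite mxE absz0.
have q0 : q != 0.
  by apply: contra_eq_neq qN => ->; rewrite /l1norm big1// => j _; rewrite mxE absz0.
have [j [s]] := l1norm_step q0; set q' := (if s then _ else _) => -[qq' wq'].
have IHq : d k (k + q') <= (l1norm q')%:R * B.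
  by apply: IH; [move: qN; rewrite qq' => -[]|move=> p i pw; apply: h; exact: le_trans wq'].
rewrite qq' -natr1 mulrDl mul1r (le_trans (dT _ (k + q') _))// lerD//.
rewrite /q' in wq' *; case: s {IHq qq'} @q' wq' => q' wq'.
  have -> : k + q = (k + (q - delta_mx 0 j)) + delta_mx 0 j by rewrite -addrA subrK.
  by apply: h; rewrite addrAC subrr add0r.
rewrite dC addrA; apply: h.
by rewrite addrAC subrr add0r.
Qed.

End LatticePaths.

Section Weights.
Variables (R : realType) (n : nat) (L : 'rV[int]_n -> R) (mu c0 CL : R).
Hypotheses (mu_gt0 : 0 < mu) (c0_gt0 : 0 < c0) (L_ge : forall k, c0 <= L k)
  (CL_gt0 : 0 < CL)
  (L_dif : forall k j, `|L (k + delta_mx 0 j) - L k| <= CL * L k `^ (1 - mu^-1)).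
Local Notation Zn := 'rV[int]_n.

Let L_gt0 k : 0 < L k. Proof. exact: lt_le_trans (L_ge k). Qed.
Let theta k := L k `^ mu^-1.
Let theta0 := c0 `^ mu^-1.

Let theta0_gt0 : 0 < theta0. Proof. exact: powR_gt0. Qed.
Let theta_ge k : theta0 <= theta k.
Proof.
by apply: ge0_ler_powR; rewrite ?nnegrE ?invr_ge0 ?(ltW mu_gt0) ?(ltW c0_gt0) ?(ltW (L_gt0 k)).
Qed.
Let theta_gt0 k : 0 < theta k. Proof. exact: powR_gt0. Qed.

(** With [u = L(k + e_j) / L(k)] the hypothesis on differences says that
    [|u - 1| <= CL / theta(k)].  As [u] is bounded, [|u^s - 1|] is at most a
    constant times [|u - 1|], which is seen by comparing [s] with an integer
    [r >= s].  Multiplying by [theta(k)] gives the claim. *)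
Lemma theta_step : exists2 C : R, 0 <= C &
  forall k j, `|theta (k + delta_mx 0 j) - theta k| <= C.
Proof.
pose s := mu^-1; have s0 : 0 < s by rewrite invr_gt0.
pose r := (Num.truncn s).+1.
have sr : s <= r%:R by rewrite ltW// truncnS_gt.
(* [U] bounds the ratio [u], as [theta0] is a lower bound of [theta] *)
pose U := 1 + CL / theta0.
have U1 : 1 <= U by rewrite lerDl divr_ge0// ltW.
exists (CL * (r%:R * U ^+ r)).
  by rewrite mulr_ge0 ?(ltW CL_gt0)// mulr_ge0// exprn_ge0// (le_trans ler01).
move=> k j; set k' := k + _.
pose u := L k' / L k.
have u0 : 0 < u by rewrite divr_gt0.
have thE : theta k' = theta k * u `^ s.
  rewrite /theta -powRM ?(ltW (L_gt0 _)) ?(ltW u0)//.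
  by rewrite /u mulrCA divff ?mulr1// gt_eqF.
have u1 : `|u - 1| <= CL / theta k.
  have -> : u - 1 = (L k' - L k) / L k by rewrite mulrBl divff// gt_eqF.
  rewrite normrM (gtr0_norm (x := _^-1)) ?invr_gt0//.
  rewrite ler_pdivrMr// (le_trans (L_dif k j))// le_eqVlt; apply/orP; left; apply/eqP.
  rewrite powRD; last by rewrite (gt_eqF (L_gt0 k)) implybT.
  rewrite powRr1 ?(ltW (L_gt0 k))// powRN -/(theta k); field.
  exact: lt0r_neq0.
have uU : u <= U.
  have : u - 1 <= CL / theta0.
    rewrite (le_trans (ler_norm _))// (le_trans u1)// ler_wpM2l ?(ltW CL_gt0)//.
    by rewrite lef_pV2 ?posrE.
  by rewrite /U lerBlDl.
have h1 : `|u `^ s - 1| <= `|u ^+ r - 1|.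
  have [u_ge1|u_lt1] := leP 1 u.
    rewrite !ger0_norm ?subr_ge0 ?exprn_ege1//.
      by rewrite lerD2r -powR_mulrn ?(ltW u0)// ler_powR.
    by rewrite -(powRr0 u) ler_powR// ltW.
  rewrite !ler0_norm ?subr_le0.
  - rewrite !opprB lerD2l lerN2 -powR_mulrn ?(ltW u0)//.
    by rewrite ger_powR// u0 ltW.
  - by rewrite exprn_ile1// ltW.
  - by rewrite -(powRr0 u) ger_powR// ?u0 ?(ltW s0)// ltW.
have h2 : `|u ^+ r - 1| <= `|u - 1| * (r%:R * U ^+ r).
  rewrite subrX1 normrM ler_wpM2l// (le_trans (ler_norm_sum _ _ _))//.
  rewrite mulr_natl -[X in _ *+ X](card_ord r) -sumr_const; apply: ler_sum => i _.
  rewrite ger0_norm ?exprn_ge0 ?(ltW u0)//.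
  rewrite (@le_trans _ _ (U ^+ i))//.
    by rewrite lerXn2r// nnegrE ?(ltW u0)// (le_trans ler01).
  by rewrite ler_weXn2l// ltnW.
rewrite thE -{2}(mulr1 (theta k)) -mulrBr normrM gtr0_norm//.
have -> : CL * (r%:R * U ^+ r) = theta k * (CL / theta k * (r%:R * U ^+ r)).
  by field; rewrite gt_eqF.
rewrite ler_pM2l// (le_trans h1)// (le_trans h2)// ler_wpM2r//.
by rewrite mulr_ge0// exprn_ge0// (le_trans ler01).
Qed.

(** Over a distance [d], a [C]-Lipschitz function bounded below by
    [theta0 > 0] grows at most by the factor [1 + (C / theta0) d]. *)
Lemma theta_peetre : exists2 D : R, 0 < D &
  forall k q, theta (k + q) <= D * weight q * theta k.
Proof.
have [C C0 hC] := theta_step.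
exists (1 + C / theta0); first by rewrite ltr_wpDr// divr_ge0// ltW.
move=> k q.
have h : `|theta k - theta (k + q)| <= (l1norm q)%:R * C.
  apply: (path_bound (d := fun x y => `|theta x - theta y|)).
  - by move=> x; rewrite subrr normr0.
  - by move=> x y; rewrite distrC.
  - by move=> x y z; exact: ler_distD.
  - by move=> p j _; rewrite distrC; exact: hC.
have h1 : theta (k + q) <= theta k + (l1norm q)%:R * C.
  by rewrite -lerBlDl (le_trans (ler_norm _))// distrC.
rewrite (le_trans h1)//.
have h2 : C <= C / theta0 * theta k by rewrite mulrAC ler_pdivlMr// ler_wpM2l.
rewrite (@le_trans _ _ (theta k + (l1norm q)%:R * (C / theta0 * theta k)))//.
  by rewrite lerD2l ler_wpM2l.
have -> : theta k + (l1norm q)%:R * (C / theta0 * theta k) =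
  (1 + (l1norm q)%:R * (C / theta0)) * theta k by ring.
rewrite ler_wpM2r ?(ltW (theta_gt0 k))//.
have Ct : 0 <= C / theta0 by rewrite divr_ge0// ltW.
rewrite (@le_trans _ _ ((1 + C / theta0) * (1 + (l1norm q)%:R)))//.
  have l0 : 0 <= (l1norm q)%:R :> R by [].
  by move: (C / theta0) ((l1norm q)%:R : R) Ct l0 => x y x0 y0; nra.
by rewrite ler_wpM2l ?l1norm_weight// addr_ge0.
Qed.

(** For [t < 0] the roles of [k] and [k + q] are exchanged. *)
Lemma peetre (t : R) : exists C : R, exists M : nat, 0 < C /\
  forall k q, L (k + q) `^ t <= C * L k `^ t * weight q ^+ M.
Proof.
have [D D0 hD] := theta_peetre.
have LE k : L k = theta k `^ mu.
  by rewrite -powRrM mulVf ?gt_eqF// powRr1// ltW.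
have pos (s : R) : 0 <= s -> exists C : R, exists M : nat, 0 < C /\
    forall k q, L (k + q) `^ s <= C * L k `^ s * weight q ^+ M.
  move=> s0; exists (D `^ (mu * s)), (Num.truncn (mu * s)).+1.
  have ms0 : 0 <= mu * s by rewrite mulr_ge0// ltW.
  split=> [|k q]; first exact: powR_gt0.
  have LEs l : L l `^ s = theta l `^ (mu * s) by rewrite powRrM -LE.
  rewrite (LEs (k + q)) (LEs k).
  apply: (@le_trans _ _ ((D * weight q * theta k) `^ (mu * s))).
    apply: ge0_ler_powR => //; rewrite ?nnegrE ?(ltW (theta_gt0 _))//.
    by rewrite !mulr_ge0 ?(ltW D0) ?weight_ge0 ?(ltW (theta_gt0 _)).
  rewrite powRM ?mulr_ge0 ?(ltW D0) ?weight_ge0 ?(ltW (theta_gt0 _))//.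
  rewrite powRM ?(ltW D0) ?weight_ge0// mulrAC ler_wpM2l ?mulr_ge0 ?powR_ge0//.
  rewrite -powR_mulrn ?weight_ge0// ler_powR ?weight_ge1//.
  by rewrite ltW// truncnS_gt.
have [t0|t0] := leP 0 t; first exact: pos.
have [C [M [C0 hC]]] := pos (- t) (ltac:(rewrite oppr_ge0 ltW//)).
exists C, M; split=> // k q.
have := hC (k + q) (- q); rewrite addrK weightN !powRN => h.
have a0 : 0 < L k `^ t by exact: powR_gt0.
have b0 : 0 < L (k + q) `^ t by exact: powR_gt0.
move: h; rewrite mulrAC ler_pdivlMr// mulrC ler_pdivrMr//.
by rewrite mulrAC.
Qed.

End Weights.

(** * Fourier coefficients of the symbol *)

Section SymbolCoefficients.
Variables (R : realType) (n : nat).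
Local Notation Zn := 'rV[int]_n.
Implicit Types (L : Zn -> R) (sigma : Zn -> 'rV[R]_n -> R[i]%C).

Lemma weight_function_lower mu0 mu1 mu L : weight_function mu0 mu1 mu L ->
  exists2 c : R, 0 < c & forall k, c <= L k.
Proof.
move=> [[m0 _ _] _ [C0 [C1 [C00 _ hL]]] _]; exists C0 => // k.
have /andP[h _] := hL k; rewrite (le_trans _ h)// ler_peMr ?(ltW C00)//.
by rewrite -[leLHS](powRr0 (1 + znorm R k)) ler_powR ?(ltW m0)// lerDl sqrtr_ge0.
Qed.

Lemma weight_function_dif mu0 mu1 mu L : weight_function mu0 mu1 mu L ->
  exists2 C : R, 0 < C &
  forall k j, `|L (k + delta_mx 0 j) - L k| <= C * L k `^ (1 - mu^-1).
Proof.
move=> [_ Lp _ hL].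
have /choice[C hC] : forall j : 'I_n, exists C : R, forall k,
    `|L (k + delta_mx 0 j) - L k| <= C * L k `^ (1 - mu^-1).
  move=> j; have [C _ h] := hL (fun i => (i == j)%N) (fun _ => 0%N) (fun _ => leq0n 1).
  exists C => k; have := h k.
  rewrite zmonomial_zero mul1r mlen_single.
  have -> : (fun j0 : 'I_n => ((j0 == j) + 0)%N) = (fun i => (i == j)%N).
    by apply/funext => i; rewrite addn0.
  by rewrite difs_single mul1r.
exists (1 + \sum_j `|C j|); first by rewrite ltr_pwDl// sumr_ge0.
move=> k j; rewrite (le_trans (hC j k))// ler_wpM2r ?powR_ge0//.
by rewrite (le_trans (ler_norm _))// (bigD1 j)//= addrCA lerDl addr_ge0// sumr_ge0.
Qed.

Lemma weight_function_peetre mu0 mu1 mu L : weight_function mu0 mu1 mu L ->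
  forall t : R, exists C : R, exists M : nat, 0 < C /\
  forall k q, L (k + q) `^ t <= C * L k `^ t * weight q ^+ M.
Proof.
move=> wf; have [c c0 hc] := weight_function_lower wf.
have [C C0 hC] := weight_function_dif wf.
have [[m0 m01 m1] _ _ _] := wf.
by apply: (@peetre R n L mu c C) => //; rewrite (lt_le_trans m0)// (le_trans m01).
Qed.

(** A power is monotone, in one direction or the other according to the
    sign of its exponent. *)
Lemma powR_le_endpoints (c x u t : R) : 0 < c -> c <= x -> x <= u ->
  x `^ t <= c `^ t + u `^ t.
Proof.
move=> c0 cx xu; have x0 := lt_le_trans c0 cx; have u0 := lt_le_trans x0 xu.
have [t0|t0] := leP 0 t.
  by rewrite ler_wpDl ?powR_ge0//; apply: ge0_ler_powR; rewrite // nnegrE ltW.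
rewrite ler_wpDr ?powR_ge0// -(opprK t) !(powRN _ (- t)) lef_pV2 ?posrE ?powR_gt0//.
by apply: ge0_ler_powR; rewrite ?nnegrE ?oppr_ge0 ?(ltW t0) ?(ltW c0) ?(ltW x0).
Qed.

Lemma weight_function_bounded mu0 mu1 mu L : weight_function mu0 mu1 mu L ->
  forall (R1 t : R), exists B : R, forall k, znorm R k < R1 -> L k `^ t <= B.
Proof.
move=> wf R1 t; have [c c0 hc] := weight_function_lower wf.
have [[m0 m01 _] _ [C0 [C1 [_ C10 hL]]] _] := wf.
exists (c `^ t + (C1 * (1 + R1) `^ mu1) `^ t) => k kR.
apply: powR_le_endpoints => //; have /andP[_ h] := hL k.
have z0 : 0 <= znorm R k by exact: sqrtr_ge0.
rewrite (le_trans h)// ler_wpM2l ?(ltW C10)//; apply: ge0_ler_powR.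
- by rewrite (le_trans (ltW m0)).
- by rewrite nnegrE addr_ge0.
- by rewrite nnegrE addr_ge0// (le_trans z0)// ltW.
- by rewrite lerD2l ltW.
Qed.

(** The case [gamma = 0] of the definition. *)
Lemma symbol_M_S rho L m sigma : symbol_M rho L m sigma -> symbol_S rho L m sigma.
Proof.
move=> [_ /(_ (fun _ => 0%N) (fun _ => isT))].
congr symbol_S; apply/funext => k; apply/funext => x.
by rewrite zmonomial_zero difs_zero mul1r.
Qed.

Section Estimates.
Variables (mu0 mu1 mu rho m : R) (L : Zn -> R) (sigma : Zn -> 'rV[R]_n -> R[i]%C).
Hypotheses (wf : weight_function mu0 mu1 mu L) (sS : symbol_S rho L m sigma).

Let L_gt0 k : 0 < L k. Proof. by have [_ h _ _] := wf. Qed.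
Let Lp_gt0 k t : 0 < L k `^ t. Proof. exact: powR_gt0. Qed.

Lemma symbol_unif_smooth :
  unif_smooth (fun k x => ((L k `^ m)^-1)%:C%C * sigma k x).
Proof.
have [ss sD] := sS.
have gE k : (fun y => difs (fun _ => 0%N) (sigma^~ y) k) = sigma k.
  by apply/funext => y; rewrite difs_zero.
have bound j l : exists C : R, forall k x,
    `|(L k `^ m)^-1| * normc (Dx1 j l (sigma k) x) <= C.
  have [C C0 h] := sD (fun _ => 0%N) (fun i => if i == j then l else 0%N).
  exists C => k x; have := h k x.
  rewrite gE Dx_single mlen_zero mulr0 subr0 ger0_norm ?invr_ge0 ?(ltW (Lp_gt0 _ _))//.
  by move=> h'; rewrite mulrC ler_pdivrMr.
apply: unif_smooth_Dx1 => //.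
  by move=> k j N; apply: smooth_diff_along; have [] := ss k.
have [C C0 h] := sD (fun _ => 0%N) (fun _ => 0%N).
exists C => k x; have := h k x.
have -> : Dx (fun _ : 'I_n => 0%N) (fun y => difs (fun _ => 0%N) (sigma^~ y) k) = sigma k.
  by rewrite gE /Dx; elim: (enum _).
rewrite mlen_zero mulr0 subr0 ger0_norm ?invr_ge0 ?(ltW (Lp_gt0 _ _))//.
by move=> h'; rewrite mulrC ler_pdivrMr.
Qed.

Lemma symbol_dif_unif_smooth i :
  unif_smooth (fun k x => ((L k `^ (m - rho))^-1)%:C%C *
     (sigma (k + delta_mx 0 i) x - sigma k x)).
Proof.
have [ss sD] := sS.
pose g k x := sigma (k + delta_mx 0 i) x - sigma k x.
have gE k : (fun y => difs (fun l => (l == i)%N) (sigma^~ y) k) = g k.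
  by apply/funext => y; rewrite difs_single.
have bound j l : exists C : R, forall k x,
    `|(L k `^ (m - rho))^-1| * normc (Dx1 j l (g k) x) <= C.
  have [C C0 h] := sD (fun l => (l == i)%N) (fun i => if i == j then l else 0%N).
  exists C => k x; have := h k x.
  rewrite gE Dx_single mlen_single mulr1 ger0_norm ?invr_ge0 ?(ltW (Lp_gt0 _ _))//.
  by move=> h'; rewrite mulrC ler_pdivrMr.
apply: (@unif_smooth_Dx1 R n _ _ g) => //.
  move=> k j N.
  have -> : g k = (fun x => 1 * sigma (k + delta_mx 0 i) x + (-1) * sigma k x).
    by apply/funext => x; rewrite mul1r mulN1r.
  by apply: diff_along_lincomb; apply: smooth_diff_along; [have [] := ss (k + delta_mx 0 i)|have [] := ss k].
have [C C0 h] := sD (fun l => (l == i)%N) (fun _ => 0%N).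
exists C => k x; have := h k x.
have -> : Dx (fun _ : 'I_n => 0%N) (fun y => difs (fun l => (l == i)%N) (sigma^~ y) k) = g k.
  by rewrite gE /Dx; elim: (enum _).
rewrite mlen_single mulr1 ger0_norm ?invr_ge0 ?(ltW (Lp_gt0 _ _))//.
by move=> h'; rewrite mulrC ler_pdivrMr.
Qed.

Lemma fourier_coefZ B C (c : R[i]%C) (g : 'rV[R]_n -> R[i]%C) q : norm_bounded B g -> lip_coord C g ->
  fourier_coef (fun x => c * g x) q = c * fourier_coef g q.
Proof.
move=> gB gC; rewrite /fourier_coef -(torus_intZ _ (lip_coord_echarM (- q) gB gC)).
by congr torus_int; apply/funext => x; rewrite mulrCA.
Qed.

(** The scale [s i] is divided out, the decay of coefficients is
    applied uniformly, and the scale is multiplied back. *)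
Lemma unif_smooth_fourier_coef (I : Type) (s : I -> R) (g : I -> 'rV[R]_n -> R[i]%C) P :
  (forall i, 0 < s i) -> (forall i, torus_periodic (g i)) ->
  unif_smooth (fun i x => ((s i)^-1)%:C%C * g i x) ->
  exists2 C : R, 0 <= C & forall i q,
    normc (fourier_coef (g i) q) <= C * s i * weight q ^- P.
Proof.
move=> s0 gp /(unif_smooth_bounds P)[C hC].
exists (2 ^+ (n * P) * `|C|); first by rewrite mulr_ge0// exprn_ge0.
move=> i q; have [hB hc [_ hD]] := hC i.
set h := (fun x => _) in hB hc hD.
have gE : g i = (fun x => (s i)%:C%C * h x).
  apply/funext => x; rewrite /h mulrA -rmorphM divff ?mul1r//.
  by rewrite gt_eqF.
have hp : torus_periodic h by move=> l x; rewrite /h gp.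
rewrite gE (fourier_coefZ _ _ hB hc) normcM normcR gtr0_norm//.
have := fourier_coef_decay q hp hB hc (conj hB hD).
rewrite -ler_pdivlMr ?exprn_gt0 ?weight_gt0// => h1.
rewrite -mulrA mulrCA ler_pM2l//.
rewrite (le_trans h1)// ler_wpM2r ?invr_ge0 ?exprn_ge0 ?weight_ge0//.
by rewrite ler_wpM2l ?exprn_ge0// ler_norm.
Qed.

Lemma symbol_periodic k : torus_periodic (sigma k).
Proof. by have [ss _] := sS; have [] := ss k. Qed.

Lemma symbol_nice k : exists B C : R, norm_bounded B (sigma k) /\ lip_coord C (sigma k).
Proof.
have [C hC] := unif_smooth_bounds 0 symbol_unif_smooth.
have [hB hc _] := hC k; set h := (fun x => _) in hB hc.
have -> : sigma k = (fun x => (L k `^ m)%:C%C * h x).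
  apply/funext => x; rewrite /h mulrA -rmorphM divff ?mul1r//.
  by rewrite gt_eqF.
exists (normc (L k `^ m)%:C%C * C), (normc (L k `^ m)%:C%C * C); split; last exact: lip_coordZ.
by move=> x; rewrite normcM ler_wpM2l ?normc_ge0.
Qed.

Lemma symbol_fourier_coef P : exists2 C : R, 0 <= C & forall k q,
  normc (fourier_coef (sigma k) q) <= C * L k `^ m * weight q ^- P.
Proof.
apply: unif_smooth_fourier_coef => //; first exact: symbol_periodic.
exact: symbol_unif_smooth.
Qed.

Lemma fourier_coefB B1 B2 C1 C2 (f g : 'rV[R]_n -> R[i]%C) q :
  norm_bounded B1 f -> lip_coord C1 f -> norm_bounded B2 g -> lip_coord C2 g ->
  fourier_coef (fun x => f x - g x) q = fourier_coef f q - fourier_coef g q.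
Proof.
move=> fB fC gB gC; rewrite /fourier_coef.
rewrite -(torus_intB (lip_coord_echarM (- q) fB fC) (lip_coord_echarM (- q) gB gC)).
by congr torus_int; apply/funext => x; rewrite mulrBr.
Qed.

Lemma symbol_fourier_coef_dif P : exists2 C : R, 0 <= C & forall k i q,
  normc (fourier_coef (sigma (k + delta_mx 0 i)) q - fourier_coef (sigma k) q)
    <= C * L k `^ (m - rho) * weight q ^- P.
Proof.
have /choice[C hC] : forall i : 'I_n, exists C : R, 0 <= C /\ forall k q,
    normc (fourier_coef (sigma (k + delta_mx 0 i)) q - fourier_coef (sigma k) q)
    <= C * L k `^ (m - rho) * weight q ^- P.
  move=> i; have [||C C0 hC] := @unif_smooth_fourier_coef _ (fun k => L k `^ (m - rho))
    (fun k x => sigma (k + delta_mx 0 i) x - sigma k x) P _ _ (symbol_dif_unif_smooth i).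
  - by move=> k.
  - by move=> k l x; rewrite !symbol_periodic.
  exists C; split=> // k q; have := hC k q.
  have [B1 [C1 [b1 c1]]] := symbol_nice (k + delta_mx 0 i).
  have [B2 [C2 [b2 c2]]] := symbol_nice k.
  by rewrite (fourier_coefB q b1 c1 b2 c2).
exists (\sum_i C i); first by apply: sumr_ge0 => i _; have [] := hC i.
move=> k i q; have [_ h] := hC i; rewrite (le_trans (h k q))//.
rewrite ler_wpM2r ?invr_ge0 ?exprn_ge0 ?weight_ge0// ler_wpM2r ?powR_ge0//.
by rewrite (bigD1 i)//= lerDl sumr_ge0// => i' _; have [] := hC i'.
Qed.

(** The coefficient is linear in the symbol, so unit steps are
    controlled by first differences of the symbol; along a path from [k] to
    [k + q] Peetre's inequality keeps [L] comparable with [L k]. *)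
Lemma symbol_fourier_coef_shift P : exists C : R, exists M : nat, 0 <= C /\ forall k q l,
  normc (fourier_coef (sigma k) l - fourier_coef (sigma (k + q)) l)
    <= C * L k `^ (m - rho) * weight q ^+ M * weight l ^- P.
Proof.
have [C C0 hC] := symbol_fourier_coef_dif P.
have [D [M [D0 hD]]] := weight_function_peetre wf (m - rho).
exists (C * D), M.+1; split=> [|k q l]; first by rewrite mulr_ge0// ltW.
have w0 : 0 <= weight l ^- P :> R by rewrite invr_ge0 exprn_ge0 ?weight_ge0.
pose B := C * D * L k `^ (m - rho) * weight q ^+ M * weight l ^- P.
have B0 : 0 <= B.
  by rewrite !mulr_ge0 ?(ltW D0) ?powR_ge0 ?exprn_ge0 ?weight_ge0.
have h := @path_bound R n (fun x y => normc (fourier_coef (sigma x) l - fourier_coef (sigma y) l)) k q B.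
apply: (le_trans (h _ _ _ _)).
- by move=> x; rewrite subrr normc0.
- by move=> x y; rewrite normcBC.
- by move=> x y z; exact: ler_normc_dist.
- move=> p j pq; rewrite normcBC (le_trans (hC p j l))// ler_wpM2r// -!mulrA ler_wpM2l// !mulrA.
  have := hD k (p - k); rewrite addrC subrK => /le_trans; apply.
  rewrite ler_wpM2l ?mulr_ge0 ?(ltW D0) ?powR_ge0//.
  by rewrite lerXn2r// nnegrE weight_ge0.
have -> : C * D * L k `^ (m - rho) * weight q ^+ M.+1 * weight l ^- P = weight q * B.
  by rewrite /B exprS; ring.
rewrite ler_wpM2r//.
by rewrite (le_trans _ (l1norm_weight _ q))// lerDr.
Qed.

End Estimates.
End SymbolCoefficients.

(** * Boundedness of the operator *)

Section BoundedLipschitz.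
Variables (R : realType) (n : nat).
Local Notation Zn := 'rV[int]_n.
Implicit Types (f g : 'rV[R]_n -> R[i]%C) (phi : Zn -> R[i]%C) (k l q : Zn).

(** The class of integrands: bounded and Lipschitz in each coordinate,
    with unspecified constants. *)
Definition bounded_lip f : Prop := exists B C : R, norm_bounded B f /\ lip_coord C f.

Lemma bounded_lipM f g : bounded_lip f -> bounded_lip g -> bounded_lip (fun x => f x * g x).
Proof.
move=> [B1 [C1 [b1 c1]]] [B2 [C2 [b2 c2]]].
by exists (B1 * B2), (C1 * B2 + B1 * C2); split; [exact: norm_boundedM|exact: lip_coordM].
Qed.

Lemma bounded_lipB f g : bounded_lip f -> bounded_lip g -> bounded_lip (fun x => f x - g x).
Proof.
move=> [B1 [C1 [b1 c1]]] [B2 [C2 [b2 c2]]].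
exists (B1 + B2), (C1 + C2); split; last exact: lip_coordB.
by move=> x; rewrite (le_trans (ler_normcB _ _))// lerD.
Qed.

Lemma bounded_lip_cst (c : R[i]%C) : bounded_lip (fun _ => c).
Proof. by exists (normc c), 0; split; [move=> x|exact: lip_coord_cst]. Qed.

Lemma bounded_lip_echar k : bounded_lip (@echar R n k).
Proof. by exists 1, (4 * pi * (l1norm k)%:R); split; [exact: echar_bounded|exact: echar_lip]. Qed.

Lemma bounded_lip_fourier phi : summable_moment phi -> bounded_lip (@fourier R n phi).
Proof.
move=> ps; have [C hC] := fourier_lip_coord ps; have [B hB] := fourier_bounded ps.1.
by exists B, C.
Qed.

Lemma bounded_lip_torus_intB f g : bounded_lip f -> bounded_lip g ->
  torus_int (fun x => f x - g x) = torus_int f - torus_int g.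
Proof. by move=> [B1 [C1 [_ c1]]] [B2 [C2 [_ c2]]]; exact: torus_intB c1 c2. Qed.

Lemma bounded_lip_torus_intZ (c : R[i]%C) f : bounded_lip f ->
  torus_int (fun x => c * f x) = c * torus_int f.
Proof. by move=> [B [C [_ hC]]]; exact: torus_intZ hC. Qed.

Lemma fourier_coef_echarM f k l : fourier_coef (fun x => echar k x * f x) l = fourier_coef f (l - k).
Proof.
rewrite /fourier_coef; congr torus_int; apply/funext => x.
by rewrite mulrA -echarD opprB addrC.
Qed.

Lemma weight0 : weight (0 : Zn) = 1 :> R.
Proof. by rewrite /weight big1// => j _; rewrite mxE absz0 addr0. Qed.

Lemma lsum_weight_fin (u : Zn -> R) (C : R) : (forall q, 0 <= u q) ->
  (forall q, u q <= C * weight q ^- 2) -> (lsum u < +oo)%E.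
Proof.
move=> u0 uC.
have C0 : 0 <= C.
  by have := le_trans (u0 0) (uC 0); rewrite weight0 expr1n invr1 mulr1.
have w0 q : 0 <= weight q ^- 2 :> R by rewrite invr_ge0 exprn_ge0 ?weight_ge0.
rewrite (le_lt_trans (le_lsum uC))// lsumZ//.
rewrite (le_lt_trans (lee_wpmul2l _ (lsum_weightV2 R n)))//.
by rewrite -EFinM ltry.
Qed.

Lemma weight_znorm q : weight q <= (1 + znorm R q) ^+ n.
Proof.
rewrite -[X in _ ^+ X]card_ord -prodr_const; apply: ler_prod => j _.
rewrite addr_ge0//= lerD2l -[leLHS]ger0_norm// -sqrtr_sqr /znorm ler_wsqrtr//.
rewrite (bigD1 j)//= -[leLHS]addr0 lerD ?sumr_ge0// => [|i _]; last exact: sqr_ge0.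
rewrite -[(absz _)%:R]/(((absz (q 0 j))%:Z)%:~R) abszE intr_norm real_normK ?lexx ?num_real//.
Qed.

(** The weight is at most the [n]-th power of [1 + |k|]. *)
Lemma schwartz_weight phi (P : nat) : schwartz phi ->
  exists C : R, 0 <= C /\ forall k, normc (phi k) <= C * weight k ^- P.
Proof.
move=> /(_ (n * P)%N)[C hC]; exists C.
have h k : normc (phi k) * weight k ^+ P <= C.
  rewrite (le_trans _ (hC k))// mulrC ler_wpM2r ?normc_ge0// exprM.
  by rewrite lerXn2r ?nnegrE ?weight_ge0 ?exprn_ge0 ?addr_ge0 ?sqrtr_ge0 ?weight_znorm.
split=> [|k]; last by rewrite ler_pdivlMr ?exprn_gt0 ?weight_gt0.
by rewrite (le_trans _ (h 0))// mulr_ge0 ?normc_ge0 ?exprn_ge0 ?weight_ge0.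
Qed.

Lemma schwartz_summable_moment phi : schwartz phi -> summable_moment phi.
Proof.
move=> ps; have [C [C0 hC]] := schwartz_weight 3 ps.
have wE (q : Zn) : weight q ^- 2 = weight q * weight q ^- 3 :> R.
  by field; rewrite gt_eqF ?weight_gt0.
have w3 (q : Zn) : 0 <= weight q ^- 3 :> R by rewrite invr_ge0 exprn_ge0 ?weight_ge0.
split; apply: (@lsum_weight_fin _ C) => q; rewrite ?mulr_ge0 ?normc_ge0//.
  by rewrite (le_trans (hC q))// ler_wpM2l// wE ler_peMl ?weight_ge1.
rewrite wE mulrCA ler_pM ?normc_ge0//.
by rewrite (le_trans _ (l1norm_weight R q))// lerDr.
Qed.

Lemma lsum_single (u : Zn -> R) k : (forall q, 0 <= u q) -> ((u k)%:E <= lsum u)%E.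
Proof. by move=> u0; have := @seq_sum_le_lsum _ _ u [:: k] u0 isT; rewrite big_seq1. Qed.

End BoundedLipschitz.

Section OperatorBounds.
Variables (R : realType) (n : nat).
Local Notation Zn := 'rV[int]_n.
Variables (mu0 mu1 mu rho m : R) (L : Zn -> R) (sigma : Zn -> 'rV[R]_n -> R[i]%C).
Hypotheses (wf : weight_function mu0 mu1 mu L) (rho_gt0 : 0 < rho)
  (sS : symbol_S rho L m sigma).
Implicit Types (phi g : Zn -> R[i]%C).

Let L_gt0 k : 0 < L k. Proof. by have [_ h _ _] := wf. Qed.
Let Lp_gt0 k t : 0 < L k `^ t. Proof. exact: powR_gt0. Qed.
Let Lp_ge0 k t : 0 <= L k `^ t. Proof. exact: powR_ge0. Qed.
Let w2_ge0 (q : Zn) P : 0 <= weight q ^- P :> R.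
Proof. by rewrite invr_ge0 exprn_ge0 ?weight_ge0. Qed.

Lemma powR_double x (s : R) : 0 <= x -> x `^ (2 * s) = (x `^ s) ^+ 2.
Proof. by move=> x0; rewrite mulrC powRrM -powR_mulrn ?powR_ge0. Qed.

(** The matrix of the operator. *)
Definition kernel k l : R[i]%C := fourier_coef (sigma k) (l - k).

Lemma weightVD P M (q : Zn) : weight q ^- (P + M) * weight q ^+ M = weight q ^- P :> R.
Proof.
have w0 : weight q ^+ M != 0 :> R by rewrite expf_neq0// gt_eqF ?weight_gt0.
by rewrite exprD invfM -mulrA mulVf ?mulr1.
Qed.

Lemma weight_opp_sub (k l : Zn) : weight (l - k) = weight (k - l) :> R.
Proof. by rewrite -opprB weightN. Qed.

(** Peetre's inequality moves the factor [L^m] from the row index to the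
    column index at the cost of a power of the weight, which the rapid decay of
    the coefficients pays for. *)
Lemma kernel_bound : exists2 C : R, 0 <= C & forall k l,
  normc (kernel k l) <= C * L l `^ m * weight (k - l) ^- 2.
Proof.
have [D [M [D0 hD]]] := weight_function_peetre wf m.
have [C C0 hC] := symbol_fourier_coef wf sS (2 + M).
exists (C * D); first by rewrite mulr_ge0// ltW.
move=> k l; rewrite (le_trans (hC k (l - k)))// (weight_opp_sub k l).
have := hD l (k - l); rewrite addrC subrK => h.
have -> : C * D * L l `^ m * weight (k - l) ^- 2 =
    C * (D * L l `^ m * weight (k - l) ^+ M) * weight (k - l) ^- (2 + M).
  by rewrite -(weightVD 2 M); ring.
by rewrite ler_wpM2r// ler_wpM2l.
Qed.

Let bounded_lip_sigma k : bounded_lip (sigma k).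
Proof. by have [B [C [hB hC]]] := symbol_nice wf sS k; exists B, C. Qed.

Lemma pseudo_opE phi k : pseudo_op sigma phi k =
  torus_int (fun x => (echar k x * sigma k x) * fourier phi x).
Proof. by []. Qed.

Lemma pseudo_op_le phi k : summable_moment phi ->
  ((normc (pseudo_op sigma phi k))%:E <=
   lsum (fun l => normc (phi l) * normc (kernel k l))%R)%E.
Proof.
move=> ps; have [B [C [hB hC]]] := bounded_lipM (bounded_lip_echar R k) (bounded_lip_sigma k).
rewrite pseudo_opE (le_trans (torus_int_fourier_le ps hB hC))//.
by apply: le_lsum => l; rewrite fourier_coef_echarM.
Qed.

(** Stated for any function dominated by the matrix, so that it applies
    both to the image of a function and to the error of a truncation. *)
Lemma kernel_l2 : exists2 C : R, 0 <= C & forall (c v : Zn -> R),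
  (forall l, 0 <= c l) -> (forall k, 0 <= v k) ->
  (forall k, (v k)%:E <= lsum (fun l => c l * normc (kernel k l))%R)%E ->
  (lsum (fun k => v k ^+ 2)%R <=
     C%:E * lsum (fun l => L l `^ (2 * m) * c l ^+ 2)%R)%E.
Proof.
have [C C0 hC] := kernel_bound.
exists ((3 ^+ n) ^+ 2 * C ^+ 2); first by rewrite mulr_ge0 ?sqr_ge0.
move=> c v c0 v0 hv.
pose u l := C * (L l `^ m * c l).
have u0 l : 0 <= u l by rewrite !mulr_ge0.
have := @young R n (fun q => weight q ^- 2) u v (3 ^+ n).
move=> /(_ (exprn_gt0 n (ltr0n R 3)) (fun q => w2_ge0 q 2) u0 v0 (lsum_weightV2 R n)).
have h k : ((v k)%:E <= lsum (fun l => weight (k - l) ^- 2 * u l)%R)%E.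
  rewrite (le_trans (hv k))//; apply: le_lsum => l.
  rewrite /u mulrC (le_trans (ler_wpM2r (c0 l) (hC k l)))//.
  by rewrite le_eqVlt; apply/orP; left; apply/eqP; ring.
move=> /(_ h) /le_trans; apply.
have -> : lsum (fun k => u k ^+ 2) =
    ((C ^+ 2)%:E * lsum (fun l => L l `^ (2 * m) * c l ^+ 2)%R)%E.
  rewrite -lsumZ ?sqr_ge0//; last by move=> l; rewrite mulr_ge0 ?sqr_ge0.
  by apply: eq_lsum => l; rewrite /u powR_double ?(ltW (L_gt0 _))// !exprMn.
by rewrite muleA -EFinM.
Qed.

Lemma pseudo_op_l2 : exists2 C : R, 0 <= C & forall phi, summable_moment phi ->
  (lsum (fun k => normc (pseudo_op sigma phi k) ^+ 2)%R <=
     C%:E * lsum (fun l => L l `^ (2 * m) * normc (phi l) ^+ 2)%R)%E.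
Proof.
have [C C0 hC] := kernel_l2; exists C => // phi ps; apply: hC => [l|k|k].
- exact: normc_ge0.
- exact: normc_ge0.
- exact: pseudo_op_le.
Qed.

Lemma schwartz_sobolev phi (t : R) : schwartz phi ->
  (lsum (fun k => L k `^ t * normc (phi k) ^+ 2)%R < +oo)%E.
Proof.
move=> ps; have [D [M [D0 hD]]] := weight_function_peetre wf t.
have [C1 [C10 hC1]] := schwartz_weight 0 ps.
have [C [C0 hC]] := schwartz_weight (2 + M) ps.
apply: (@lsum_weight_fin _ _ _ (D * L 0 `^ t * (C1 * C))) => k.
  by rewrite mulr_ge0 ?sqr_ge0.
have := hD 0 k; rewrite add0r => h.
apply: (le_trans (ler_wpM2r (sqr_ge0 _) h)).
have -> : D * L 0 `^ t * (C1 * C) * weight k ^- 2 =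
    D * L 0 `^ t * weight k ^+ M * (C1 * (C * weight k ^- (2 + M))).
  by rewrite -(weightVD 2 M); ring.
rewrite ler_wpM2l ?mulr_ge0 ?(ltW D0) ?exprn_ge0 ?weight_ge0// expr2.
rewrite ler_pM ?normc_ge0//.
by have := hC1 k; rewrite expr0 invr1 mulr1.
Qed.

(** Where [L] exceeds a threshold, [L^{-2 rho} <= e]; where it does not, [L]
    ranges over a compact subset of the positive half-line, on which every
    power is bounded. *)
Lemma absorb (e : R) : 0 < e -> exists C : R, forall k,
  L k `^ (2 * (m - rho)) <= e * L k `^ (2 * m) + C.
Proof.
move=> e0; have [c c0 hc] := weight_function_lower wf.
pose u := e `^ (- (2 * rho)^-1).
exists (c `^ (2 * (m - rho)) + u `^ (2 * (m - rho))) => k.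
have r2 : 0 < 2 * rho by rewrite mulr_gt0.
have [Lu|uL] := leP (L k) u.
  rewrite (le_trans (powR_le_endpoints _ c0 (hc k) Lu))// lerDr mulr_ge0// ltW//.
rewrite ler_wpDr ?addr_ge0 ?powR_ge0//.
have -> : 2 * (m - rho) = - (2 * rho) + 2 * m by ring.
rewrite powRD; last by rewrite (gt_eqF (L_gt0 k)) implybT.
rewrite ler_wpM2r// powRN.
have ue : u `^ (2 * rho) = e^-1.
  by rewrite /u -powRrM mulNr mulVf ?gt_eqF// powR_inv1 ?(ltW e0).
rewrite -[leRHS]invrK lef_pV2 ?posrE ?invr_gt0//.
rewrite -ue; apply: ge0_ler_powR; rewrite ?nnegrE ?powR_ge0 ?(ltW r2) ?(ltW (L_gt0 k))//.
exact: ltW.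
Qed.

End OperatorBounds.

(** * The elliptic estimate *)

Lemma bounded_derivs_comp (R : realType) (I J : Type) (p : J -> I) N (F : I -> R -> R) :
  bounded_derivs N F -> bounded_derivs N (fun j => F (p j)).
Proof.
elim: N F => [|N IH] F [[C FC] hF]; first by split=> //; exists C.
split; first by exists C.
by have [F' dF bF'] := hF; exists (fun j => F' (p j)) => //; exact: IH.
Qed.

Lemma unif_smooth_comp (R : realType) n (I J : Type) (p : J -> I)
    (g : I -> 'rV[R]_n -> R[i]%C) :
  unif_smooth g -> unif_smooth (fun j => g (p j)).
Proof.
move=> [[C hC] hg]; split; first by exists C.
move=> N; have [h1 h2] := hg N.
pose pp (t : J * 'rV[R]_n * 'I_n) := (p t.1.1, t.1.2, t.2).
by split; [exact: (bounded_derivs_comp pp h1)|exact: (bounded_derivs_comp pp h2)].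
Qed.

Section EllipticEstimate.
Variables (R : realType) (n : nat).
Local Notation Zn := 'rV[int]_n.
Variables (mu0 mu1 mu rho m : R) (L : Zn -> R) (sigma : Zn -> 'rV[R]_n -> R[i]%C).
Hypotheses (wf : weight_function mu0 mu1 mu L) (rho_gt0 : 0 < rho)
  (sS : symbol_S rho L m sigma).
Implicit Types (phi g : Zn -> R[i]%C).

Let L_gt0 k : 0 < L k. Proof. by have [_ h _ _] := wf. Qed.
Let Lp_gt0 k t : 0 < L k `^ t. Proof. exact: powR_gt0. Qed.
Let Lp_ge0 k t : 0 <= L k `^ t. Proof. exact: powR_ge0. Qed.
Let w_ge0 (q : Zn) P : 0 <= weight q ^- P :> R.
Proof. by rewrite invr_ge0 exprn_ge0 ?weight_ge0. Qed.
Let bounded_lip_sigma k : bounded_lip (sigma k).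
Proof. by have [B [C [hB hC]]] := symbol_nice wf sS k; exists B, C. Qed.

(** The cost of freezing the symbol at [k] where the operator would
    use its value at [k + q]: the coefficients of the difference have order
    [m - rho] by [symbol_fourier_coef_shift].  Submultiplicativity of the
    weight recentres the decay at [k], for a further power of [weight q]. *)
Lemma frozen_symbol_error P2 : exists C : R, exists M : nat, 0 <= C /\
  forall phi k q, summable_moment phi ->
  ((normc (torus_int (fun x => echar (k + q) x * sigma k x * fourier phi x)
           - pseudo_op sigma phi (k + q)))%:E <=
   (C * L k `^ (m - rho) * weight q ^+ M)%:E *
   lsum (fun l => weight (k - l)%R ^- P2 * normc (phi l))%R)%E.
Proof.
have [C [M [C0 hC]]] := symbol_fourier_coef_shift wf sS P2.
exists C, (M + P2)%N; split=> // phi k q ps.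
have bf := bounded_lip_fourier ps.
have bk l : bounded_lip (fun x => echar (k + q) x * sigma l x * fourier phi x).
  exact: bounded_lipM (bounded_lipM (bounded_lip_echar R _) (bounded_lip_sigma l)) bf.
have hbd : bounded_lip (fun x => echar (k + q) x * (sigma k x - sigma (k + q) x)).
  exact: bounded_lipM (bounded_lip_echar R _) (bounded_lipB (bounded_lip_sigma k) (bounded_lip_sigma (k + q))).
rewrite pseudo_opE -(bounded_lip_torus_intB (bk k) (bk (k + q))).
have -> : (fun x => echar (k + q) x * sigma k x * fourier phi x -
    echar (k + q) x * sigma (k + q) x * fourier phi x) =
  (fun x => echar (k + q) x * (sigma k x - sigma (k + q) x) * fourier phi x).
  by apply/funext => x; ring.
have [B [C' [hB hC']]] := hbd.
apply: (le_trans (torus_int_fourier_le ps hB hC')).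
have n0 l : 0 <= normc (phi l) by exact: normc_ge0.
rewrite -lsumZ; last 2 first.
- by rewrite !mulr_ge0 ?exprn_ge0 ?weight_ge0.
- by move=> l; rewrite mulr_ge0.
apply: le_lsum => l; rewrite fourier_coef_echarM.
have [B1 [C1 [b1 c1]]] := bounded_lip_sigma k; have [B2 [C2 [b2 c2]]] := bounded_lip_sigma (k + q).
rewrite (fourier_coefB _ b1 c1 b2 c2).
have := hC k q (l - (k + q)).
have wl : weight (l - (k + q)) ^- P2 <= weight q ^+ P2 * weight (k - l) ^- P2 :> R.
  rewrite ler_pdivlMr ?exprn_gt0 ?weight_gt0// mulrC.
  rewrite ler_pdivrMr ?exprn_gt0 ?weight_gt0// -exprMn.
  rewrite lerXn2r ?nnegrE ?weight_ge0 ?mulr_ge0 ?weight_ge0//.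
  rewrite (le_trans _ (weightD R q (l - (k + q))))// -(weight_opp_sub R k l).
  have -> : l - k = q + (l - (k + q)) by apply/rowP => j; rewrite !mxE; ring.
  exact: lexx.
move=> h; rewrite mulrC.
rewrite (le_trans (ler_wpM2r (n0 l) h))//.
rewrite (le_trans (ler_wpM2r (n0 l) (ler_wpM2l _ wl)))//.
  by rewrite !mulr_ge0 ?exprn_ge0 ?weight_ge0.
by rewrite le_eqVlt; apply/orP; left; apply/eqP; rewrite exprD; ring.
Qed.

Hypothesis ell : M_elliptic L m sigma.

(** The inverse of the normalized symbol, with constants uniform in [k]:
    ellipticity bounds the normalized symbols below, so that [unif_smoothV]
    applies to the family indexed by the large [k]. *)
Lemma elliptic_inverse P : exists R1 C : R, 0 <= C /\ forall k, R1 <= znorm R k ->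
  exists b : 'rV[R]_n -> R[i]%C,
    [/\ forall x, b x * ((L k `^ m)^-1%:C%C * sigma k x) = 1,
        torus_periodic b, norm_bounded C b, lip_coord C b & diff_decay 2 C b /\
        forall q, normc (fourier_coef b q) <= C * weight q ^- P].
Proof.
have [c [R1 [c0 R10 hc]]] := ell.
pose I := {k : Zn | R1 <= znorm R k}.
pose h (i : I) (x : 'rV[R]_n) := ((L (sval i) `^ m)^-1)%:C%C * sigma (sval i) x.
have hs : unif_smooth h := unif_smooth_comp sval (symbol_unif_smooth wf sS).
have hlow i x : c <= normc (h i x).
  rewrite /h normcM normcR ger0_norm ?invr_ge0// mulrC ler_pdivlMr//.
  exact: hc (svalP i).
have bs := unif_smoothV c0 hlow hs.
have [C2 hC2] := unif_smooth_bounds 2 bs.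
have [CP hCP] := unif_smooth_bounds P bs.
exists R1, (`|C2| + 2 ^+ (n * P) * `|CP|); split.
  by rewrite addr_ge0// mulr_ge0// exprn_ge0.
move=> k kR; pose i : I := exist _ k kR.
exists (fun x => (h i x)^-1).
have C2C : C2 <= `|C2| + 2 ^+ (n * P) * `|CP|.
  by rewrite (le_trans (ler_norm _))// lerDl mulr_ge0// exprn_ge0.
have [b2 c2 [_ d2]] := hC2 i; have [bP cP dP] := hCP i.
have bper : torus_periodic (fun x => (h i x)^-1).
  by move=> l x; rewrite /h (symbol_periodic sS).
have bC : norm_bounded (`|C2| + 2 ^+ (n * P) * `|CP|) (fun x => (h i x)^-1).
  by move=> x; rewrite (le_trans (b2 x)).
split=> //.
- move=> x; rewrite mulVf//; apply/eqP => h0.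
  by have := hlow i x; rewrite h0 normc0 leNgt c0.
- exact: lip_coordW C2C c2.
split; first by split=> // j t x; rewrite (le_trans (d2 j t x))// ler_wpM2r ?exprn_ge0.
move=> q; have := fourier_coef_decay q bper bP cP dP.
rewrite -ler_pdivlMr ?exprn_gt0 ?weight_gt0// => /le_trans; apply.
rewrite ler_wpM2r// ler_wpDl// ler_wpM2l ?exprn_ge0//.
exact: ler_norm.
Qed.

Let u phi l : R := normc (pseudo_op sigma phi l) + L l `^ (m - rho) * normc (phi l)
  + normc (phi l).

Let u_ge0 phi l : 0 <= u phi l.
Proof. by rewrite /u !addr_ge0 ?mulr_ge0 ?normc_ge0. Qed.

(** For large [k], Fourier inversion of the inverse symbol [b] under the
    integral [phi k] produces the coefficients of [b], which decay faster than
    any power, against integrals that equal [T phi (k + q)] up to the error of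
    [frozen_symbol_error].  For small [k], [L k] is bounded and the last term of
    [u] suffices. *)
Lemma elliptic_pointwise : exists2 C : R, 0 <= C & forall phi, summable_moment phi ->
  forall k, ((L k `^ m * normc (phi k))%:E <=
    lsum (fun l => weight (k - l)%R ^- 2 * (C * u phi l))%R)%E.
Proof.
have [C3 [M3 [C30 hC3]]] := weight_function_peetre wf (m - rho).
(* [M3] powers of the weight will pay for Peetre's inequality, and two remain
   for Young's *)
pose P2 := (2 + M3)%N.
have [C2 [M [C20 hC2]]] := frozen_symbol_error P2.
(* the decay of [b] must outweigh the powers [M + P2] of [weight q] lost by
   freezing the symbol *)
have [R1 [Cb [Cb0 hCb]]] := elliptic_inverse (2 + (M + P2)).
have [B hB] := weight_function_bounded wf R1 m.
pose C := `|B| + (Cb + Cb * C2 * 3 ^+ n * C3).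
have A0 : 0 <= Cb * C2 * 3 ^+ n * C3 by rewrite !mulr_ge0 ?exprn_ge0 ?(ltW C30).
have C0 : 0 <= C by rewrite !addr_ge0.
exists C => // phi ps k.
have wu0 l : 0 <= weight (k - l) ^- 2 * (C * u phi l) by rewrite !mulr_ge0.
have n0 l : 0 <= normc (phi l) by exact: normc_ge0.
have t0 l : 0 <= normc (pseudo_op sigma phi l) by exact: normc_ge0.
have [kR|kR] := ltP (znorm R k) R1.
  apply: le_trans (lsum_single k wu0).
  rewrite subrr weight0 expr1n invr1 mul1r lee_fin.
  rewrite (le_trans (ler_wpM2r (n0 k) (hB k kR)))//.
  rewrite (le_trans (ler_wpM2r (n0 k) (ler_norm B)))//.
  apply: ler_pM => //; first by rewrite lerDl !addr_ge0.
  by rewrite /u lerDr addr_ge0 ?mulr_ge0.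
have [b [bE bper bC bc [hbd bq]]] := hCb k kR.
pose G x := (L k `^ m)^-1%:C%C * (echar k x * sigma k x * fourier phi x).
have bkf q : bounded_lip (fun x => echar q x * sigma k x * fourier phi x).
  exact: bounded_lipM (bounded_lipM (bounded_lip_echar R _) (bounded_lip_sigma k)) (bounded_lip_fourier ps).
have [BG [CG [GB GC]]] : bounded_lip G by exact: bounded_lipM (bounded_lip_cst _ _) (bkf k).
have := torus_int_mul_le bper bC bc hbd GB GC.
have -> : (fun x => b x * G x) = (fun x => echar k x * fourier phi x).
  by apply/funext => x; rewrite /G -[RHS]mul1r -(bE x); ring.
rewrite fourier_inversion// => h1.
pose X := lsum (fun l => weight (k - l) ^- P2 * normc (phi l)).
have X0 l : 0 <= weight (k - l) ^- P2 * normc (phi l) by rewrite mulr_ge0.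
have [x x0 XE] : exists2 x : R, 0 <= x & X = x%:E.
  apply: lsum_fin => //; apply: le_lt_trans ps.1; apply: le_lsum => l.
  by rewrite ler_piMl// invf_le1 ?exprn_gt0 ?weight_gt0// exprn_ege1// weight_ge1.
have GE q : normc (torus_int (fun x => echar q x * G x)) <= (L k `^ m)^-1 *
    (normc (pseudo_op sigma phi (k + q)) + C2 * L k `^ (m - rho) * weight q ^+ (M) * x).
  have -> : (fun x => echar q x * G x) = (fun x => (L k `^ m)^-1%:C%C *
      (echar (k + q) x * sigma k x * fourier phi x)).
    by apply/funext => y; rewrite /G echarD; ring.
  rewrite (bounded_lip_torus_intZ _ (bkf (k + q))) normcM normcR ger0_norm ?invr_ge0//.
  rewrite ler_wpM2l ?invr_ge0//.
  rewrite (le_trans (ler_normcD_sub _ (pseudo_op sigma phi (k + q))))// lerD2l.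
  have := hC2 phi k q ps; rewrite -/X XE -EFinM lee_fin; exact.
pose V q : R := (L k `^ m)^-1 * (Cb * (weight q ^- 2 * normc (pseudo_op sigma phi (k + q)))
   + Cb * C2 * L k `^ (m - rho) * x * weight q ^- 2).
have wM (q : Zn) : weight q ^- (2 + (M + P2)) * weight q ^+ M <= weight q ^- 2 :> R.
  rewrite -[leRHS](weightVD R 2 (M + P2) q) ler_wpM2l ?w_ge0//.
  by rewrite ler_weXn2l ?weight_ge1 ?leq_addr.
have wP (q : Zn) : weight q ^- (2 + (M + P2)) <= weight q ^- 2 :> R.
  rewrite lef_pV2 ?posrE ?exprn_gt0 ?weight_gt0//.
  by rewrite ler_weXn2l ?weight_ge1.
have hV q : normc (fourier_coef b q) * normc (torus_int (fun x => echar q x * G x)) <= V q.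
  apply: (le_trans (ler_wpM2r (normc_ge0 _) (bq q))).
  apply: (le_trans (ler_wpM2l _ (GE q))); first by rewrite mulr_ge0.
  rewrite mulrCA /V ler_wpM2l ?invr_ge0// mulrDr -!mulrA; apply: lerD.
    by rewrite ler_wpM2l// ler_wpM2r.
  rewrite ler_wpM2l//.
  have -> : weight q ^- (2 + (M + P2)) * (C2 * (L k `^ (m - rho) * (weight q ^+ M * x)))
     = C2 * (L k `^ (m - rho) * (x * (weight q ^- (2 + (M + P2)) * weight q ^+ M))) by ring.
  by rewrite !ler_wpM2l.
have {h1} h2 : ((L k `^ m * normc (phi k))%:E <= (L k `^ m)%:E * lsum V)%E.
  rewrite EFinM lee_wpmul2l ?lee_fin// (le_trans h1)//.
  exact: le_lsum.
apply: (le_trans h2).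
rewrite -lsumZ//; last first.
  move=> q; apply: mulr_ge0; first by rewrite invr_ge0.
  by apply: addr_ge0; rewrite !mulr_ge0.
have -> : lsum (fun q => L k `^ m * V q) =
  lsum (fun q => Cb * (weight q ^- 2 * normc (pseudo_op sigma phi (k + q)))
   + Cb * C2 * L k `^ (m - rho) * x * weight q ^- 2).
  by apply: eq_lsum => q; rewrite /V mulrA divff ?mul1r// gt_eqF.
rewrite lsumD; last 2 first.
- by move=> q; rewrite !mulr_ge0.
- by move=> q; rewrite !mulr_ge0.
rewrite lsumZ//; last by move=> q; rewrite mulr_ge0.
rewrite lsumZ//; last by rewrite !mulr_ge0.
have -> : lsum (fun q => weight q ^- 2 * normc (pseudo_op sigma phi (k + q))) =
    lsum (fun l => weight (k - l) ^- 2 * normc (pseudo_op sigma phi l)).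
  rewrite -[RHS](lsum_shift _ k); apply: eq_lsum => q.
  by rewrite opprD addrCA subrr addr0 weightN (addrC q k).
have h3 : ((L k `^ (m - rho) * x)%:E <=
   lsum (fun l => C3 * (weight (k - l) ^- 2 * (L l `^ (m - rho) * normc (phi l)))%R)%R)%E.
  rewrite EFinM -XE -lsumZ//; apply: le_lsum => l.
  have := hC3 l (k - l); rewrite addrC subrK => h.
  apply: (le_trans (ler_wpM2r (X0 l) h)).
  have -> : C3 * L l `^ (m - rho) * weight (k - l) ^+ M3 *
      (weight (k - l) ^- P2 * normc (phi l)) =
      C3 * (weight (k - l) ^- P2 * weight (k - l) ^+ M3 * (L l `^ (m - rho) * normc (phi l))).
    by ring.
  by rewrite weightVD.
have h4 : ((Cb * C2 * L k `^ (m - rho) * x)%:E * lsum (fun q : Zn => weight q ^- 2)%R <=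
   (Cb * C2 * 3 ^+ n)%:E *
    lsum (fun l => C3 * (weight (k - l) ^- 2 * (L l `^ (m - rho) * normc (phi l)))%R)%R)%E.
  apply: (le_trans (lee_wpmul2l _ (lsum_weightV2 R n))); first by rewrite lee_fin !mulr_ge0.
  rewrite -EFinM.
  have -> : Cb * C2 * L k `^ (m - rho) * x * 3 ^+ n =
     Cb * C2 * 3 ^+ n * (L k `^ (m - rho) * x) by ring.
  by rewrite EFinM lee_wpmul2l// lee_fin !mulr_ge0 ?exprn_ge0.
apply: (le_trans (leeD2l _ h4)).
rewrite -lsumZ//; last by move=> l; rewrite mulr_ge0.
rewrite -lsumZ; last 2 first.
- by rewrite !mulr_ge0 ?exprn_ge0.
- by move=> l; rewrite !mulr_ge0 ?(ltW C30).
rewrite -lsumD; last 2 first.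
- by move=> l; rewrite !mulr_ge0.
- by move=> l; rewrite !mulr_ge0 ?exprn_ge0 ?(ltW C30).
apply: le_lsum => l.
rewrite /u; set w := weight (k - l) ^- 2; set T := normc (pseudo_op _ _ _).
set S := L l `^ _ * _; set N := normc (phi l).
have -> : Cb * (w * T) + Cb * C2 * 3 ^+ n * (C3 * (w * S)) =
  w * (Cb * T + Cb * C2 * 3 ^+ n * C3 * S) by ring.
have w0 : 0 <= w by exact: w_ge0.
have T0 : 0 <= T by exact: normc_ge0.
have N0 : 0 <= N by exact: normc_ge0.
have S0 : 0 <= S by exact: mulr_ge0.
rewrite ler_wpM2l// !mulrDr -[leLHS]addr0; apply: lerD; last exact: mulr_ge0.
have b0 : 0 <= `|B| by [].
by apply: lerD; apply: ler_wpM2r => //; rewrite /C; lra.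
Qed.

Lemma lsum3 (a b c : Zn -> R) : (forall k, 0 <= a k) -> (forall k, 0 <= b k) ->
  (forall k, 0 <= c k) ->
  lsum (fun k => a k + b k + c k) = (lsum a + lsum b + lsum c)%E.
Proof. by move=> a0 b0 c0; rewrite !lsumD// => k; rewrite addr_ge0. Qed.

(** Young's inequality turns the pointwise bound into one on square
    sums; the term of order [m - rho] is absorbed with a constant small enough
    to be subtracted, which is legitimate since the left-hand side is finite for
    rapidly decreasing [phi]. *)
Lemma elliptic_estimate : exists2 C : R, 0 <= C & forall phi, schwartz phi ->
  (lsum (fun k => L k `^ (2 * m) * normc (phi k) ^+ 2)%R <=
   C%:E * (lsum (fun k => normc (pseudo_op sigma phi k) ^+ 2)%R +
           lsum (fun k => normc (phi k) ^+ 2)%R))%E.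
Proof.
have [C C0 hC] := elliptic_pointwise.
have [C' C'0 hC'] := pseudo_op_l2 wf sS.
pose K := (3 ^+ n) ^+ 2 * (3 * C ^+ 2).
have K0 : 0 <= K by rewrite !mulr_ge0 ?sqr_ge0.
have K1 : 0 < K + 1 by rewrite ltr_wpDl.
have [B hB] := absorb m wf rho_gt0 (divr_gt0 (ltr01 : 0 < (1 : R)) (mulr_gt0 (ltr0n R 2) K1)).
exists (2 * K + 2 * K * (`|B| + 1)); first by rewrite addr_ge0 ?mulr_ge0 ?addr_ge0.
move=> phi pS; have ps := schwartz_summable_moment pS.
pose T k := normc (pseudo_op sigma phi k); pose N k := normc (phi k).
have T0 k : 0 <= T k by exact: normc_ge0.
have N0 k : 0 <= N k by exact: normc_ge0.
have [V V0 VE] : exists2 V : R, 0 <= V & lsum (fun k => L k `^ (2 * m) * N k ^+ 2) = V%:E.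
  by apply: lsum_fin => [k|]; [rewrite mulr_ge0 ?sqr_ge0|exact: (schwartz_sobolev wf (2 * m) pS)].
have [Q Q0 QE] : exists2 Q : R, 0 <= Q & lsum (fun k => N k ^+ 2) = Q%:E.
  apply: lsum_fin => [k|]; first exact: sqr_ge0.
  have := schwartz_sobolev wf 0 pS; congr (_ < _)%E; apply: eq_lsum => k.
  by rewrite powRr0 mul1r.
have [t t0 tE] : exists2 t : R, 0 <= t & lsum (fun k => T k ^+ 2) = t%:E.
  apply: lsum_fin => [k|]; first exact: sqr_ge0.
  by rewrite (le_lt_trans (hC' phi ps))// VE -EFinM ltry.
rewrite [X in (X <= _)%E]VE [X in (_ <= _ * (X + _))%E]tE [X in (_ <= _ * (_ + X))%E]QE.
rewrite -EFinD -EFinM lee_fin.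
have vE : lsum (fun k => (L k `^ m * N k) ^+ 2) = V%:E.
  by rewrite -VE; apply: eq_lsum => k; rewrite powR_double ?(ltW (L_gt0 _))// exprMn.
have hv := @young R n (fun q => weight q ^- 2) (fun l => C * u phi l)
   (fun k => L k `^ m * N k) (3 ^+ n) (exprn_gt0 n (ltr0n R 3)) (fun q => w_ge0 q 2).
have {}hv := hv (fun l => mulr_ge0 C0 (u_ge0 phi l)) (fun k => mulr_ge0 (Lp_ge0 k m) (N0 k))
   (lsum_weightV2 R n) (hC phi ps).
rewrite vE in hv.
have sq3 (x y z : R) : (x + y + z) ^+ 2 <= 3 * (x ^+ 2 + y ^+ 2 + z ^+ 2).
  rewrite -subr_ge0.
  have -> : 3 * (x ^+ 2 + y ^+ 2 + z ^+ 2) - (x + y + z) ^+ 2 =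
    (x - y) ^+ 2 + (y - z) ^+ 2 + (x - z) ^+ 2 by ring.
  by rewrite !addr_ge0 ?sqr_ge0.
have e0 : 0 < 1 / (2 * (K + 1)) by rewrite divr_gt0// mulr_gt0.
(* chosen so that [K * e <= 1/2] *)
set e := 1 / (2 * (K + 1)) in hB e0.
have hu : (lsum (fun k => (C * u phi k) ^+ 2)%R <=
   (3 * C ^+ 2 * (t + (e * V + `|B| * Q) + Q))%:E)%E.
  have -> : (3 * C ^+ 2 * (t + (e * V + `|B| * Q) + Q))%:E =
     lsum (fun k => 3 * C ^+ 2 * (T k ^+ 2 +
      (e * (L k `^ (2 * m) * N k ^+ 2) + `|B| * N k ^+ 2) + N k ^+ 2)).
    have a1 k : 0 <= T k ^+ 2 by exact: sqr_ge0.
    have a2 k : 0 <= N k ^+ 2 by exact: sqr_ge0.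
    have a3 k : 0 <= L k `^ (2 * m) * N k ^+ 2 by rewrite mulr_ge0.
    have a4 k : 0 <= e * (L k `^ (2 * m) * N k ^+ 2) by rewrite mulr_ge0 ?(ltW e0).
    have a5 k : 0 <= `|B| * N k ^+ 2 by rewrite mulr_ge0.
    rewrite lsumZ; last 2 first.
    - by rewrite mulr_ge0 ?sqr_ge0.
    - by move=> k; rewrite !addr_ge0.
    rewrite lsum3//; last by move=> k; rewrite addr_ge0.
    rewrite lsumD// !lsumZ ?(ltW e0)// VE QE tE.
    by [].
  apply: le_lsum => k; rewrite exprMn -[leRHS]mulrA [leRHS]mulrCA.
  rewrite ler_wpM2l ?sqr_ge0// (le_trans (sq3 _ _ _))// ler_wpM2l// lerD2r lerD2l.
  rewrite -/(N k) exprMn -powR_double ?(ltW (L_gt0 _))//.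
  rewrite [e * _]mulrA -mulrDl ler_wpM2r ?sqr_ge0// (le_trans (hB k))// lerD2l.
  exact: ler_norm.
have {}hv : V <= (3 ^+ n) ^+ 2 * (3 * C ^+ 2 * (t + (e * V + `|B| * Q) + Q)).
  by rewrite -lee_fin (le_trans hv)// [leRHS]EFinM lee_wpmul2l.
have Ke : K * e <= 2^-1.
  rewrite /e div1r invfM mulrCA ler_piMr ?invr_ge0// ler_pdivrMr// mul1r.
  by rewrite lerDl.
have h1 : V <= K * t + K * e * V + K * (`|B| + 1) * Q.
  apply: (le_trans hv); rewrite le_eqVlt; apply/orP; left; apply/eqP.
  by rewrite /K; ring.
have h2 : K * e * V <= 2^-1 * V by rewrite ler_wpM2r.
have h3 : V <= 2 * (K * t) + 2 * (K * (`|B| + 1) * Q) by lra.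
apply: (le_trans h3).
have b1 : 0 <= K * Q by rewrite mulr_ge0.
have b2 : 0 <= K * (`|B| + 1) * t by rewrite !mulr_ge0 ?addr_ge0.
have -> : (2 * K + 2 * K * (`|B| + 1)) * (t + Q) = 2 * (K * t) +
   2 * (K * (`|B| + 1) * Q) + (2 * (K * Q) + 2 * (K * (`|B| + 1) * t)) by ring.
by rewrite lerDl; lra.
Qed.

End EllipticEstimate.

(** * The domain of the minimal operator *)

Section EllTwo.
Variables (R : realType) (n : nat).
Local Notation Zn := 'rV[int]_n.
Implicit Types (u : nat -> Zn -> R[i]%C) (w g f : Zn -> R[i]%C).

Lemma poweR_half_le (x : \bar R) (d : R) : (0 <= x)%E -> 0 <= d ->
  (x `^ 2^-1 <= d%:E)%E <-> (x <= (d ^+ 2)%:E)%E.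
Proof.
move=> x0 d0; case: x x0 => [s| |]; last by rewrite leeNy_eq.
  rewrite lee_fin => s0; rewrite poweR_EFin !lee_fin powR12_sqrt//; split=> h.
    by rewrite -(sqr_sqrtr s0) lerXn2r ?nnegrE ?sqrtr_ge0.
  by rewrite -(ger0_norm d0) -sqrtr_sqr ler_wsqrtr.
by move=> _; rewrite poweRyr ?invr_eq0// !leye_eq.
Qed.

Definition sqsum w : \bar R := lsum (fun k => normc (w k) ^+ 2).

Lemma sqsum_ge0 w : (0 <= sqsum w)%E.
Proof. by apply: lsum_ge0 => k; exact: sqr_ge0. Qed.

Lemma l2normE w : l2norm w = (sqsum w `^ 2^-1)%E. Proof. by []. Qed.

Lemma ell2P w : ell2 w <-> (sqsum w < +oo)%E.
Proof.
split; rewrite /ell2 /= l2normE; last exact: poweR_lty.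
by apply: lty_poweRy; rewrite invr_eq0.
Qed.

(** Convergence expressed by square sums, which avoids square roots of
    extended reals in the sequel. *)
Lemma l2_cvgP u w : l2_cvg u w <-> ell2 w /\ forall e : R, 0 < e ->
  exists N : nat, forall j, (N <= j)%N -> (sqsum (fun k => u j k - w k)%R <= e%:E)%E.
Proof.
split=> -[hw hu]; split=> //.
  move=> e e0; have se : 0 < Num.sqrt e by rewrite sqrtr_gt0.
  have [[N1 _ h1] h2] := (@fine_cvgP _ _ _ _ _ _).1 hu.
  have /cvgrPdist_le/(_ _ se)[N2 _ h3] := h2.
  exists (maxn N1 N2) => j; rewrite geq_max => /andP[j1 j2].
  rewrite -(sqr_sqrtr (ltW e0)); apply/poweR_half_le; rewrite ?sqsum_ge0 ?sqrtr_ge0//.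
  rewrite -l2normE -(fineK (h1 j j1)) lee_fin.
  by have := h3 j j2; rewrite /= sub0r normrN => /(le_trans (ler_norm _)).
have fin (e : R) : 0 < e -> exists N : nat, forall j, (N <= j)%N ->
    (l2norm (fun k => u j k - w k)%R <= e%:E)%E.
  move=> e0; have [N hN] := hu _ (exprn_gt0 2 e0).
  exists N => j Nj; rewrite l2normE; apply/poweR_half_le; rewrite ?sqsum_ge0 ?(ltW e0)//.
  exact: hN.
have ge0 j : (0 <= l2norm (fun k => (u j k - w k)%R))%E by exact: poweR_ge0.
apply/fine_cvgP; split.
  have [N hN] := fin 1 ltr01; exists N => // j /= Nj.
  by rewrite ge0_fin_numE// (le_lt_trans (hN j Nj)) ?ltry.
apply/cvgrPdist_le => e e0; have [N hN] := fin e e0.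
exists N => // j /= Nj; rewrite sub0r normrN ger0_norm; last exact: fine_ge0.
have hj := hN j Nj.
by rewrite -lee_fin fineK// ge0_fin_numE// (le_lt_trans hj) ?ltry.
Qed.

Lemma normc_sqrD (z w : R[i]%C) :
  normc (z + w) ^+ 2 <= 2 * normc z ^+ 2 + 2 * normc w ^+ 2.
Proof.
apply: (@le_trans _ _ ((normc z + normc w) ^+ 2)).
  by rewrite lerXn2r ?nnegrE ?addr_ge0 ?normc_ge0 ?ler_normcD.
rewrite -subr_ge0.
have -> : 2 * normc z ^+ 2 + 2 * normc w ^+ 2 - (normc z + normc w) ^+ 2
  = (normc z - normc w) ^+ 2 by ring.
exact: sqr_ge0.
Qed.

Lemma sqsumD f g :
  (sqsum (fun k => (f k + g k)%R) <= 2%:E * sqsum f + 2%:E * sqsum g)%E.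
Proof.
rewrite /sqsum -!lsumZ//; try by move=> k; exact: sqr_ge0.
rewrite -lsumD; try by move=> k; rewrite mulr_ge0 ?sqr_ge0.
by apply: le_lsum => k; exact: normc_sqrD.
Qed.

Lemma ell2_tempered g : ell2 g -> tempered g.
Proof.
move=> /ell2P h.
have [S S0 SE] := lsum_fin (fun k => sqr_ge0 (normc (g k))) h.
exists 0%N, (Num.sqrt S) => k; rewrite expr0 mulr1.
rewrite -(ger0_norm (normc_ge0 _)) -sqrtr_sqr ler_wsqrtr// -lee_fin -SE.
by apply: (@lsum_single _ _ (fun k => normc (g k) ^+ 2)) => q; exact: sqr_ge0.
Qed.

End EllTwo.

Section Domain.
Variables (R : realType) (n : nat).
Local Notation Zn := 'rV[int]_n.
Variables (mu0 mu1 mu rho m : R) (L : Zn -> R) (sigma : Zn -> 'rV[R]_n -> R[i]%C).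
Hypotheses (wf : weight_function mu0 mu1 mu L) (rho_gt0 : 0 < rho)
  (sS : symbol_S rho L m sigma).
Implicit Types (phi g : Zn -> R[i]%C).

Let L_gt0 k : 0 < L k. Proof. by have [_ h _ _] := wf. Qed.
Let Lp_ge0 k t : 0 <= L k `^ t. Proof. exact: powR_ge0. Qed.

Definition sobolev_sum g : \bar R := lsum (fun k => L k `^ (2 * m) * normc (g k) ^+ 2).

Let sob_ge0 g k : 0 <= L k `^ (2 * m) * normc (g k) ^+ 2.
Proof. by rewrite mulr_ge0 ?sqr_ge0. Qed.

Lemma sobolevP g : sobolev L m g <-> tempered g /\ (sobolev_sum g < +oo)%E.
Proof.
rewrite /sobolev /= /sobolev_norm -/(sobolev_sum g).
split=> -[tg h]; split=> //; last exact: poweR_lty.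
by move: h; apply: lty_poweRy; rewrite invr_eq0.
Qed.

Lemma sobolev_ell2 g : 0 <= m -> sobolev L m g -> ell2 g.
Proof.
move=> m0 /sobolevP[_ h]; apply/ell2P.
have [c c0 hc] := weight_function_lower wf.
have cm : 0 < c `^ (2 * m) by exact: powR_gt0.
have [S S0 SE] := lsum_fin (sob_ge0 g) h.
have le k : normc (g k) ^+ 2 <= (c `^ (2 * m))^-1 * (L k `^ (2 * m) * normc (g k) ^+ 2).
  rewrite mulrA ler_peMl ?sqr_ge0// mulrC ler_pdivlMr// mul1r.
  by apply: ge0_ler_powR; rewrite ?nnegrE ?mulr_ge0 ?(ltW c0) ?(ltW (L_gt0 k)).
rewrite (le_lt_trans (le_lsum le))// lsumZ ?invr_ge0 ?(ltW cm)//.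
by rewrite SE -EFinM ltry.
Qed.

Lemma minimal_dom_ell2 g : minimal_dom sigma g -> ell2 g.
Proof. by move=> [f [phi [_ [h _] _]]]. Qed.

(** The a priori estimate bounds the Sobolev norms of an
    approximating sequence; on each box of the lattice the bound passes to the
    limit [g]. *)
Lemma minimal_dom_sobolev g : M_elliptic L m sigma -> minimal_dom sigma g -> sobolev L m g.
Proof.
move=> ell [f [phi [pS /l2_cvgP[gl2 hg] /l2_cvgP[fl2 hf]]]].
have [C C0 hC] := elliptic_estimate wf rho_gt0 sS ell.
apply/sobolevP; split; first exact: ell2_tempered.
have [G G0 GE] := lsum_fin (fun k => sqr_ge0 (normc (g k))) ((ell2P g).1 gl2).
have [F F0 FE] := lsum_fin (fun k => sqr_ge0 (normc (f k))) ((ell2P f).1 fl2).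
have bound (u w : Zn -> R[i]%C) (W e : R) : sqsum w = W%:E ->
    (sqsum (fun k => (u k - w k)%R) <= e%:E)%E -> (sqsum u <= (2 * e + 2 * W)%:E)%E.
  move=> wW ue.
  have -> : u = (fun k => (u k - w k) + w k) by apply/funext => k; rewrite subrK.
  rewrite (le_trans (sqsumD _ _))// wW [leRHS]EFinD !EFinM leeD2r//.
  by rewrite lee_wpmul2l// lee_fin.
pose B := C * ((2 + 2 * F) + (2 + 2 * G)).
have hB j : (sqsum (fun k => (phi j k - g k)%R) <= 1%:E)%E ->
    (sqsum (fun k => (pseudo_op sigma (phi j) k - f k)%R) <= 1%:E)%E ->
    (sobolev_sum (phi j) <= B%:E)%E.
  move=> h1 h2; rewrite (le_trans (hC (phi j) (pS j)))// /B EFinM lee_wpmul2l ?lee_fin//.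
  rewrite [leRHS]EFinD leeD//.
    by have := bound _ _ _ _ FE h2; rewrite mulr1.
  by have := bound _ _ _ _ GE h1; rewrite mulr1.
have B0 : 0 <= B by rewrite mulr_ge0 ?addr_ge0 ?mulr_ge0.
apply: (@le_lt_trans _ _ (2 * B + 1)%:E); last by rewrite ltry.
apply: lsum_le_box_sum => // K.
pose w := box_sum K (fun k : Zn => L k `^ (2 * m)).
have w0 : 0 <= w by apply: sumr_ge0 => k _.
have w1 : 0 < 2 * w + 1 by rewrite ltr_wpDl ?mulr_ge0.
have [N1 h1] := hg _ ltr01; have [N2 h2] := hf _ ltr01.
(* on a fixed box the weights [L^{2m}] have the finite sum [w], so l^2
   convergence is enough there *)
have [N3 h3] := hg _ (divr_gt0 ltr01 w1).
pose j := maxn N1 (maxn N2 N3).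
have j1 : (N1 <= j)%N by exact: leq_maxl.
have j2 : (N2 <= j)%N by rewrite /j !leq_max leqnn orbT.
have j3 : (N3 <= j)%N by rewrite /j !leq_max leqnn !orbT.
have sb : box_sum K (fun k => L k `^ (2 * m) * normc (phi j k) ^+ 2) <= B.
  rewrite -lee_fin (le_trans _ (hB j (h1 j j1) (h2 j j2)))//.
  exact: box_sum_le_lsum (sob_ge0 (phi j)).
apply: (@le_trans _ _ (2 * box_sum K (fun k => L k `^ (2 * m) * normc (phi j k) ^+ 2) +
    2 * w * (1 / (2 * w + 1)))).
  set d := 1 / (2 * w + 1) in h3 *.
  rewrite -mulrA /w /box_sum mulr_suml !mulr_sumr -big_split /=; apply: ler_sum => k _.
  have -> : 2 * (L k `^ (2 * m) * normc (phi j k) ^+ 2) + 2 * (L k `^ (2 * m) * d) =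
    L k `^ (2 * m) * (2 * normc (phi j k) ^+ 2 + 2 * d) by ring.
  rewrite ler_wpM2l//.
  have -> : g k = phi j k + (g k - phi j k) by rewrite addrC subrK.
  rewrite (le_trans (normc_sqrD _ _))// lerD2l ler_wpM2l//.
  rewrite normcBC -lee_fin (le_trans _ (h3 j j3))//.
  by apply: (@lsum_single _ _ (fun k => normc (phi j k - g k) ^+ 2)) => q; exact: sqr_ge0.
rewrite lerD ?ler_wpM2l// mulrA mulr1 ler_pdivrMr// mul1r.
by rewrite lerDl.
Qed.

Definition truncate g (j : nat) : Zn -> R[i]%C := fun k => if k \in box n j then g k else 0.

Lemma truncate_schwartz g j : schwartz (truncate g j).
Proof.
move=> N; exists (box_sum j (fun k => (1 + znorm R k) ^+ N * normc (g k))) => k.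
have p0 q : 0 <= (1 + znorm R q) ^+ N * normc (g q).
  by rewrite mulr_ge0 ?exprn_ge0 ?addr_ge0 ?sqrtr_ge0 ?normc_ge0.
rewrite /truncate; case: ifP => kj; last by rewrite normc0 mulr0 sumr_ge0.
by rewrite /box_sum (bigD1_seq k) ?box_uniq//= lerDl sumr_ge0.
Qed.

(** A finitely supported function has no tail, so that the error in
    [torus_int_fourier_near] vanishes. *)
Lemma pseudo_op_truncate g j k :
  pseudo_op sigma (truncate g j) k = \sum_(l <- box n j) kernel sigma k l * g l.
Proof.
have ps := schwartz_summable_moment (truncate_schwartz g j).
have [B0 [C0 [hB0 hC0]]] := symbol_nice wf sS k.
have [B [C [hB hC]]] : bounded_lip (fun x => echar k x * sigma k x).
  by apply: bounded_lipM (bounded_lip_echar R k) _; exists B0, C0.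
have tl : (lsum (tail j (fun l => normc (truncate g j l))) <= 0%:E)%E.
  rewrite (_ : lsum _ = 0%E)//; apply: esum1 => l _.
  by rewrite /tail /truncate; case: ifP => // ->; rewrite normc0.
have := torus_int_fourier_near ps hB hC tl.
rewrite mul0rn mulr0 -pseudo_opE => h.
have := subr0_eq (eq0_normc (le_anti (introT andP (conj h (normc_ge0 _))))).
move=> ->; rewrite big_seq [RHS]big_seq; apply: eq_bigr => l lj.
by rewrite /truncate lj fourier_coef_echarM mulrC.
Qed.

(** The truncations of [g] to boxes approximate it both in l^2 and in
    the Sobolev norm; their images converge to the matrix product [f], because
    the error is the matrix applied to a tail of [g]. *)
Lemma sobolev_minimal_dom g : sobolev L m g -> ell2 g -> minimal_dom sigma g.
Proof.
move=> /sobolevP[_ gH] gl2.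
have [C C0 hC] := kernel_l2 wf sS.
have [Ck Ck0 hCk] := kernel_bound wf sS.
have [H H0 HE] := lsum_fin (sob_ge0 g) gH.
pose f k := zsum (fun l => kernel sigma k l * g l).
have kg0 k l : 0 <= normc (kernel sigma k l * g l) by exact: normc_ge0.
have kgfin k : (lsum (fun l => normc (kernel sigma k l * g l)%R) < +oo)%E.
  have w0 (l : Zn) : 0 <= weight (k - l) ^- 2 :> R.
    by rewrite invr_ge0 exprn_ge0 ?weight_ge0.
  have le l : normc (kernel sigma k l * g l) <=
      Ck * weight (k - l) ^- 2 + Ck * (L l `^ (2 * m) * normc (g l) ^+ 2).
    rewrite normcM (le_trans (ler_wpM2r (normc_ge0 _) (hCk k l)))//.
    rewrite -mulrDr -!mulrA ler_wpM2l// powR_double ?(ltW (L_gt0 l))// mulrA.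
    set a := L l `^ m; set b := weight _ ^- 2; set c := normc _.
    have b0 : 0 <= b by exact: w0.
    have b1 : b <= 1.
      by rewrite invf_le1 ?exprn_gt0 ?weight_gt0// exprn_ege1// weight_ge1.
    have a0 : 0 <= a by exact: Lp_ge0.
    have c0 : 0 <= c by exact: normc_ge0.
    have -> : a * b * c = b * (a * c) by ring.
    rewrite -exprMn; set x := a * c.
    have x0 : 0 <= x by exact: mulr_ge0.
    have [x1|x1] := leP x 1.
      by rewrite (@le_trans _ _ b)// ?ler_piMr// lerDl sqr_ge0.
    rewrite (@le_trans _ _ x)// ?ler_piMl//.
    by rewrite ler_wpDl// expr2 ler_peMl// ltW.
  rewrite (le_lt_trans (le_lsum le))// lsumD; last 2 first.
  - by move=> l; rewrite mulr_ge0.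
  - by move=> l; rewrite mulr_ge0.
  rewrite !lsumZ// HE lte_add_pinfty ?ltry//.
  rewrite (lsum_reflect (fun q => weight q ^- 2)).
  rewrite (le_lt_trans (lee_wpmul2l _ (lsum_weightV2 R n)))//.
  by rewrite -EFinM ltry.
have diff j k : ((normc (pseudo_op sigma (truncate g j) k - f k)%R)%:E <=
    lsum (fun l => (2 * tail j (fun l => normc (g l)) l) * normc (kernel sigma k l))%R)%E.
  have t0 l : 0 <= tail j (fun l => normc (kernel sigma k l * g l)) l by exact: tail_ge0.
  have [t tp tE] : exists2 t : R, 0 <= t &
      lsum (tail j (fun l => normc (kernel sigma k l * g l))) = t%:E.
    apply: lsum_fin => //; apply: le_lt_trans (kgfin k); apply: le_lsum => l.
    by rewrite /tail; case: ifP.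
  have h : normc (pseudo_op sigma (truncate g j) k - f k) <= t *+ 2.
    by rewrite normcBC pseudo_op_truncate; apply: zsum_near; rewrite tE.
  apply: (@le_trans _ _ (2%:E * t%:E)%E).
    by rewrite -EFinM lee_fin mulr_natl.
  rewrite -tE -lsumZ//; apply: le_lsum => l.
  by rewrite /tail; case: ifP => _; rewrite ?mulr0 ?mul0r// normcM -mulrA (mulrC (normc (g l))).
have l2diff j : (sqsum (fun k => (pseudo_op sigma (truncate g j) k - f k)%R) <=
    (C * 4)%:E * lsum (tail j (fun l => L l `^ (2 * m) * normc (g l) ^+ 2)%R))%E.
  have := hC _ (fun k => normc (pseudo_op sigma (truncate g j) k - f k)) _ _ (diff j).
  move=> /(_ _ _)/le_trans; apply.
  - by move=> l; rewrite mulr_ge0 ?tail_ge0 ?normc_ge0.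
  - by move=> l; exact: normc_ge0.
  rewrite EFinM -muleA lee_wpmul2l ?lee_fin// -lsumZ//; last first.
    by move=> l; exact: tail_ge0.
  apply: le_lsum => l; rewrite /tail; case: ifP => _.
    by rewrite !mulr0 expr0n mulr0.
  by rewrite le_eqVlt; apply/orP; left; apply/eqP; ring.
have fl2 : ell2 f.
  apply/ell2P.
  have fE : f = (fun k => pseudo_op sigma (truncate g 0) k +
      - (pseudo_op sigma (truncate g 0) k - f k)).
    by apply/funext => k; rewrite opprB addrC subrK.
  rewrite fE (le_lt_trans (sqsumD _ _))// lte_add_pinfty//.
    rewrite lte_mul_pinfty//.
    have [C1 C10 hC1] := pseudo_op_l2 wf sS.
    have tS := truncate_schwartz g 0.
    rewrite (le_lt_trans (hC1 _ (schwartz_summable_moment tS)))//.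
    by rewrite lte_mul_pinfty ?lee_fin// (schwartz_sobolev wf (2 * m) tS).
  rewrite lte_mul_pinfty//.
  have -> : sqsum (fun k => - (pseudo_op sigma (truncate g 0) k - f k)) =
     sqsum (fun k => pseudo_op sigma (truncate g 0) k - f k).
    by apply: eq_lsum => k; rewrite normcN.
  rewrite (le_lt_trans (l2diff 0%N))// lte_mul_pinfty ?lee_fin ?mulr_ge0//.
  apply: le_lt_trans gH; apply: le_lsum => l.
  by rewrite /tail; case: ifP.
exists f, (truncate g); split.
- by move=> j; exact: truncate_schwartz.
- apply/l2_cvgP; split=> // e e0.
  have [N hN] := tail_small (fun k => sqr_ge0 (normc (g k))) ((ell2P g).1 gl2) e0.
  exists N => j Nj; rewrite (le_trans _ (hN j Nj))//; apply: le_lsum => k.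
  rewrite /truncate /tail; case: ifP => _; first by rewrite subrr normc0 expr0n.
  by rewrite sub0r normcN.
- apply/l2_cvgP; split=> // e e0.
  have C4 : 0 < C * 4 + 1 by rewrite ltr_wpDl// mulr_ge0.
  have [N hN] := tail_small (sob_ge0 g) gH (divr_gt0 e0 C4).
  exists N => j Nj; rewrite (le_trans (l2diff j))//.
  have C40 : (0 <= (C * 4)%:E)%E by rewrite lee_fin mulr_ge0.
  apply: (le_trans (lee_wpmul2l C40 (hN j Nj))); rewrite -EFinM lee_fin.
  rewrite mulrCA ler_piMr ?(ltW e0)// ler_pdivrMr// mul1r lerDl.
  exact: ler01.
Qed.

End Domain.

Unset Implicit Arguments.

(* For m < 0 the space H^{m,2} is not contained in l^2, whereas the domain of
   an operator in l^2 is; the equality then holds inside l^2. *)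
Theorem theorem5p17 (R : realType) (n : nat) (mu0 mu1 mu rho : R)
    (L : 'rV[int]_n -> R) (m : R)
    (sigma : 'rV[int]_n -> 'rV[R]_n -> R[i]%C) :
  weight_function mu0 mu1 mu L ->
  0 < rho <= mu^-1 ->
  symbol_M rho L m sigma ->
  M_elliptic L m sigma ->
  sobolev L m `&` @ell2 R n = minimal_dom sigma /\
  (0 <= m -> sobolev L m = minimal_dom sigma).
Proof.
move=> wf /andP[rho0 _] /symbol_M_S sS ell.
have eq : sobolev L m `&` @ell2 R n = minimal_dom sigma.
  apply/seteqP; split=> g.
    by move=> [gH gl2]; exact: sobolev_minimal_dom wf sS _ gH gl2.
  move=> gD; split; last exact: minimal_dom_ell2 gD.
  exact: minimal_dom_sobolev wf rho0 sS _ ell gD.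
split=> // m0; rewrite -eq; apply/seteqP; split=> g; last by case.
by move=> gH; split=> //; exact: sobolev_ell2 wf _ m0 gH.
Qed.
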